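(* Let $f$ and $g$ be arbitrary elements of the free Poisson algebra $P=k\{x_1,x_2,\ldots,x_n\}$ in the variables $x_1,x_2,\ldots,x_n$ over a field $k$ of characteristic zero. Then the following conditions are equivalent: (i) $f$ and $g$ are Poisson dependent; (ii) $H(f)$ and $H(g)$ are left dependent over $P^e$; (iii) $f$ and $g$ are polynomially dependent, i.e., they are algebraically dependent in the polynomial algebra $P$; (iv) there exists $a\in P$ such that $f,g\in k[a]$; (v) $\{f,g\}=0$ in $P$.
   Context: A Poisson algebra over $k$ is a commutative associative algebra with identity $1$ endowed with a Lie bracket $\{x,y\}$ such that $\{x,yz\}=\{x,y\}z+y\{x,z\}$. $k\{x_1,\ldots,x_n\}$ is the free Poisson algebra on $x_1,\ldots,x_n$; as a commutative associative algebra it is the polynomial algebra in the elements of a linear basis of the free Lie algebra on $x_1,\ldots,x_n$. For a Poisson algebra $P$, the universal enveloping algebra $P^e$ is the associative unital $k$-algebra generated by two copies $m_P=\{m_a: a\in P\}$, $h_P=\{h_a: a\in P\}$ of the vector space $P$ (with $a\mapsto m_a$, $a\mapsto h_a$ linear) subject to the relations, for all $x,y\in P$: $m_{xy}=m_xm_y$, $h_{\{x,y\}}=h_xh_y-h_yh_x$, $h_{xy}=m_yh_x+m_xh_y$, $m_{\{x,y\}}=h_xm_y-m_yh_x$, $m_1=1$. The map $x\mapsto m_x$ is injective and $m_x$ is identified with $x$. $H:P\to P^e$ is the map $H(p)=h_p$. Elements $f_1,\ldots,f_m$ of $P$ are Poisson free (Poisson independent) if the Poisson subalgebra of $P$ they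 generate is the free Poisson algebra with free generators $f_1,\ldots,f_m$; otherwise they are Poisson dependent. Elements $s_1,\ldots,s_m\in P^e$ are left dependent over $P^e$ if there are $u_1,\ldots,u_m\in P^e$, not all zero, with $\sum u_is_i=0$. *)

(* Defs.v *)
(* Mathematical Components, with classical reasoning from boolp. *)
From HB Require Import structures.
From mathcomp Require Import all_boot all_algebra.
From mathcomp Require Import boolp.
From mathcomp Require Import mpoly.

Set Implicit Arguments.
Unset Strict Implicit.
Unset Printing Implicit Defensive.

Import GRing.Theory.
Local Open Scope ring_scope.
Local Open Scope quotient_scope.

HB.mixin Record isPoisson (k : fieldType) P of GRing.ComAlgebra k P := {
  bracket : P -> P -> P;
  bracketPl : forall (c : k) (x y z : P),
    bracket (c *: x + y) z = c *: bracket x z + bracket y z;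
  bracketPr : forall (c : k) (x y z : P),
    bracket x (c *: y + z) = c *: bracket x y + bracket x z;
  bracketxx : forall x : P, bracket x x = 0;
  bracket_jacobi : forall x y z : P,
    bracket x (bracket y z) + bracket y (bracket z x)
    + bracket z (bracket x y) = 0;
  bracketM : forall x y z : P,
    bracket x (y * z) = bracket x y * z + y * bracket x z
}.

#[short(type="poissonType")]
HB.structure Definition Poisson (k : fieldType) :=
  {P of isPoisson k P & GRing.ComAlgebra k P}.

Section PoissonTheory.
Variables (k : fieldType) (P : poissonType k).
Implicit Types (x y z : P) (c : k).

Lemma bracketDl x y z : bracket (x + y) z = bracket x z + bracket y z.
Proof. by rewrite -[x in LHS]scale1r bracketPl scale1r. Qed.

Lemma bracketDr x y z : bracket x (y + z) = bracket x y + bracket x z.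
Proof. by rewrite -[y in LHS]scale1r bracketPr scale1r. Qed.

Lemma bracket0l z : bracket 0 z = 0 :> P.
Proof. by apply: (addIr (bracket 0 z)); rewrite -bracketDl !add0r. Qed.

Lemma bracket0r z : bracket z 0 = 0 :> P.
Proof. by apply: (addIr (bracket z 0)); rewrite -bracketDr !add0r. Qed.

Lemma bracketZl c x z : bracket (c *: x) z = c *: bracket x z.
Proof. by rewrite -[c *: x in LHS]addr0 bracketPl bracket0l addr0. Qed.

Lemma bracketZr c x z : bracket x (c *: z) = c *: bracket x z.
Proof. by rewrite -[c *: z in LHS]addr0 bracketPr bracket0r addr0. Qed.

Lemma bracketC x y : bracket x y = - bracket y x.
Proof.
apply/eqP; rewrite -addr_eq0; apply/eqP; move: (bracketxx (x + y)).
by rewrite bracketDl !bracketDr !bracketxx add0r addr0.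
Qed.

Lemma bracketMl x y z : bracket (x * y) z = y * bracket x z + x * bracket y z.
Proof.
rewrite bracketC bracketM (bracketC z x) (bracketC z y).
by rewrite mulNr mulrN opprD !opprK [bracket x z * y]mulrC.
Qed.

End PoissonTheory.

Definition poisson_morphism (k : fieldType) (P Q : poissonType k)
    (phi : {lrmorphism P -> Q}) : Prop :=
  forall x y : P, phi (bracket x y) = bracket (phi x) (phi y).

Definition free_poisson_on (k : fieldType) (P : poissonType k) (m : nat)
    (x : 'I_m -> P) : Prop :=
  forall (Q : poissonType k) (y : 'I_m -> Q),
  exists phi : {lrmorphism P -> Q},
    [/\ poisson_morphism phi, (forall i, phi (x i) = y i)
      & forall psi : {lrmorphism P -> Q}, poisson_morphism psi ->
          (forall i, psi (x i) = y i) -> psi =1 phi].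

(* The free Poisson algebra k{x_1, ..., x_n}: formal Poisson expressions in n
   variables, modulo the least congruence containing the Poisson algebra laws.
   PScal c denotes c times the identity, so that c *: x is PMul (PScal c) x. *)
Section FreePoisson.
Variables (k : fieldType) (n : nat).

Inductive pexpr : Type :=
| PVar of 'I_n
| PScal of k
| PAdd of pexpr & pexpr
| PMul of pexpr & pexpr
| PBr of pexpr & pexpr.

Inductive pexpr_eq : pexpr -> pexpr -> Prop :=
| peq_refl a : pexpr_eq a a
| peq_sym a b : pexpr_eq a b -> pexpr_eq b a
| peq_trans a b c : pexpr_eq a b -> pexpr_eq b c -> pexpr_eq a c
| peq_add a a' b b' :
    pexpr_eq a a' -> pexpr_eq b b' -> pexpr_eq (PAdd a b) (PAdd a' b')
| peq_mul a a' b b' :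
    pexpr_eq a a' -> pexpr_eq b b' -> pexpr_eq (PMul a b) (PMul a' b')
| peq_br a a' b b' :
    pexpr_eq a a' -> pexpr_eq b b' -> pexpr_eq (PBr a b) (PBr a' b')
| peq_scalD c d : pexpr_eq (PScal (c + d)) (PAdd (PScal c) (PScal d))
| peq_scalM c d : pexpr_eq (PScal (c * d)) (PMul (PScal c) (PScal d))
| peq_addA a b c : pexpr_eq (PAdd a (PAdd b c)) (PAdd (PAdd a b) c)
| peq_addC a b : pexpr_eq (PAdd a b) (PAdd b a)
| peq_add0 a : pexpr_eq (PAdd (PScal 0) a) a
| peq_addN a : pexpr_eq (PAdd (PMul (PScal (-1)) a) a) (PScal 0)
| peq_mulA a b c : pexpr_eq (PMul a (PMul b c)) (PMul (PMul a b) c)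
| peq_mulC a b : pexpr_eq (PMul a b) (PMul b a)
| peq_mul1 a : pexpr_eq (PMul (PScal 1) a) a
| peq_mulDl a b c :
    pexpr_eq (PMul (PAdd a b) c) (PAdd (PMul a c) (PMul b c))
| peq_brPl s a b c :
    pexpr_eq (PBr (PAdd (PMul (PScal s) a) b) c)
             (PAdd (PMul (PScal s) (PBr a c)) (PBr b c))
| peq_brPr s a b c :
    pexpr_eq (PBr a (PAdd (PMul (PScal s) b) c))
             (PAdd (PMul (PScal s) (PBr a b)) (PBr a c))
| peq_brxx a : pexpr_eq (PBr a a) (PScal 0)
| peq_jacobi a b c :
    pexpr_eq (PAdd (PAdd (PBr a (PBr b c)) (PBr b (PBr c a)))
                   (PBr c (PBr a b)))
             (PScal 0)
| peq_brM a b c :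
    pexpr_eq (PBr a (PMul b c)) (PAdd (PMul (PBr a b) c) (PMul b (PBr a c))).

HB.instance Definition _ := gen_eqMixin pexpr.
HB.instance Definition _ := gen_choiceMixin pexpr.

Definition pexpr_eqb (a b : pexpr) : bool := `[< pexpr_eq a b >].

Lemma pexpr_eqb_refl : reflexive pexpr_eqb.
Proof. by move=> a; apply/asboolP; apply: peq_refl. Qed.

Lemma pexpr_eqb_sym : ssrbool.symmetric pexpr_eqb.
Proof. by move=> a b; apply/asboolP/asboolP; apply: peq_sym. Qed.

Lemma pexpr_eqb_trans : transitive pexpr_eqb.
Proof.
by move=> b a c /asboolP ab /asboolP bc; apply/asboolP; apply: peq_trans bc.
Qed.

Canonical pexpr_equiv := EquivRel pexpr_eqb
  pexpr_eqb_refl pexpr_eqb_sym pexpr_eqb_trans.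

Definition freePoisson := {eq_quot pexpr_equiv}.

HB.instance Definition _ := Choice.on freePoisson.
HB.instance Definition _ := EqQuotient.on freePoisson.

Definition fp_class (a : pexpr) : freePoisson := \pi_freePoisson a.

Lemma fp_eqP a b : fp_class a = fp_class b <-> pexpr_eq a b.
Proof.
by split=> [/eqmodP/asboolP | ab]; [|apply/eqmodP/asboolP].
Qed.

Lemma fp_reprK x : fp_class (repr x) = x.
Proof. exact: reprK. Qed.

Lemma fp_repr_class a : pexpr_eq (repr (fp_class a)) a.
Proof. by apply/fp_eqP; rewrite fp_reprK. Qed.

Lemma fp_ind (A : freePoisson -> Prop) :
  (forall a, A (fp_class a)) -> forall x, A x.
Proof. by move=> IH x; rewrite -[x]fp_reprK. Qed.

Definition fp_scal (c : k) : freePoisson := fp_class (PScal c).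
Definition fp_add (x y : freePoisson) := fp_class (PAdd (repr x) (repr y)).
Definition fp_mul (x y : freePoisson) := fp_class (PMul (repr x) (repr y)).
Definition fp_br (x y : freePoisson) := fp_class (PBr (repr x) (repr y)).
Definition fp_opp (x : freePoisson) := fp_mul (fp_scal (-1)) x.
Definition fp_scale (c : k) (x : freePoisson) := fp_mul (fp_scal c) x.

Lemma fp_addE a b : fp_add (fp_class a) (fp_class b) = fp_class (PAdd a b).
Proof. by apply/fp_eqP/peq_add; apply: fp_repr_class. Qed.

Lemma fp_mulE a b : fp_mul (fp_class a) (fp_class b) = fp_class (PMul a b).
Proof. by apply/fp_eqP/peq_mul; apply: fp_repr_class. Qed.

Lemma fp_brE a b : fp_br (fp_class a) (fp_class b) = fp_class (PBr a b).
Proof. by apply/fp_eqP/peq_br; apply: fp_repr_class. Qed.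

Let fpE := (fp_addE, fp_mulE, fp_brE).

Lemma fp_addA : associative fp_add.
Proof.
elim/fp_ind=> a; elim/fp_ind=> b; elim/fp_ind=> c.
by rewrite !fpE; apply/fp_eqP/peq_addA.
Qed.

Lemma fp_addC : commutative fp_add.
Proof.
by elim/fp_ind=> a; elim/fp_ind=> b; rewrite !fpE; apply/fp_eqP/peq_addC.
Qed.

Lemma fp_add0 : left_id (fp_scal 0) fp_add.
Proof. by elim/fp_ind=> a; rewrite !fpE; apply/fp_eqP/peq_add0. Qed.

Lemma fp_addN : left_inverse (fp_scal 0) fp_opp fp_add.
Proof.
by elim/fp_ind=> a; rewrite /fp_opp /fp_scal !fpE; apply/fp_eqP/peq_addN.
Qed.

HB.instance Definition _ := GRing.isZmodule.Build freePoisson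
  fp_addA fp_addC fp_add0 fp_addN.

Lemma fp_mulA : associative fp_mul.
Proof.
elim/fp_ind=> a; elim/fp_ind=> b; elim/fp_ind=> c.
by rewrite !fpE; apply/fp_eqP/peq_mulA.
Qed.

Lemma fp_mulC : commutative fp_mul.
Proof.
by elim/fp_ind=> a; elim/fp_ind=> b; rewrite !fpE; apply/fp_eqP/peq_mulC.
Qed.

Lemma fp_mul1 : left_id (fp_scal 1) fp_mul.
Proof. by elim/fp_ind=> a; rewrite !fpE; apply/fp_eqP/peq_mul1. Qed.

Lemma fp_mulDl : left_distributive fp_mul fp_add.
Proof.
elim/fp_ind=> a; elim/fp_ind=> b; elim/fp_ind=> c.
by rewrite !fpE; apply/fp_eqP/peq_mulDl.
Qed.

Fixpoint pexpr_aug (a : pexpr) : k :=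
  match a with
  | PVar _ => 0
  | PScal c => c
  | PAdd a b => pexpr_aug a + pexpr_aug b
  | PMul a b => pexpr_aug a * pexpr_aug b
  | PBr _ _ => 0
  end.

Lemma pexpr_aug_eq a b : pexpr_eq a b -> pexpr_aug a = pexpr_aug b.
Proof.
elim=> //= *; rewrite ?(add0r, addr0, mul0r, mulr0, mul1r, mulN1r, addNr) //.
- by congruence.
- by congruence.
- by congruence.
- exact: addrA.
- exact: addrC.
- exact: mulrA.
- exact: mulrC.
- exact: mulrDl.
Qed.

Lemma fp_1neq0 : fp_scal 1 != 0.
Proof.
by apply/eqP=> /fp_eqP/pexpr_aug_eq/= /eqP; rewrite oner_eq0.
Qed.

HB.instance Definition _ := GRing.Zmodule_isComNzRing.Build freePoisson
  fp_mulA fp_mulC fp_mul1 fp_mulDl fp_1neq0.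

Lemma fp_scaleA c d x : fp_scale c (fp_scale d x) = fp_scale (c * d) x.
Proof.
rewrite /fp_scale fp_mulA; congr fp_mul.
by rewrite fp_mulE; apply/fp_eqP/peq_sym/peq_scalM.
Qed.

Lemma fp_scale1 : left_id 1 fp_scale.
Proof. exact: fp_mul1. Qed.

Lemma fp_scaleDr : right_distributive fp_scale +%R.
Proof. by move=> c x y; apply: (mulrDr (fp_scal c)). Qed.

Lemma fp_scaleDl x : {morph fp_scale^~ x : c d / c + d}.
Proof.
move=> c d; rewrite /fp_scale -[RHS]fp_mulDl; congr fp_mul.
by rewrite fp_addE; apply/fp_eqP/peq_scalD.
Qed.

HB.instance Definition _ := GRing.Zmodule_isLmodule.Build k freePoisson
  fp_scaleA fp_scale1 fp_scaleDr fp_scaleDl.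

Lemma fp_scaleAl (c : k) (x y : freePoisson) : c *: (x * y) = (c *: x) * y.
Proof. exact: fp_mulA. Qed.

HB.instance Definition _ := GRing.Lmodule_isLalgebra.Build k freePoisson
  fp_scaleAl.
HB.instance Definition _ := GRing.Lalgebra_isComAlgebra.Build k freePoisson.

Lemma fp_classZ (c : k) a : c *: fp_class a = fp_class (PMul (PScal c) a).
Proof. exact: fp_mulE. Qed.

Lemma fp_classD a b : fp_class a + fp_class b = fp_class (PAdd a b).
Proof. exact: fp_addE. Qed.

Lemma fp_classM a b : fp_class a * fp_class b = fp_class (PMul a b).
Proof. exact: fp_mulE. Qed.

Lemma fp_class0 : 0 = fp_class (PScal 0).
Proof. by []. Qed.

Lemma fp_brPl (c : k) (x y z : freePoisson) :
  fp_br (c *: x + y) z = c *: fp_br x z + fp_br y z.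
Proof.
elim/fp_ind: x => x; elim/fp_ind: y => y; elim/fp_ind: z => z.
rewrite fp_classZ fp_classD !fp_brE fp_classZ fp_classD.
exact/fp_eqP/peq_brPl.
Qed.

Lemma fp_brPr (c : k) (x y z : freePoisson) :
  fp_br x (c *: y + z) = c *: fp_br x y + fp_br x z.
Proof.
elim/fp_ind: x => x; elim/fp_ind: y => y; elim/fp_ind: z => z.
rewrite fp_classZ fp_classD !fp_brE fp_classZ fp_classD.
exact/fp_eqP/peq_brPr.
Qed.

Lemma fp_brxx (x : freePoisson) : fp_br x x = 0.
Proof. by elim/fp_ind: x => x; rewrite fp_brE; apply/fp_eqP/peq_brxx. Qed.

Lemma fp_jacobi (x y z : freePoisson) :
  fp_br x (fp_br y z) + fp_br y (fp_br z x) + fp_br z (fp_br x y) = 0.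
Proof.
elim/fp_ind: x => x; elim/fp_ind: y => y; elim/fp_ind: z => z.
by rewrite !fp_brE !fp_classD; apply/fp_eqP/peq_jacobi.
Qed.

Lemma fp_brM (x y z : freePoisson) :
  fp_br x (y * z) = fp_br x y * z + y * fp_br x z.
Proof.
elim/fp_ind: x => x; elim/fp_ind: y => y; elim/fp_ind: z => z.
by rewrite fp_classM !fp_brE !fp_classM fp_classD; apply/fp_eqP/peq_brM.
Qed.

HB.instance Definition _ := isPoisson.Build k freePoisson
  fp_brPl fp_brPr fp_brxx fp_jacobi fp_brM.

Definition fpX (i : 'I_n) : freePoisson := fp_class (PVar i).

End FreePoisson.

Section FreePoissonUniversal.
Variables (k : fieldType) (n : nat) (Q : poissonType k) (y : 'I_n -> Q).

Fixpoint pexpr_eval (a : pexpr k n) : Q :=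
  match a with
  | PVar i => y i
  | PScal c => c%:A
  | PAdd a b => pexpr_eval a + pexpr_eval b
  | PMul a b => pexpr_eval a * pexpr_eval b
  | PBr a b => bracket (pexpr_eval a) (pexpr_eval b)
  end.

Lemma pexpr_eval_eq a b : pexpr_eq a b -> pexpr_eval a = pexpr_eval b.
Proof.
elim=> //=.
- by move=> ? ? ? _ -> _ ->.
- by move=> ? ? ? ? _ -> _ ->.
- by move=> ? ? ? ? _ -> _ ->.
- by move=> ? ? ? ? _ -> _ ->.
- by move=> *; rewrite scalerDl.
- by move=> *; rewrite -scalerAl mul1r scalerA.
- by move=> *; rewrite addrA.
- by move=> *; rewrite addrC.
- by move=> *; rewrite scale0r add0r.
- by move=> *; rewrite scaleN1r mulN1r addNr scale0r.
- by move=> *; rewrite mulrA.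
- by move=> *; rewrite mulrC.
- by move=> *; rewrite scale1r mul1r.
- by move=> *; rewrite mulrDl.
- by move=> *; rewrite -!scalerAl !mul1r bracketPl.
- by move=> *; rewrite -!scalerAl !mul1r bracketPr.
- by move=> *; rewrite bracketxx scale0r.
- by move=> *; rewrite bracket_jacobi scale0r.
- by move=> *; rewrite bracketM.
Qed.

Definition fp_lift (x : freePoisson k n) : Q := pexpr_eval (repr x).

Lemma fp_lift_class a : fp_lift (fp_class a) = pexpr_eval a.
Proof. exact/pexpr_eval_eq/fp_repr_class. Qed.

Lemma fp_lift_linear : linear fp_lift.
Proof.
move=> c; elim/fp_ind=> a; elim/fp_ind=> b.
by rewrite fp_classZ fp_classD !fp_lift_class /= -scalerAl mul1r.
Qed.

Lemma fp_lift_monoid : monoid_morphism fp_lift.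
Proof.
split; first exact: etrans (fp_lift_class (PScal n 1)) (scale1r _).
by elim/fp_ind=> a; elim/fp_ind=> b; rewrite fp_classM !fp_lift_class.
Qed.

Lemma fp_lift_bracket : {morph fp_lift : u v / bracket u v}.
Proof.
elim/fp_ind=> a; elim/fp_ind=> b.
rewrite -[bracket (fp_class a) _]/(fp_br _ _) fp_brE.
by rewrite !fp_lift_class.
Qed.

HB.instance Definition _ := GRing.isLinear.Build k (freePoisson k n) Q _ fp_lift
  fp_lift_linear.
HB.instance Definition _ :=
  GRing.isMonoidMorphism.Build (freePoisson k n) Q fp_lift fp_lift_monoid.

End FreePoissonUniversal.

Lemma freePoisson_free (k : fieldType) (n : nat) :
  free_poisson_on (@fpX k n).
Proof.
move=> Q y; exists (fp_lift y); split.
- exact: fp_lift_bracket.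
- by move=> i; apply: fp_lift_class.
move=> psi psiB psiX; elim/fp_ind=> x; rewrite /= fp_lift_class.
elim: x => [i|c|a IHa b IHb|a IHa b IHb|a IHa b IHb] /=.
- exact: psiX.
- have ->: fp_class (PScal n c) = c%:A.
    rewrite fp_classZ; apply/fp_eqP/peq_sym.
    exact: peq_trans (peq_mulC _ _) (peq_mul1 _).
  by rewrite linearZ /= rmorph1.
- by rewrite -fp_classD rmorphD /= IHa IHb.
- by rewrite -fp_classM rmorphM /= IHa IHb.
- by rewrite -fp_brE psiB /= IHa IHb.
Qed.

Section PoissonSubalgebra.
Variables (k : fieldType) (P : poissonType k).

Definition bracket_closed (S : {pred P}) : Prop :=
  {in S &, forall x y, bracket x y \in S}.

Definition poisson_subalg_closed (S : {pred P}) : Prop :=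
  GRing.subalg_closed S /\ bracket_closed S.

Variables (m : nat) (f : 'I_m -> P).

Definition poisson_span : {pred P} :=
  fun x => `[< forall S : {pred P}, poisson_subalg_closed S ->
                 (forall i, f i \in S) -> x \in S >].

Lemma poisson_spanP x :
  reflect (forall S : {pred P}, poisson_subalg_closed S ->
             (forall i, f i \in S) -> x \in S) (x \in poisson_span).
Proof. exact: asboolP. Qed.

Lemma poisson_span_gen i : f i \in poisson_span.
Proof. exact/poisson_spanP. Qed.

Lemma poisson_span_subalg : GRing.subalg_closed poisson_span.
Proof.
split.
- by apply/poisson_spanP=> S [[]].
- move=> c x y /poisson_spanP Sx /poisson_spanP Sy.
  apply/poisson_spanP=> S cS fS.
  by have [[_ linS _] _] := cS; apply: linS; [apply: Sx | apply: Sy].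
- move=> x y /poisson_spanP Sx /poisson_spanP Sy; apply/poisson_spanP=> S cS fS.
  by have [[_ _ mulS] _] := cS; apply: mulS; [apply: Sx | apply: Sy].
Qed.

Lemma poisson_span_bracket : bracket_closed poisson_span.
Proof.
move=> x y /poisson_spanP Sx /poisson_spanP Sy; apply/poisson_spanP=> S cS fS.
by have [_ brS] := cS; apply: brS; [apply: Sx | apply: Sy].
Qed.

HB.instance Definition _ :=
  GRing.isSubalgClosed.Build k P poisson_span poisson_span_subalg.

Definition poisson_subalg : Type := {x : P | x \in poisson_span}.

HB.instance Definition _ := [isSub of poisson_subalg for @sval P _].
HB.instance Definition _ := [Choice of poisson_subalg by <:].
HB.instance Definition _ :=
  [SubChoice_isSubAlgebra of poisson_subalg by <:].
HB.instance Definition _ := [SubNzRing_isSubComNzRing of poisson_subalg by <:].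

Definition psub_bracket (x y : poisson_subalg) : poisson_subalg :=
  Sub (bracket (val x) (val y)) (poisson_span_bracket (valP x) (valP y)).

Lemma psub_brPl (c : k) (x y z : poisson_subalg) :
  psub_bracket (c *: x + y) z = c *: psub_bracket x z + psub_bracket y z.
Proof. by apply: val_inj; rewrite /= bracketPl. Qed.

Lemma psub_brPr (c : k) (x y z : poisson_subalg) :
  psub_bracket x (c *: y + z) = c *: psub_bracket x y + psub_bracket x z.
Proof. by apply: val_inj; rewrite /= bracketPr. Qed.

Lemma psub_brxx (x : poisson_subalg) : psub_bracket x x = 0.
Proof. by apply: val_inj; rewrite /= bracketxx. Qed.

Lemma psub_jacobi (x y z : poisson_subalg) :
  psub_bracket x (psub_bracket y z) + psub_bracket y (psub_bracket z x)
  + psub_bracket z (psub_bracket x y) = 0.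
Proof. by apply: val_inj; rewrite /= bracket_jacobi. Qed.

Lemma psub_brM (x y z : poisson_subalg) :
  psub_bracket x (y * z) = psub_bracket x y * z + y * psub_bracket x z.
Proof. by apply: val_inj; rewrite /= bracketM. Qed.

HB.instance Definition _ := isPoisson.Build k poisson_subalg
  psub_brPl psub_brPr psub_brxx psub_jacobi psub_brM.

Definition psub_gen (i : 'I_m) : poisson_subalg :=
  Sub (f i) (poisson_span_gen i).

Definition poisson_free : Prop := free_poisson_on psub_gen.

Definition poisson_dependent : Prop := ~ poisson_free.

End PoissonSubalgebra.

(* The universal enveloping algebra P^e: formal noncommutative expressions in
   the symbols m_a and h_a (a : P) and the scalars, modulo the least congruence
   containing the associative unital algebra laws, the linearity of m and h and
   the defining relations. *)
Section Envelope.
Variables (k : fieldType) (P : poissonType k).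

Inductive eexpr : Type :=
| EM of P
| EH of P
| EScal of k
| EAdd of eexpr & eexpr
| EMul of eexpr & eexpr.

Definition EOpp (a : eexpr) : eexpr := EMul (EScal (-1)) a.

Inductive eexpr_eq : eexpr -> eexpr -> Prop :=
| eeq_refl a : eexpr_eq a a
| eeq_sym a b : eexpr_eq a b -> eexpr_eq b a
| eeq_trans a b c : eexpr_eq a b -> eexpr_eq b c -> eexpr_eq a c
| eeq_add a a' b b' :
    eexpr_eq a a' -> eexpr_eq b b' -> eexpr_eq (EAdd a b) (EAdd a' b')
| eeq_mul a a' b b' :
    eexpr_eq a a' -> eexpr_eq b b' -> eexpr_eq (EMul a b) (EMul a' b')
| eeq_scalD c d : eexpr_eq (EScal (c + d)) (EAdd (EScal c) (EScal d))
| eeq_scalM c d : eexpr_eq (EScal (c * d)) (EMul (EScal c) (EScal d))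
| eeq_scalC c a : eexpr_eq (EMul (EScal c) a) (EMul a (EScal c))
| eeq_addA a b c : eexpr_eq (EAdd a (EAdd b c)) (EAdd (EAdd a b) c)
| eeq_addC a b : eexpr_eq (EAdd a b) (EAdd b a)
| eeq_add0 a : eexpr_eq (EAdd (EScal 0) a) a
| eeq_addN a : eexpr_eq (EAdd (EOpp a) a) (EScal 0)
| eeq_mulA a b c : eexpr_eq (EMul a (EMul b c)) (EMul (EMul a b) c)
| eeq_mul1l a : eexpr_eq (EMul (EScal 1) a) a
| eeq_mulDl a b c :
    eexpr_eq (EMul (EAdd a b) c) (EAdd (EMul a c) (EMul b c))
| eeq_mulDr a b c :
    eexpr_eq (EMul a (EAdd b c)) (EAdd (EMul a b) (EMul a c))
| eeq_mlin c x y :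
    eexpr_eq (EM (c *: x + y)) (EAdd (EMul (EScal c) (EM x)) (EM y))
| eeq_hlin c x y :
    eexpr_eq (EH (c *: x + y)) (EAdd (EMul (EScal c) (EH x)) (EH y))
| eeq_mM x y : eexpr_eq (EM (x * y)) (EMul (EM x) (EM y))
| eeq_hB x y :
    eexpr_eq (EH (bracket x y))
             (EAdd (EMul (EH x) (EH y)) (EOpp (EMul (EH y) (EH x))))
| eeq_hM x y :
    eexpr_eq (EH (x * y)) (EAdd (EMul (EM y) (EH x)) (EMul (EM x) (EH y)))
| eeq_mB x y :
    eexpr_eq (EM (bracket x y))
             (EAdd (EMul (EH x) (EM y)) (EOpp (EMul (EM y) (EH x))))
| eeq_m1 : eexpr_eq (EM 1) (EScal 1).

HB.instance Definition _ := gen_eqMixin eexpr.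
HB.instance Definition _ := gen_choiceMixin eexpr.

Definition eexpr_eqb (a b : eexpr) : bool := `[< eexpr_eq a b >].

Lemma eexpr_eqb_refl : reflexive eexpr_eqb.
Proof. by move=> a; apply/asboolP; apply: eeq_refl. Qed.

Lemma eexpr_eqb_sym : ssrbool.symmetric eexpr_eqb.
Proof. by move=> a b; apply/asboolP/asboolP; apply: eeq_sym. Qed.

Lemma eexpr_eqb_trans : transitive eexpr_eqb.
Proof.
by move=> b a c /asboolP ab /asboolP bc; apply/asboolP; apply: eeq_trans bc.
Qed.

Canonical eexpr_equiv := EquivRel eexpr_eqb
  eexpr_eqb_refl eexpr_eqb_sym eexpr_eqb_trans.

Definition envelope := {eq_quot eexpr_equiv}.

HB.instance Definition _ := Choice.on envelope.
HB.instance Definition _ := EqQuotient.on envelope.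

Definition env_class (a : eexpr) : envelope := \pi_envelope a.

Lemma env_eqP a b : env_class a = env_class b <-> eexpr_eq a b.
Proof.
by split=> [/eqmodP/asboolP | ab]; [|apply/eqmodP/asboolP].
Qed.

Lemma env_reprK x : env_class (repr x) = x.
Proof. exact: reprK. Qed.

Lemma env_repr_class a : eexpr_eq (repr (env_class a)) a.
Proof. by apply/env_eqP; rewrite env_reprK. Qed.

Lemma env_ind (A : envelope -> Prop) :
  (forall a, A (env_class a)) -> forall x, A x.
Proof. by move=> IH x; rewrite -[x]env_reprK. Qed.

Definition env_scal (c : k) : envelope := env_class (EScal c).
Definition env_add (x y : envelope) := env_class (EAdd (repr x) (repr y)).
Definition env_mul (x y : envelope) := env_class (EMul (repr x) (repr y)).
Definition env_opp (x : envelope) := env_mul (env_scal (-1)) x.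
Definition env_scale (c : k) (x : envelope) := env_mul (env_scal c) x.

Lemma env_addE a b : env_add (env_class a) (env_class b) = env_class (EAdd a b).
Proof. by apply/env_eqP/eeq_add; apply: env_repr_class. Qed.

Lemma env_mulE a b : env_mul (env_class a) (env_class b) = env_class (EMul a b).
Proof. by apply/env_eqP/eeq_mul; apply: env_repr_class. Qed.

Let envE := (env_addE, env_mulE).

Lemma env_addA : associative env_add.
Proof.
elim/env_ind=> a; elim/env_ind=> b; elim/env_ind=> c.
by rewrite !envE; apply/env_eqP/eeq_addA.
Qed.

Lemma env_addC : commutative env_add.
Proof.
by elim/env_ind=> a; elim/env_ind=> b; rewrite !envE; apply/env_eqP/eeq_addC.
Qed.

Lemma env_add0 : left_id (env_scal 0) env_add.
Proof. by elim/env_ind=> a; rewrite !envE; apply/env_eqP/eeq_add0. Qed.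

Lemma env_addN : left_inverse (env_scal 0) env_opp env_add.
Proof.
by elim/env_ind=> a; rewrite /env_opp /env_scal !envE; apply/env_eqP/eeq_addN.
Qed.

HB.instance Definition _ := GRing.isZmodule.Build envelope
  env_addA env_addC env_add0 env_addN.

Lemma env_mulA : associative env_mul.
Proof.
elim/env_ind=> a; elim/env_ind=> b; elim/env_ind=> c.
by rewrite !envE; apply/env_eqP/eeq_mulA.
Qed.

Lemma env_scalC c x : env_mul (env_scal c) x = env_mul x (env_scal c).
Proof. by elim/env_ind: x => a; rewrite !envE; apply/env_eqP/eeq_scalC. Qed.

Lemma env_mul1l : left_id (env_scal 1) env_mul.
Proof. by elim/env_ind=> a; rewrite !envE; apply/env_eqP/eeq_mul1l. Qed.

Lemma env_mul1r : right_id (env_scal 1) env_mul.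
Proof. by move=> x; rewrite -env_scalC env_mul1l. Qed.

Lemma env_mulDl : left_distributive env_mul env_add.
Proof.
elim/env_ind=> a; elim/env_ind=> b; elim/env_ind=> c.
by rewrite !envE; apply/env_eqP/eeq_mulDl.
Qed.

Lemma env_mulDr : right_distributive env_mul env_add.
Proof.
elim/env_ind=> a; elim/env_ind=> b; elim/env_ind=> c.
by rewrite !envE; apply/env_eqP/eeq_mulDr.
Qed.

(* P is a left module over P^e, with m_a acting by multiplication and h_a by
   {a, _}; this is used to see that P^e is not the zero ring. *)
Fixpoint eexpr_act (a : eexpr) (p : P) : P :=
  match a with
  | EM x => x * p
  | EH x => bracket x p
  | EScal c => c *: p
  | EAdd a b => eexpr_act a p + eexpr_act b p
  | EMul a b => eexpr_act a (eexpr_act b p)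
  end.

Lemma eexpr_act_linear a : linear (eexpr_act a).
Proof.
elim: a => [x|x|d|a IHa b IHb|a IHa b IHb] c p q /=.
- by rewrite mulrDr scalerAr.
- by rewrite bracketPr.
- by rewrite scalerDr !scalerA mulrC.
- by rewrite IHa IHb scalerDr addrACA.
- by rewrite IHb IHa.
Qed.

Lemma eexpr_actD a p q : eexpr_act a (p + q) = eexpr_act a p + eexpr_act a q.
Proof. by have := eexpr_act_linear a 1 p q; rewrite !scale1r. Qed.

Lemma eexpr_actZ a c p : eexpr_act a (c *: p) = c *: eexpr_act a p.
Proof.
have a0 : eexpr_act a 0 = 0.
  by apply: (addIr (eexpr_act a 0)); rewrite -eexpr_actD !add0r.
by have := eexpr_act_linear a c p 0; rewrite a0 !addr0.
Qed.

Lemma eexpr_act_eq a b : eexpr_eq a b -> eexpr_act a =1 eexpr_act b.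
Proof.
elim=> /=.
- by [].
- by move=> ? ? _ ab p; rewrite ab.
- by move=> ? ? ? _ ab _ bc p; rewrite ab bc.
- by move=> ? ? ? ? _ ab _ cd p; rewrite ab cd.
- by move=> ? ? ? ? _ ab _ cd p; rewrite ab cd.
- by move=> c d p; rewrite scalerDl.
- by move=> c d p; rewrite scalerA.
- by move=> c x p; rewrite eexpr_actZ.
- by move=> ? ? ? p; rewrite addrA.
- by move=> ? ? p; rewrite addrC.
- by move=> ? p; rewrite scale0r add0r.
- by move=> ? p; rewrite scaleN1r addNr scale0r.
- by [].
- by move=> ? p; rewrite scale1r.
- by [].
- by move=> ? ? ? p; rewrite eexpr_actD.
- by move=> c x y p; rewrite mulrDl scalerAl.
- by move=> c x y p; rewrite bracketPl.
- by move=> x y p; rewrite mulrA.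
- move=> x y p; rewrite scaleN1r.
  have /eqP := bracket_jacobi x y p; rewrite addr_eq0 => /eqP.
  rewrite (bracketC p (bracket x y)) opprK => <-.
  by rewrite (bracketC p x) -[- bracket x p]scaleN1r bracketZr scaleN1r.
- by move=> x y p; rewrite bracketMl.
- by move=> x y p; rewrite scaleN1r bracketM addrK.
- by move=> p; rewrite mul1r scale1r.
Qed.

Lemma env_1neq0 : env_scal 1 != 0.
Proof.
apply/eqP=> /env_eqP/eexpr_act_eq/(_ 1)/= /eqP.
by rewrite scale1r scale0r oner_eq0.
Qed.

HB.instance Definition _ := GRing.Zmodule_isNzRing.Build envelope
  env_mulA env_mul1l env_mul1r env_mulDl env_mulDr env_1neq0.

Lemma env_scaleA c d x : env_scale c (env_scale d x) = env_scale (c * d) x.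
Proof.
rewrite /env_scale env_mulA; congr env_mul.
by rewrite env_mulE; apply/env_eqP/eeq_sym/eeq_scalM.
Qed.

Lemma env_scale1 : left_id 1 env_scale.
Proof. exact: env_mul1l. Qed.

Lemma env_scaleDr : right_distributive env_scale +%R.
Proof. by move=> c x y; apply: (mulrDr (env_scal c)). Qed.

Lemma env_scaleDl x : {morph env_scale^~ x : c d / c + d}.
Proof.
move=> c d; rewrite /env_scale -[RHS]env_mulDl; congr env_mul.
by rewrite env_addE; apply/env_eqP/eeq_scalD.
Qed.

HB.instance Definition _ := GRing.Zmodule_isLmodule.Build k envelope
  env_scaleA env_scale1 env_scaleDr env_scaleDl.

Lemma env_scaleAl (c : k) (x y : envelope) : c *: (x * y) = (c *: x) * y.
Proof. exact: env_mulA. Qed.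

HB.instance Definition _ := GRing.Lmodule_isLalgebra.Build k envelope
  env_scaleAl.

Lemma env_scaleAr (c : k) (x y : envelope) : c *: (x * y) = x * (c *: y).
Proof.
rewrite env_scaleAl -[c *: x]/(env_mul (env_scal c) x) env_scalC.
exact/esym/env_mulA.
Qed.

HB.instance Definition _ := GRing.Lalgebra_isAlgebra.Build k envelope
  env_scaleAr.

Lemma env_classZ (c : k) a : c *: env_class a = env_class (EMul (EScal c) a).
Proof. exact: env_mulE. Qed.

Lemma env_classD a b : env_class a + env_class b = env_class (EAdd a b).
Proof. exact: env_addE. Qed.

Lemma env_classM a b : env_class a * env_class b = env_class (EMul a b).
Proof. exact: env_mulE. Qed.

Lemma env_classN a : - env_class a = env_class (EOpp a).
Proof. exact: env_mulE. Qed.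

Definition env_m (x : P) : envelope := env_class (EM x).
Definition env_h (x : P) : envelope := env_class (EH x).

End Envelope.

Definition enveloping_pair (k : fieldType) (P : poissonType k)
    (A : algType k) (m h : P -> A) : Prop :=
  [/\ linear m /\ linear h,
      (forall x y : P, m (x * y) = m x * m y)
        /\ (forall x y : P, h (bracket x y) = h x * h y - h y * h x),
      (forall x y : P, h (x * y) = m y * h x + m x * h y),
      (forall x y : P, m (bracket x y) = h x * m y - m y * h x)
    & m 1 = 1].

Lemma envelope_pair (k : fieldType) (P : poissonType k) :
  enveloping_pair (@env_m k P) (@env_h k P).
Proof.
split.
- split=> c x y; rewrite /env_m /env_h env_classZ env_classD; apply/env_eqP.
    exact: eeq_mlin.
  exact: eeq_hlin.
- split=> x y; rewrite /env_m /env_h !env_classM ?env_classN ?env_classD.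
    exact/env_eqP/eeq_mM.
  exact/env_eqP/eeq_hB.
- move=> x y; rewrite /env_m /env_h !env_classM env_classD.
  exact/env_eqP/eeq_hM.
- move=> x y; rewrite /env_m /env_h !env_classM env_classN env_classD.
  exact/env_eqP/eeq_mB.
- exact/env_eqP/eeq_m1.
Qed.

Lemma env_m_inj (k : fieldType) (P : poissonType k) : injective (@env_m k P).
Proof. by move=> x y /env_eqP/eexpr_act_eq/(_ 1) /=; rewrite !mulr1. Qed.

Section EnvelopeUniversal.
Variables (k : fieldType) (P : poissonType k) (A : algType k) (m h : P -> A).
Hypothesis mhA : enveloping_pair m h.

Fixpoint eexpr_eval (a : eexpr P) : A :=
  match a with
  | EM x => m x
  | EH x => h x
  | EScal c => c%:A
  | EAdd a b => eexpr_eval a + eexpr_eval b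
  | EMul a b => eexpr_eval a * eexpr_eval b
  end.

Lemma eexpr_eval_eq a b : eexpr_eq a b -> eexpr_eval a = eexpr_eval b.
Proof.
have [[mL hL] [mM hB] hM mB m1] := mhA.
elim=> //=.
- by move=> ? ? ? _ -> _ ->.
- by move=> ? ? ? ? _ -> _ ->.
- by move=> ? ? ? ? _ -> _ ->.
- by move=> *; rewrite scalerDl.
- by move=> *; rewrite -scalerAl mul1r scalerA.
- by move=> *; rewrite mulr_algl mulr_algr.
- by move=> *; rewrite addrA.
- by move=> *; rewrite addrC.
- by move=> *; rewrite scale0r add0r.
- by move=> *; rewrite scaleN1r mulN1r addNr scale0r.
- by move=> *; rewrite mulrA.
- by move=> *; rewrite scale1r mul1r.
- by move=> *; rewrite mulrDl.
- by move=> *; rewrite mulrDr.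
- by move=> *; rewrite mulr_algl mL.
- by move=> *; rewrite mulr_algl hL.
- by move=> *; rewrite mulr_algl scaleN1r hB.
- by move=> *; rewrite mulr_algl scaleN1r mB.
- by rewrite m1 scale1r.
Qed.

Definition env_lift (x : envelope P) : A := eexpr_eval (repr x).

Lemma env_lift_class a : env_lift (env_class a) = eexpr_eval a.
Proof. exact/eexpr_eval_eq/env_repr_class. Qed.

Lemma env_lift_linear : linear env_lift.
Proof.
move=> c; elim/env_ind=> a; elim/env_ind=> b.
by rewrite env_classZ env_classD !env_lift_class /= mulr_algl.
Qed.

Lemma env_lift_monoid : monoid_morphism env_lift.
Proof.
split; first exact: etrans (env_lift_class (EScal P 1)) (scale1r _).
by elim/env_ind=> a; elim/env_ind=> b; rewrite env_classM !env_lift_class.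
Qed.

Lemma envelope_universal :
  exists phi : {lrmorphism envelope P -> A},
    [/\ (forall x, phi (env_m x) = m x), (forall x, phi (env_h x) = h x)
      & forall psi : {lrmorphism envelope P -> A},
          (forall x, psi (env_m x) = m x) -> (forall x, psi (env_h x) = h x) ->
          psi =1 phi].
Proof.
pose LM := GRing.isLinear.Build k (envelope P) A _ env_lift env_lift_linear.
pose MM := GRing.isMonoidMorphism.Build (envelope P) A env_lift env_lift_monoid.
pose phi : {lrmorphism envelope P -> A} :=
  HB.pack env_lift LM MM.
exists phi; split=> [x|x|psi psim psih]; try exact: env_lift_class.
elim/env_ind=> x; rewrite /= env_lift_class.
elim: x => [x|x|c|a IHa b IHb|a IHa b IHb] /=.
- exact: psim.
- exact: psih.
- have ->: env_class (EScal P c) = c%:A.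
    rewrite env_classZ; apply/env_eqP/eeq_sym.
    exact: eeq_trans (eeq_scalC _ _) (eeq_mul1l _).
  by rewrite linearZ /= rmorph1.
- by rewrite -env_classD rmorphD /= IHa IHb.
- by rewrite -env_classM rmorphM /= IHa IHb.
Qed.

End EnvelopeUniversal.

Definition left_dependent (A : nzRingType) (m : nat) (s : 'I_m -> A) : Prop :=
  exists u : 'I_m -> A, (exists i, u i != 0) /\ \sum_i u i * s i = 0.

Definition poly_dependent (k : fieldType) (A : comAlgType k) (m : nat)
    (f : 'I_m -> A) : Prop :=
  exists F : {mpoly k[m]}, F != 0 /\ mmap (in_alg A) f F = 0.

(* Main.v *)
(* Let P be the free Poisson algebra, d the universal differential with values
   in noncommutative power series over P, so that H(f) = sum_w (d_w f) H(x_w) for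
   words w in the variables.

   P is a retract of a polynomial algebra: sending a Lie monomial to the sum of
   its words is split by right-normed bracketing divided by the length
   (Dynkin-Specht-Wever), so P is a domain.

   (ii) => (iv).  df and dg lie in P tensor Lie.  A left relation between H(f) and
   H(g) gives one between the leading parts of df and dg in the free associative
   algebra over P; as Lie elements act as derivations, comparing orders of
   differential operators shows that such a relation has coefficients in P, and
   the Euclidean algorithm (with the Ore condition in place of fractions) yields
   p df = q dg with p, q in P not both zero.  Then the gradients of f and g are
   proportional in the polynomial algebra, and a Luroth type argument gives
   f, g in k[a].

   (i) => (ii).  If H(f) and H(g) are left independent and u(f, g) = 0, then
   applying H gives (d_w u)(f, g) = 0 for all w; by induction on the degree
   d_w u = 0, hence u is constant, so u = 0.

   The other implications are elementary. *)
Require Import Defs.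
From HB Require Import structures.
From mathcomp Require Import all_boot all_algebra.
From mathcomp Require Import ring zify.
From mathcomp Require Import boolp.
From mathcomp Require Import mpoly.

Set Implicit Arguments.
Unset Strict Implicit.
Unset Printing Implicit Defensive.

Import GRing.Theory.
Local Open Scope ring_scope.

(** * Lie monomials *)

(** Neither a basis of the free Lie algebra nor the Poincare-Birkhoff-Witt theorem is used; two
    devices replace them. Polynomials in variables z_w, for words w of length at most d, carry a
    Poisson bracket; d keeps them finite in number and is chosen anew for the elements at hand. The
    map from P to them is a Poisson morphism, injective on what Lie monomials of degree at most d
    generate, whereas the map back is only an algebra morphism. Under the first map d_w f becomes
    the partial derivative along z_w: this is how the noncommutative differential meets gradients
    and polynomial degrees. Secondly, P^e acts on series so that u is recovered from its value on
    the unit series; hence the words in the H(x_i) form a basis of P^e over P. Characteristic zero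
    enters through the division by word lengths, through the integer factors met when orders of
    operators are compared, and through the fact that a polynomial with zero gradient is
    constant. *)

Section LieMonomials.
Variable n : nat.
Implicit Types (w u v : seq 'I_n).

Inductive lie_tree := Leaf of 'I_n | Node of lie_tree & lie_tree.

Fixpoint tdeg (t : lie_tree) : nat :=
  match t with Leaf _ => 1 | Node s t => tdeg s + tdeg t end.

(* The Lie monomial t expands in the free associative algebra into a signed sum
   of words; tsum t phi is the same signed sum of the values of phi. *)
Fixpoint tsum (V : zmodType) (t : lie_tree) (phi : seq 'I_n -> V) : V :=
  match t with
  | Leaf i => phi [:: i]
  | Node s t => tsum s (fun u => tsum t (fun v => phi (u ++ v) - phi (v ++ u)))
  end.

Lemma tdeg_gt0 t : (0 < tdeg t)%N.
Proof. by elim: t => //= s IHs t IHt; rewrite addn_gt0 IHs. Qed.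

Lemma eq_tsum (V : zmodType) t (phi psi : seq 'I_n -> V) :
  (forall w, size w = tdeg t -> phi w = psi w) -> tsum t phi = tsum t psi.
Proof.
elim: t phi psi => [i|s IHs t IHt] phi psi eqf /=; first exact: eqf.
apply: IHs => u su; apply: IHt => v sv.
by rewrite !eqf // size_cat su sv // addnC.
Qed.

Lemma raddf_tsum (V W : zmodType) (f : V -> W) t (phi : seq 'I_n -> V) :
  {morph f : x y / x - y} -> f (tsum t phi) = tsum t (f \o phi).
Proof.
move=> fB; elim: t phi => [i|s IHs t IHt] phi //=.
rewrite IHs; apply: eq_tsum => u _ /=; rewrite IHt.
by apply: eq_tsum => v _ /=.
Qed.

Lemma tsumB (V : zmodType) t (phi psi : seq 'I_n -> V) :
  tsum t (fun w => phi w - psi w) = tsum t phi - tsum t psi.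
Proof.
elim: t phi psi => [i|s IHs t IHt] phi psi //=.
rewrite -IHs; apply: eq_tsum => u _ /=; rewrite -IHt; apply: eq_tsum => v _ /=.
by rewrite !opprB addrACA [RHS]addrACA [- psi _ + _]addrC.
Qed.

Lemma tsum0 (V : zmodType) t : tsum t (fun=> 0) = 0 :> V.
Proof. by rewrite -[X in fun=> X](subrr (0 : V)) tsumB subrr. Qed.

Lemma tsumN (V : zmodType) t (phi : seq 'I_n -> V) :
  tsum t (fun w => - phi w) = - tsum t phi.
Proof.
rewrite -[RHS]add0r -(tsum0 V t) -tsumB.
by apply: eq_tsum => w _; rewrite add0r.
Qed.

Lemma tsumD (V : zmodType) t (phi psi : seq 'I_n -> V) :
  tsum t (fun w => phi w + psi w) = tsum t phi + tsum t psi.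
Proof.
rewrite -[X in _ = _ + X]opprK -tsumN -tsumB.
by apply: eq_tsum => w _; rewrite opprK.
Qed.

Lemma tsum_sum (V : zmodType) t (I : Type) (r : seq I) (phi : I -> seq 'I_n -> V) :
  tsum t (fun w => \sum_(i <- r) phi i w) = \sum_(i <- r) tsum t (phi i).
Proof.
elim: r => [|i r IHr].
  by rewrite big_nil -[RHS](tsum0 V t); apply: eq_tsum => w _; rewrite big_nil.
rewrite big_cons -IHr -tsumD; apply: eq_tsum => w _.
by rewrite big_cons.
Qed.

Lemma exchange_tsum (V : zmodType) s t (phi : seq 'I_n -> seq 'I_n -> V) :
  tsum s (fun u => tsum t (phi u)) = tsum t (fun v => tsum s (phi^~ v)).
Proof.
elim: s phi => [i|s1 IH1 s2 IH2] phi //=.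
under eq_tsum => u _ do
  (under eq_tsum => v _ do rewrite -tsumB; rewrite IH2).
by rewrite IH1.
Qed.

Fixpoint tree_br (k : fieldType) (P : poissonType k) (x : 'I_n -> P) t : P :=
  match t with
  | Leaf i => x i
  | Node s t => bracket (tree_br x s) (tree_br x t)
  end.

End LieMonomials.
Arguments Leaf {n}.

Section PoissonExtra.
Variables (k : fieldType) (P : poissonType k).
Implicit Types x y z : P.

Lemma bracketNl x y : bracket (- x) y = - bracket x y.
Proof. by rewrite -scaleN1r bracketZl scaleN1r. Qed.

Lemma bracketNr x y : bracket x (- y) = - bracket x y.
Proof. by rewrite -scaleN1r bracketZr scaleN1r. Qed.

Lemma bracketBl x y z : bracket (x - y) z = bracket x z - bracket y z.
Proof. by rewrite bracketDl bracketNl. Qed.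

Lemma bracketBr x y z : bracket x (y - z) = bracket x y - bracket x z.
Proof. by rewrite bracketDr bracketNr. Qed.

Lemma bracket_sumr (I : Type) (r : seq I) x (F : I -> P) :
  bracket x (\sum_(i <- r) F i) = \sum_(i <- r) bracket x (F i).
Proof.
by elim: r => [|i r IH]; rewrite ?big_nil ?bracket0r // !big_cons bracketDr IH.
Qed.

Lemma bracket1r x : bracket x 1 = 0.
Proof.
by apply: (addrI (bracket x 1)); rewrite -{3}[1](mulr1 1) bracketM mulr1 mul1r addr0.
Qed.

Lemma bracketAr c x : bracket x c%:A = 0.
Proof. by rewrite bracketZr bracket1r scaler0. Qed.

Lemma bracket_brl x y z :
  bracket (bracket x y) z = bracket x (bracket y z) - bracket y (bracket x z).
Proof.
rewrite (bracketC (bracket x y)); have /eqP := bracket_jacobi x y z.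
by rewrite addr_eq0 => /eqP <-; rewrite (bracketC z x) bracketNr.
Qed.

End PoissonExtra.

(** * Multivariate polynomials *)

Section MPolyExtra.
Variables (N : nat) (R : nzRingType).
Implicit Types F G : {mpoly R[N]}.

Lemma mpoly_alg_ind (A : {mpoly R[N]} -> Prop) :
  (forall c, A c%:MP) -> (forall i, A 'X_i) ->
  (forall F G, A F -> A G -> A (F + G)) ->
  (forall F G, A F -> A G -> A (F * G)) -> forall F, A F.
Proof.
move=> hC hX hD hM; elim/mpolyind => [|c m F _ _ AF]; first exact: (hC 0).
apply: (hD) => //; rewrite -mul_mpolyC; apply: (hM) => //.
rewrite mpolyXE_id; apply: big_ind; [exact: (hC 1) | exact: hM | move=> i _].
by elim: (m i) => [|e IH]; [apply: (hC 1) | rewrite exprS; apply: hM].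
Qed.

Lemma mderivU (i j : 'I_N) : ('X_j : {mpoly R[N]})^`M(i) = (i == j)%:R.
Proof.
rewrite mderivX mnm1E eq_sym; have [->|_] := eqVneq i j; last by rewrite scale0r.
rewrite scale1r; have ->: (U_(j) - U_(j))%MM = 0%MM :> 'X_{1.. N}.
  by apply/mnmP => l; rewrite mnmBE subnn mnm0E.
by rewrite mpolyX0.
Qed.

End MPolyExtra.

(** The derivative along X_i has at m - U_i the coefficient of F at m multiplied by m_i, and m_i is
    nonzero in characteristic 0 for some i. *)
Lemma mpoly_deriv0 (N : nat) (R : idomainType) (char0 : [pchar R] =i pred0)
    (F : {mpoly R[N]}) :
  (forall i, F^`M(i) = 0) -> F = (F@_0%MM)%:MP.
Proof.
move=> F0; apply/mpolyP => m; rewrite mcoeffC.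
have [->|m0] := eqVneq m 0%MM; first by rewrite mulr1.
rewrite mulr0; have [i mi] : exists i, m i != 0%N.
  apply/existsP; apply: contraNT m0; rewrite negb_exists => /forallP m0.
  by apply/eqP/mnmP => i; rewrite mnm0E; apply/eqP; rewrite -[_ == _]negbK.
have /mpolyP/(_ (m - U_(i))%MM) := F0 i; rewrite mcoeff_deriv mcoeff0.
rewrite submK; last first.
  by apply/mnm_lepP => j; rewrite mnm1E; case: eqP => [<-|//]; rewrite lt0n.
rewrite -mulr_natr => /eqP; rewrite mulf_eq0 => /orP[/eqP //|].
by move/pcharf0P: char0 => ->.
Qed.

(** * A polynomial Poisson algebra receiving the free one *)

Section Jacobiator.
Variables (A : comNzRingType) (br : A -> A -> A).
Hypothesis brC : forall x y, br x y = - br y x.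
Hypothesis brD : forall x y z, br x (y + z) = br x y + br x z.
Hypothesis brM : forall x y z, br x (y * z) = br x y * z + y * br x z.

Definition jacobiator x y z := br x (br y z) + br y (br z x) + br z (br x y).

Lemma jacobiator_rot x y z : jacobiator x y z = jacobiator y z x.
Proof. by rewrite /jacobiator; ring. Qed.

Let brN x y : br x (- y) = - br x y.
Proof.
have br0 : br x 0 = 0 by apply: (addrI (br x 0)); rewrite -brD !addr0.
by apply/eqP; rewrite -addr_eq0 -brD addNr br0.
Qed.

Let brDl x y z : br (x + y) z = br x z + br y z.
Proof. by rewrite brC brD !(brC z) opprD !opprK. Qed.

Let brMl x y z : br (x * y) z = br x z * y + x * br y z.
Proof. by rewrite brC brM !(brC z); ring. Qed.

Lemma jacobiatorD x y z t :
  jacobiator x y (z + t) = jacobiator x y z + jacobiator x y t.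
Proof. by rewrite /jacobiator !(brDl, brD); ring. Qed.

(** Together with additivity and cyclic symmetry this reduces the Jacobi identity of an
    antisymmetric biderivation to algebra generators. *)
Lemma jacobiatorM x y z t :
  jacobiator x y (z * t) = jacobiator x y z * t + z * jacobiator x y t.
Proof.
rewrite /jacobiator !(brDl, brD, brM, brMl) (brC z x) (brC t x) !brN.
by ring.
Qed.

End Jacobiator.

(** Each variable stands for the value at one ordering of three concatenated words: the Jacobi
    identity of commutators in additive form. *)
Lemma commutator_jacobi_sum (V : zmodType) (abc acb bac bca cab cba : V) :
  abc - bca - (acb - cba) + (bca - cab - (bac - acb)) + (cab - abc - (cba - bac)) = 0.
Proof.
have subACA (x y z t : V) : x - y + (z - t) = x + z - (y + t).
  by rewrite addrACA opprD.
rewrite (subACA (abc - bca)) (subACA (_ + _)) !subrKA subrr sub0r.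
by rewrite [acb - cba + _]addrC !subrKA subrr oppr0.
Qed.

Section WordVariables.
Variables (R : comNzRingType) (n d : nat).
Let N := #|{: d.-bseq 'I_n}|.

Definition wd (i : 'I_N) : seq 'I_n := val (enum_val i).

(* Variables indexed by the words of length at most d; longer words get 0. *)
Definition zvar (w : seq 'I_n) : {mpoly R[N]} :=
  if insub w : option (d.-bseq 'I_n) is Some b then 'X_(enum_rank b) else 0.

Definition wderiv (w : seq 'I_n) (F : {mpoly R[N]}) : {mpoly R[N]} :=
  if insub w : option (d.-bseq 'I_n) is Some b then F^`M(enum_rank b) else 0.

Lemma wordP w :
  (exists2 i, w = wd i & (size w <= d)%N) \/ (d < size w)%N /\ zvar w = 0.
Proof.
rewrite /zvar; case: insubP => [b|] sw; last by right; rewrite ltnNge.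
by left; exists (enum_rank b); rewrite // /wd enum_rankK.
Qed.

Lemma insub_wd i : insub (wd i) = Some (enum_val i) :> option (d.-bseq 'I_n).
Proof. exact: valK. Qed.

Lemma size_wd i : (size (wd i) <= d)%N.
Proof. exact: size_bseq. Qed.

Lemma zvar_wd i : zvar (wd i) = 'X_i.
Proof. by rewrite /zvar insub_wd enum_valK. Qed.

Lemma wderiv_wd i F : wderiv (wd i) F = F^`M(i).
Proof. by rewrite /wderiv insub_wd enum_valK. Qed.

Lemma wd_inj : injective wd.
Proof. by move=> i j /val_inj/enum_val_inj. Qed.

Lemma zvar_long w : (d < size w)%N -> zvar w = 0.
Proof. by case: (wordP w) => [[i _]|[_ ->]] //; rewrite ltnNge => ->. Qed.

Lemma wderiv_zvar u v :
  wderiv u (zvar v) = ((u == v) && (size u <= d)%N)%:R.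
Proof.
case: (wordP u) => [[i -> su]|[su _]]; last first.
  rewrite leqNgt su andbF /wderiv; case: insubP => // b; by rewrite leqNgt su.
rewrite wderiv_wd size_wd andbT.
case: (wordP v) => [[j -> _]|[sv ->]]; last first.
  by rewrite mderiv0; case: eqP => // E; move: sv; rewrite -E ltnNge size_wd.
by rewrite zvar_wd mderivU (inj_eq wd_inj).
Qed.

End WordVariables.

Section WordPoly.
Variables (k : fieldType) (n d : nat).
Let N := #|{: d.-bseq 'I_n}|.

(* The Lie bracket of the free associative algebra, truncated at length d, gives
   a linear Poisson structure {z_u, z_v} = z_uv - z_vu. *)
Definition wpoly := {mpoly k[N]}.

HB.instance Definition _ := GRing.IntegralDomain.on wpoly.
HB.instance Definition _ := GRing.ComAlgebra.on wpoly.

Local Notation zvar := (@zvar k n d).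

Definition zbr u v : wpoly := zvar (u ++ v) - zvar (v ++ u).

Definition wbr (F G : wpoly) : wpoly :=
  \sum_i \sum_j zbr (wd i) (wd j) * (F^`M(i) * G^`M(j)).

Lemma wbrC F G : wbr F G = - wbr G F.
Proof.
rewrite /wbr exchange_big -sumrN; apply: eq_bigr => i _; rewrite -sumrN.
apply: eq_bigr => j _; rewrite -mulNr opprB; congr (_ * _).
exact: mulrC.
Qed.

Lemma wbrPr c F G H : wbr F (c *: G + H) = c *: wbr F G + wbr F H.
Proof.
rewrite scaler_sumr -big_split; apply: eq_bigr => i _ /=.
rewrite scaler_sumr -big_split; apply: eq_bigr => j _ /=.
by rewrite mderivD mderivZ !mulrDr -!scalerAr.
Qed.

Lemma wbrPl c F G H : wbr (c *: F + G) H = c *: wbr F H + wbr G H.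
Proof. by rewrite wbrC wbrPr (wbrC F) (wbrC G) scalerN opprD. Qed.

Lemma wbrM F G H : wbr F (G * H) = wbr F G * H + G * wbr F H.
Proof.
rewrite mulr_suml mulr_sumr -big_split; apply: eq_bigr => i _ /=.
rewrite mulr_suml mulr_sumr -big_split; apply: eq_bigr => j _ /=.
rewrite mderivM 2!mulrDr; congr (_ + _); first by rewrite !mulrA.
by rewrite [RHS]mulrCA; congr (_ * _); rewrite mulrCA.
Qed.

Lemma wbrDr F G H : wbr F (G + H) = wbr F G + wbr F H.
Proof. by rewrite -[G]scale1r wbrPr !scale1r. Qed.

Lemma wbrDl F G H : wbr (F + G) H = wbr F H + wbr G H.
Proof. by rewrite -[F]scale1r wbrPl !scale1r. Qed.

Lemma wbrMl F G H : wbr (F * G) H = wbr F H * G + F * wbr G H.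
Proof. by rewrite wbrC wbrM (wbrC F) (wbrC G) mulNr mulrN opprD. Qed.

Lemma wbrCr F c : wbr F c%:MP = 0.
Proof. by rewrite /wbr big1 // => i _; rewrite big1 // => j _; rewrite mderivC !mulr0. Qed.

Lemma wbrNr F G : wbr F (- G) = - wbr F G.
Proof.
by rewrite -scaleN1r -[_ *: G]addr0 wbrPr -[0]/(0%:MP) wbrCr addr0 scaleN1r.
Qed.

(** No length condition is needed: if u or v is longer than d, then so are both concatenations, and
    both sides vanish. *)
Lemma wbr_zvar u v : wbr (zvar u) (zvar v) = zvar (u ++ v) - zvar (v ++ u).
Proof.
have wbrz F w : (d < size w)%N -> wbr F (zvar w) = 0.
  by move=> /zvar_long ->; rewrite -[0]/(0%:MP) wbrCr.
case: (wordP k d u) => [[i -> _]|[su _]]; last first.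
  by rewrite wbrC wbrz // !zvar_long ?subr0 ?oppr0 // size_cat; lia.
case: (wordP k d v) => [[j -> _]|[sv _]]; last first.
  by rewrite wbrz // !zvar_long ?subr0 ?oppr0 // size_cat; lia.
rewrite !zvar_wd /wbr (bigD1 i) //= [X in _ + X]big1 ?addr0; last first.
  by move=> i' ne; rewrite big1 // => j' _; rewrite mderivU (negPf ne) mul0r mulr0.
rewrite (bigD1 j) //= big1 ?addr0; last first.
  by move=> j' ne; rewrite [('X_j)^`M(_)]mderivU (negPf ne) !mulr0.
by rewrite !mderivU !eqxx !mulr1.
Qed.

(** Antisymmetry only gives that twice this bracket is 0, and the characteristic is arbitrary here;
    hence the induction on generators. *)
Lemma wbrxx F : wbr F F = 0.
Proof.
elim/mpoly_alg_ind: F => [c|i|F G FF GG|F G FF GG].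
- exact: wbrCr.
- by rewrite -zvar_wd wbr_zvar subrr.
- by rewrite wbrDl !wbrDr FF GG (wbrC G) add0r addr0 subrr.
- rewrite wbrM !wbrMl FF GG (wbrC G) !mul0r !mulr0 !addr0 !add0r.
  by rewrite mulrN mulNr mulrA addNr.
Qed.

(** The jacobiator vanishes on variables and is a derivation in its last argument; rotation brings
    each argument there in turn. *)
Lemma wbr_jacobi F G H : wbr F (wbr G H) + wbr G (wbr H F) + wbr H (wbr F G) = 0.
Proof.
pose J := jacobiator wbr; rewrite -[LHS]/(J F G H).
have Jrot A B C : J A B C = J B C A by apply: jacobiator_rot.
have wbr0r A : wbr A 0 = 0 by rewrite -[0]/(0%:MP) wbrCr.
have Jind A B : (forall i, J A B 'X_i = 0) -> forall C, J A B C = 0.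
  move=> JX; elim/mpoly_alg_ind => [c|//|C D JC JD|C D JC JD].
  - by rewrite /J /jacobiator wbrCr (wbrC _ A) (wbrC _ (wbr A B)) !wbrCr !oppr0 !wbr0r !addr0.
  - by rewrite [J _ _ _](jacobiatorD wbrC wbrDr) -!/(J _ _ _) JC JD addr0.
  - by rewrite [J _ _ _](jacobiatorM wbrC wbrDr wbrM) -!/(J _ _ _) JC JD mul0r mulr0 addr0.
have JXX i j : forall C, J 'X_i 'X_j C = 0.
  apply: Jind => l; rewrite /J /jacobiator -!zvar_wd !wbr_zvar.
  rewrite !(wbrDr, wbrNr) !wbr_zvar !catA.
  exact: commutator_jacobi_sum.
have JX i : forall B C, J B C 'X_i = 0.
  by move=> B C; rewrite -Jrot; apply: Jind => j; rewrite -Jrot; apply: JXX.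
by apply: Jind => i; apply: JX.
Qed.

HB.instance Definition _ := isPoisson.Build k wpoly
  wbrPl wbrPr wbrxx wbr_jacobi wbrM.

Lemma bracket_wbr (F G : wpoly) : bracket F G = wbr F G.
Proof. by []. Qed.

End WordPoly.

(** * The free Poisson algebra as a retract of a polynomial algebra *)

Section Retraction.
Variables (k : fieldType) (n : nat).
Local Notation P := (freePoisson k n).
Local Notation x := (@fpX k n).

Definition wemb d : P -> wpoly k n d := fp_lift (fun i => zvar k d [:: i] : wpoly k n d).
Arguments wemb : clear implicits.

HB.instance Definition _ d := GRing.LRMorphism.on (wemb d).

Lemma wembB d (u v : P) : wemb d (bracket u v) = wbr (wemb d u) (wemb d v).
Proof. exact: fp_lift_bracket. Qed.

Lemma wembX d i : wemb d (x i) = zvar k d [:: i].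
Proof. exact: fp_lift_class. Qed.

Lemma wemb_tree d t : wemb d (tree_br x t) = tsum t (@zvar k n d).
Proof.
elim: t => [i|s IHs t IHt] /=; first exact: wembX.
rewrite wembB IHs IHt -bracket_wbr (raddf_tsum (f := bracket^~ _)); last first.
  by move=> u v; rewrite bracketBl.
apply: eq_tsum => u _ /=; rewrite raddf_tsum; last first.
  by move=> a b; rewrite bracketBr.
by apply: eq_tsum => v _ /=; rewrite bracket_wbr wbr_zvar.
Qed.

Definition adw (w : seq 'I_n) (y : P) : P :=
  foldr (fun i y => bracket (x i) y) y w.

Fixpoint right_normed (w : seq 'I_n) : P :=
  match w with
  | [::] => 0
  | i :: w' => if w' is [::] then x i else bracket (x i) (right_normed w')
  end.

Lemma right_normed_cat w v :
  v != [::] -> right_normed (w ++ v) = adw w (right_normed v).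
Proof.
move=> v0; elim: w => //= i w <-; case E: (w ++ v) => //.
by case: w v v0 E => [|? ?] [].
Qed.

Lemma adw_cat u v y : adw (u ++ v) y = adw u (adw v y).
Proof. exact: foldr_cat. Qed.

Lemma adwB w : {morph adw w : y z / y - z}.
Proof. by elim: w => [|i w IH] y z //=; rewrite IH bracketBr. Qed.

(** Since ad is a morphism of Lie algebras, ad of a Lie monomial expands into words exactly as the
    monomial does. *)
Lemma bracket_tree t y : bracket (tree_br x t) y = tsum t (adw^~ y).
Proof.
elim: t y => //= s IHs t IHt y; rewrite bracket_brl !IHs !IHt.
have adw_tsum (t1 t2 : lie_tree n) :
    tsum t1 (adw^~ (tsum t2 (adw^~ y)))
    = tsum t1 (fun u => tsum t2 (fun v => adw (u ++ v) y)).
  apply: eq_tsum => u _; rewrite (raddf_tsum _ _ (@adwB u)).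
  by apply: eq_tsum => v _ /=; rewrite adw_cat.
rewrite !adw_tsum [X in _ - X]exchange_tsum -tsumB.
by apply: eq_tsum => u _; rewrite -tsumB.
Qed.

(* Dynkin-Specht-Wever. *)
Lemma tsum_right_normed t :
  tsum t right_normed = (tdeg t)%:R *: tree_br x t.
Proof.
elim: t => [i|s IHs t IHt]; first by rewrite scale1r.
have rn_tsum (t1 t2 : lie_tree n) :
    tsum t1 (fun u => tsum t2 (fun v => right_normed (u ++ v)))
    = bracket (tree_br x t1) (tsum t2 right_normed).
  rewrite bracket_tree; apply: eq_tsum => u _.
  rewrite (raddf_tsum _ _ (@adwB u)); apply: eq_tsum => v sv /=.
  by rewrite right_normed_cat // -size_eq0 sv -lt0n tdeg_gt0.
have -> : tsum (Node s t) right_normed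
    = bracket (tree_br x s) (tsum t right_normed)
      - bracket (tree_br x t) (tsum s right_normed).
  rewrite -!rn_tsum [X in _ - X]exchange_tsum -tsumB /=.
  by apply: eq_tsum => u _; rewrite -tsumB.
(* With [t, s] = - [s, t] the two terms contribute deg t and deg s times the same bracket. *)
rewrite IHs IHt !bracketZr (bracketC (tree_br x t)) scalerN opprK -scalerDl.
by rewrite -natrD addnC.
Qed.

(** At the empty word the inverse of 0 is 0, and [right_normed] is 0 too, so that variable is sent
    to 0. *)
Definition wproj d : wpoly k n d -> P :=
  mmap (in_alg P) (fun i => (size (wd i))%:R^-1 *: right_normed (wd i)).
Arguments wproj : clear implicits.

HB.instance Definition _ d := GRing.RMorphism.on (wproj d).

Lemma wprojZ d c F : wproj d (c *: F) = c *: wproj d F.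
Proof. by rewrite /wproj mmapZ mulr_algl. Qed.

Lemma wproj_zvar d w : (size w <= d)%N ->
  wproj d (zvar k d w) = (size w)%:R^-1 *: right_normed w.
Proof.
case: (wordP k d w) => [[i -> _] _|[]]; last by rewrite ltnNge => /negPf ->.
by rewrite zvar_wd /wproj mmapX mmap1U.
Qed.

(** The subalgebra on which truncation at length d loses nothing. A bracket raises the bound, so P
    is only the union of these subalgebras. *)
Inductive lie_gen (d : nat) : P -> Prop :=
| lie_gen_scal c : lie_gen d c%:A
| lie_gen_tree t : (tdeg t <= d)%N -> lie_gen d (tree_br x t)
| lie_genD u v : lie_gen d u -> lie_gen d v -> lie_gen d (u + v)
| lie_genM u v : lie_gen d u -> lie_gen d v -> lie_gen d (u * v).

Lemma lie_gen_le d e u : (d <= e)%N -> lie_gen d u -> lie_gen e u.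
Proof.
move=> de; elim=> [c|t td|v w _ IHv _ IHw|v w _ IHv _ IHw].
- exact: lie_gen_scal.
- by apply: lie_gen_tree; apply: leq_trans de.
- exact: lie_genD.
- exact: lie_genM.
Qed.

Lemma lie_gen_br d e u v :
  lie_gen d u -> lie_gen e v -> lie_gen (d + e) (bracket u v).
Proof.
have gen0 d' : lie_gen d' 0 by rewrite -(scale0r 1); apply: lie_gen_scal.
have gl d' v' : (d' <= d + e)%N -> lie_gen d' v' -> lie_gen (d + e) v'.
  exact: lie_gen_le.
move=> gu gv; elim: gu => [c|s sd|u1 u2 g1 IH1 g2 IH2|u1 u2 g1 IH1 g2 IH2].
- by rewrite bracketC bracketAr oppr0.
- elim: gv => [c|t te|v1 v2 g1 IH1 g2 IH2|v1 v2 g1 IH1 g2 IH2].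
  + by rewrite bracketAr.
  + by apply: (lie_gen_tree (t := Node s t)); apply: leq_add.
  + by rewrite bracketDr; apply: lie_genD.
  + by rewrite bracketM; apply: lie_genD; apply: lie_genM => //;
      apply: (gl e); rewrite ?leq_addl.
- by rewrite bracketDl; apply: lie_genD.
- by rewrite bracketMl; apply: lie_genD; apply: lie_genM => //;
    apply: (gl d); rewrite ?leq_addr.
Qed.

Lemma fp_class_scal c : fp_class (PScal n c) = c%:A :> P.
Proof.
rewrite fp_classZ; apply/fp_eqP/peq_sym.
exact: peq_trans (peq_mulC _ _) (peq_mul1 _).
Qed.

Lemma freePoisson_ind (A : P -> Prop) :
  (forall i, A (x i)) -> (forall c, A c%:A) ->
  (forall u v, A u -> A v -> A (u + v)) ->
  (forall u v, A u -> A v -> A (u * v)) ->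
  (forall u v, A u -> A v -> A (bracket u v)) -> forall u, A u.
Proof.
move=> hX hC hD hM hB; elim/fp_ind; elim=> [i|c|a IHa b IHb|a IHa b IHb|a IHa b IHb].
- exact: hX.
- by rewrite fp_class_scal; apply: hC.
- by rewrite -fp_classD; apply: (hD).
- by rewrite -fp_classM; apply: (hM).
- by rewrite -fp_brE; apply: (hB).
Qed.

Lemma lie_gen_ex u : exists d, lie_gen d u.
Proof.
elim/freePoisson_ind: u => [i|c|u v [d gu] [e gv]|u v [d gu] [e gv]|u v [d gu] [e gv]].
- by exists 1%N; apply: (lie_gen_tree (t := Leaf i)).
- by exists 0%N; apply: lie_gen_scal.
- by exists (d + e)%N; apply: lie_genD;
    [apply: lie_gen_le gu; apply: leq_addr | apply: lie_gen_le gv; apply: leq_addl].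
- by exists (d + e)%N; apply: lie_genM;
    [apply: lie_gen_le gu; apply: leq_addr | apply: lie_gen_le gv; apply: leq_addl].
- by exists (d + e)%N; apply: lie_gen_br.
Qed.

Lemma lie_gen_ex2 u v : exists d, lie_gen d u /\ lie_gen d v.
Proof.
have [d gu] := lie_gen_ex u; have [e gv] := lie_gen_ex v.
exists (d + e)%N; split.
  by apply: lie_gen_le gu; apply: leq_addr.
by apply: lie_gen_le gv; apply: leq_addl.
Qed.

Hypothesis char0 : [pchar k] =i pred0.

Lemma natr_neq0 m : (0 < m)%N -> m%:R != 0 :> k.
Proof. by move/pcharf0P: char0 => ->; rewrite -lt0n. Qed.

(** Both maps are multiplicative, so Lie monomials suffice. All words of t have length [tdeg t], so
    a single scalar leaves the sum and cancels the degree. *)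
Lemma wembK d u : lie_gen d u -> wproj d (wemb d u) = u.
Proof.
elim=> [c|t td|v w _ IHv _ IHw|v w _ IHv _ IHw].
- by rewrite linearZ wprojZ !rmorph1.
- rewrite wemb_tree (raddf_tsum (f := wproj d)); last exact: rmorphB.
  under eq_tsum => w sw do rewrite /= wproj_zvar ?sw //.
  rewrite -(raddf_tsum (f := GRing.scale _)); last exact: scalerBr.
  rewrite tsum_right_normed scalerA mulVf ?scale1r //.
  exact/natr_neq0/tdeg_gt0.
- by rewrite !rmorphD /= IHv IHw.
- by rewrite !rmorphM /= IHv IHw.
Qed.

Lemma wemb_eq0 d u : lie_gen d u -> wemb d u = 0 -> u = 0.
Proof. by move=> gu u0; rewrite -(wembK gu) u0 rmorph0. Qed.

Lemma freePoisson_domain (u v : P) : u * v = 0 -> u = 0 \/ v = 0.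
Proof.
have [d [gu gv]] := lie_gen_ex2 u v.
move=> /(congr1 (wemb d)); rewrite rmorphM rmorph0 => /eqP.
by rewrite mulf_eq0 => /orP[/eqP/(wemb_eq0 gu) | /eqP/(wemb_eq0 gv)]; [left | right].
Qed.

End Retraction.
Arguments wemb {k n} d _.
Arguments wproj {k n} d _.

(** * Differentials *)

Section Convolution.
Variables (n : nat) (A : comNzRingType).
Implicit Types (F G H : seq 'I_n -> A) (w : seq 'I_n).

(** The product of noncommutative power series: the sum of [F u * G v] over all factorisations u ++
    v of w. Removing the first letter of w shifts F by that letter. *)
Fixpoint convw w F G : A :=
  match w with
  | [::] => F [::] * G [::]
  | i :: w' => F [::] * G w + convw w' (fun u => F (i :: u)) G
  end.

Definition conv F G w := convw w F G.

Lemma conv_cons F G i w :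
  conv F G (i :: w) = F [::] * G (i :: w) + conv (fun u => F (i :: u)) G w.
Proof. by []. Qed.

Lemma convDl F1 F2 G w :
  conv (fun u => F1 u + F2 u) G w = conv F1 G w + conv F2 G w.
Proof.
elim: w F1 F2 => [|i w IH] F1 F2; first exact: mulrDl.
by rewrite !conv_cons IH mulrDl addrACA.
Qed.

Lemma convDr F G1 G2 w :
  conv F (fun u => G1 u + G2 u) w = conv F G1 w + conv F G2 w.
Proof.
elim: w F => [|i w IH] F; first exact: mulrDr.
by rewrite !conv_cons IH mulrDr addrACA.
Qed.

Lemma convZl a F G w : conv (fun u => a * F u) G w = a * conv F G w.
Proof.
elim: w F => [|i w IH] F; first exact: esym (mulrA _ _ _).
by rewrite !conv_cons IH mulrDr mulrA.
Qed.

Lemma convZr a F G w : conv F (fun u => a * G u) w = a * conv F G w.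
Proof.
elim: w F => [|i w IH] F; first exact: mulrCA.
by rewrite !conv_cons IH mulrDr [in RHS]mulrCA.
Qed.

Lemma convNl F G w : conv (fun u => - F u) G w = - conv F G w.
Proof.
rewrite -mulN1r -convZl; congr (conv _ _ _).
by apply/funext => u; rewrite mulN1r.
Qed.

Lemma convNr F G w : conv F (fun u => - G u) w = - conv F G w.
Proof.
rewrite -mulN1r -convZr; congr (conv _ _ _).
by apply/funext => u; rewrite mulN1r.
Qed.

Lemma conv0l G w : conv (fun=> 0) G w = 0.
Proof. by elim: w => [|i w IH]; rewrite ?conv_cons ?IH ?mul0r ?addr0 // /conv /= mul0r. Qed.

Lemma convA F G H w : conv F (conv G H) w = conv (conv F G) H w.
Proof.
elim: w F => [|i w IH] F; first exact: mulrA.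
by rewrite !conv_cons convDl convZl IH mulrDr -!addrA mulrA.
Qed.

Lemma conv_deriv (D : A -> A) F G w :
  {morph D : a b / a + b} -> (forall a b, D (a * b) = D a * b + a * D b) ->
  D (conv F G w) = conv (D \o F) G w + conv F (D \o G) w.
Proof.
move=> DD DM; elim: w F => [|i w IH] F; first exact: DM.
by rewrite !conv_cons DD DM IH addrACA.
Qed.

Definition wdelta u w : A := (u == w)%:R.

Lemma conv_wdelta u v w : conv (wdelta u) (wdelta v) w = wdelta (u ++ v) w.
Proof.
elim: u w => [|i u IH] [|j w].
- exact: mul1r.
- rewrite conv_cons [wdelta [::] [::]]/wdelta mul1r -[RHS]addr0; congr (_ + _).
  exact: conv0l.
- exact: mul0r.
rewrite conv_cons {1}/wdelta mul0r add0r [RHS]/wdelta cat_cons eqseq_cons; case: eqVneq => [<-|ne] /=.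
  rewrite -[RHS]/(wdelta (u ++ v) w) -IH; congr (conv _ _ _).
  by apply/funext => x; rewrite /wdelta eqseq_cons eqxx.
rewrite -[RHS](conv0l (wdelta v) w); congr (conv _ _ _).
by apply/funext => x; rewrite /wdelta eqseq_cons (negPf ne).
Qed.

End Convolution.

Section Jets.
Variables (k : fieldType) (P : poissonType k) (n : nat).

(* Pairs (f, df), where df is a series in the differentials of n generators, with
   coefficients in P. *)
Definition jet := (P * (seq 'I_n -> P))%type.
Implicit Types F G H : jet.

HB.instance Definition _ := gen_eqMixin jet.
HB.instance Definition _ := gen_choiceMixin jet.

Lemma jetP F G : F.1 = G.1 -> (forall w, F.2 w = G.2 w) -> F = G.
Proof. by case: F G => [f F] [g G] /= -> /funext ->. Qed.

Definition jet_add F G : jet := (F.1 + G.1, fun w => F.2 w + G.2 w).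
Definition jet_opp F : jet := (- F.1, fun w => - F.2 w).
Definition jet_mul F G : jet := (F.1 * G.1, fun w => F.1 * G.2 w + G.1 * F.2 w).
Definition jet_scale (c : k) F : jet := (c *: F.1, fun w => c *: F.2 w).
(** The second component is the commutator of sum_w F_w H(w) and sum_w G_w H(w) in the enveloping
    algebra: moving h_f to the right of G_w produces the bracket with f, and the remaining h_f,
    expanded again, produces a convolution. *)
Definition jet_br F G : jet :=
  (bracket F.1 G.1, fun w => bracket F.1 (G.2 w) - bracket G.1 (F.2 w)
                             + (conv F.2 G.2 w - conv G.2 F.2 w)).

Lemma jet_addA : associative jet_add.
Proof. by move=> F G H; apply: jetP => [|w]; apply: addrA. Qed.
Lemma jet_addC : commutative jet_add.
Proof. by move=> F G; apply: jetP => [|w]; apply: addrC. Qed.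
Lemma jet_add0 : left_id (0, fun=> 0) jet_add.
Proof. by move=> F; apply: jetP => [|w]; apply: add0r. Qed.
Lemma jet_addN : left_inverse (0, fun=> 0) jet_opp jet_add.
Proof. by move=> F; apply: jetP => [|w]; apply: addNr. Qed.

HB.instance Definition _ := GRing.isZmodule.Build jet
  jet_addA jet_addC jet_add0 jet_addN.

Lemma jet_mulA : associative jet_mul.
Proof. by move=> F G H; apply: jetP => [|w] /=; ring. Qed.
Lemma jet_mulC : commutative jet_mul.
Proof. by move=> F G; apply: jetP => [|w] /=; ring. Qed.
Lemma jet_mul1 : left_id (1, fun=> 0) jet_mul.
Proof. by move=> F; apply: jetP => [|w] /=; ring. Qed.
Lemma jet_mulDl : left_distributive jet_mul jet_add.
Proof. by move=> F G H; apply: jetP => [|w] /=; ring. Qed.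
Lemma jet_1neq0 : (1, fun=> 0) != 0 :> jet.
Proof. by apply/eqP => -[/eqP]; rewrite oner_eq0. Qed.

HB.instance Definition _ := GRing.Zmodule_isComNzRing.Build jet
  jet_mulA jet_mulC jet_mul1 jet_mulDl jet_1neq0.

Lemma jet_scaleA c d F : jet_scale c (jet_scale d F) = jet_scale (c * d) F.
Proof. by apply: jetP => [|w] /=; rewrite scalerA. Qed.
Lemma jet_scale1 : left_id 1 jet_scale.
Proof. by move=> F; apply: jetP => [|w] /=; rewrite scale1r. Qed.
Lemma jet_scaleDr : right_distributive jet_scale +%R.
Proof. by move=> c F G; apply: jetP => [|w] /=; rewrite scalerDr. Qed.
Lemma jet_scaleDl F : {morph jet_scale^~ F : c d / c + d}.
Proof. by move=> c d; apply: jetP => [|w] /=; rewrite scalerDl. Qed.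

HB.instance Definition _ := GRing.Zmodule_isLmodule.Build k jet
  jet_scaleA jet_scale1 jet_scaleDr jet_scaleDl.

Lemma jet_scaleAl (c : k) F G : c *: (F * G) = (c *: F) * G.
Proof.
apply: jetP => [|w] /=; first by rewrite scalerAl.
by rewrite scalerDr scalerAl scalerAr.
Qed.

HB.instance Definition _ := GRing.Lmodule_isLalgebra.Build k jet jet_scaleAl.
HB.instance Definition _ := GRing.Lalgebra_isComAlgebra.Build k jet.

Lemma jet_brDr F G H : jet_br F (G + H) = jet_br F G + jet_br F H.
Proof.
apply: jetP => [|w] /=; rewrite !(bracketDl, bracketDr, convDl, convDr) //.
by ring.
Qed.

Lemma jet_brZr F (c : k) G : jet_br F (c *: G) = c *: jet_br F G.
Proof.
apply: jetP => [|w] /=; rewrite bracketZr ?bracketZl //.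
have E (H : seq 'I_n -> P) : (fun u => c *: H u) = (fun u => c%:A * H u).
  by apply/funext => u; rewrite mulr_algl.
by rewrite E convZr convZl !mulr_algl -!scalerBr -scalerDr.
Qed.

Lemma jet_brC F G : jet_br F G = - jet_br G F.
Proof. by apply: jetP => [|w] /=; rewrite bracketC // opprD !opprB. Qed.

Lemma jet_brPr (c : k) F G H : jet_br F (c *: G + H) = c *: jet_br F G + jet_br F H.
Proof. by rewrite jet_brDr jet_brZr. Qed.

Lemma jet_brPl (c : k) F G H : jet_br (c *: F + G) H = c *: jet_br F H + jet_br G H.
Proof. by rewrite jet_brC jet_brPr (jet_brC F) (jet_brC G) scalerN opprD. Qed.

Lemma jet_brxx F : jet_br F F = 0.
Proof. by apply: jetP => [|w] /=; rewrite ?bracketxx // !subrr addr0. Qed.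

Lemma jet_brM F G H : jet_br F (G * H) = jet_br F G * H + G * jet_br F H.
Proof.
apply: jetP => [|w] /=; first exact: bracketM.
rewrite convDr convDl !convZr !convZl bracketDr !bracketM bracketMl.
by ring.
Qed.

Lemma jet_jacobi F G H :
  jet_br F (jet_br G H) + jet_br G (jet_br H F) + jet_br H (jet_br F G) = 0.
Proof.
have convBr (A B C : seq 'I_n -> P) w :
    conv A (fun u => B u - C u) w = conv A B w - conv A C w.
  by rewrite convDr convNr.
have convBl (A B C : seq 'I_n -> P) w :
    conv (fun u => A u - B u) C w = conv A C w - conv B C w.
  by rewrite convDl convNl.
have conv_br f (A B : seq 'I_n -> P) w :
    bracket f (conv A B w) = conv (bracket f \o A) B w + conv A (bracket f \o B) w.
  apply: conv_deriv => *; [exact: bracketDr | exact: bracketM].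
apply: jetP => [|w] /=; first exact: bracket_jacobi.
(* Once brackets are distributed over convolutions and the latter reassociated, equal terms agree
   syntactically and serve as atoms for [ring]. *)
rewrite !(convBr, convBl, convDr, convDl, convNr, convNl, bracketDr, bracketNr,
  bracket_brl, conv_br, convA) /comp.
by ring.
Qed.

HB.instance Definition _ := isPoisson.Build k jet
  jet_brPl jet_brPr jet_brxx jet_jacobi jet_brM.

End Jets.

Section LieForms.
Variables (n : nat) (A : comNzRingType).

Definition lie_coef (t : lie_tree n) w : A := tsum t (fun u => wdelta A u w).

(** An element of A tensor the free Lie algebra, read as a series. The list is a presentation of it
    and need not be unique. *)
Definition lie_form (s : seq (A * lie_tree n)) w : A :=
  \sum_(p <- s) p.1 * lie_coef p.2 w.

Lemma lie_coef_size t w : size w != tdeg t -> lie_coef t w = 0.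
Proof.
move=> sw; rewrite /lie_coef -[RHS](tsum0 A t); apply: eq_tsum => u su.
by rewrite /wdelta; case: eqP => // E; rewrite -E su eqxx in sw.
Qed.

Lemma conv_suml (I : Type) (r : seq I) (F : I -> seq 'I_n -> A) G w :
  conv (fun u => \sum_(i <- r) F i u) G w = \sum_(i <- r) conv (F i) G w.
Proof.
elim: r => [|i r IH].
  rewrite big_nil -[RHS](conv0l G w); congr (conv _ _ _).
  by apply/funext => u; rewrite big_nil.
rewrite big_cons -IH -convDl; congr (conv _ _ _).
by apply/funext => u; rewrite big_cons.
Qed.

Lemma conv0r (F : seq 'I_n -> A) w : conv F (fun=> 0) w = 0.
Proof. by rewrite -[LHS](addrK (conv F (fun=> 0) w)) -convDr addr0 subrr. Qed.

Lemma conv_sumr (I : Type) (r : seq I) (F : I -> seq 'I_n -> A) G w :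
  conv G (fun u => \sum_(i <- r) F i u) w = \sum_(i <- r) conv G (F i) w.
Proof.
elim: r => [|i r IH].
  rewrite big_nil -[RHS](conv0r G w); congr (conv _ _ _).
  by apply/funext => u; rewrite big_nil.
rewrite big_cons -IH -convDr; congr (conv _ _ _).
by apply/funext => u; rewrite big_cons.
Qed.

Lemma conv_tsuml t (F : seq 'I_n -> seq 'I_n -> A) G w :
  conv (fun u => tsum t (F^~ u)) G w = tsum t (fun v => conv (F v) G w).
Proof.
elim: t F => //= s IHs t IHt F; rewrite IHs; apply: eq_tsum => u _.
rewrite IHt; apply: eq_tsum => v _.
by rewrite convDl convNl.
Qed.

Lemma conv_tsumr t (F : seq 'I_n -> seq 'I_n -> A) G w :
  conv G (fun u => tsum t (F^~ u)) w = tsum t (fun v => conv G (F v) w).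
Proof.
elim: t F => //= s IHs t IHt F; rewrite IHs; apply: eq_tsum => u _.
rewrite IHt; apply: eq_tsum => v _.
by rewrite convDr convNr.
Qed.

Lemma eq_conv (F1 F2 G1 G2 : seq 'I_n -> A) w :
  (forall u, (size u <= size w)%N -> F1 u = F2 u) ->
  (forall u, (size u <= size w)%N -> G1 u = G2 u) ->
  conv F1 G1 w = conv F2 G2 w.
Proof.
elim: w F1 F2 => [|i w IH] F1 F2 eF eG; first by rewrite /conv /= eF ?eG.
rewrite !conv_cons eF // eG //; congr (_ + _); apply: IH => u su.
  exact: eF.
by apply: eG; apply: leqW.
Qed.

Lemma lie_coef_node s t w :
  lie_coef (Node s t) w
  = conv (lie_coef s) (lie_coef t) w - conv (lie_coef t) (lie_coef s) w.
Proof.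
rewrite /lie_coef !conv_tsuml /=.
under [X in _ = X - _]eq_tsum => u _ do rewrite conv_tsumr.
under [X in _ = _ - X]eq_tsum => u _ do rewrite conv_tsumr.
rewrite [X in _ = _ - X]exchange_tsum -tsumB; apply: eq_tsum => u _.
by rewrite -tsumB; apply: eq_tsum => v _; rewrite !conv_wdelta.
Qed.

Lemma lie_form_cat s1 s2 w : lie_form (s1 ++ s2) w = lie_form s1 w + lie_form s2 w.
Proof. exact: big_cat. Qed.

Lemma lie_formZ a s w :
  lie_form [seq (a * p.1, p.2) | p <- s] w = a * lie_form s w.
Proof.
by rewrite /lie_form big_map mulr_sumr; apply: eq_bigr => p _ /=; rewrite mulrA.
Qed.

Lemma lie_formN s w : lie_form [seq (- p.1, p.2) | p <- s] w = - lie_form s w.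
Proof.
by rewrite /lie_form big_map -sumrN; apply: eq_bigr => p _ /=; rewrite mulNr.
Qed.

Definition lie_form_br (s1 s2 : seq (A * lie_tree n)) :=
  [seq (p.1 * q.1, Node p.2 q.2) | p <- s1, q <- s2].

Lemma lie_form_brE s1 s2 w :
  lie_form (lie_form_br s1 s2) w
  = conv (lie_form s1) (lie_form s2) w - conv (lie_form s2) (lie_form s1) w.
Proof.
rewrite /lie_form big_allpairs_dep /= !conv_suml.
under [X in _ = X - _]eq_bigr => p _ do rewrite conv_sumr.
under [X in _ = _ - X]eq_bigr => p _ do rewrite conv_sumr.
rewrite [X in _ = _ - X]exchange_big -sumrB; apply: eq_bigr => p _ /=.
rewrite -sumrB; apply: eq_bigr => q _.
rewrite !convZl !convZr lie_coef_node; ring.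
Qed.

End LieForms.

(** * Calculation rules in the enveloping algebra *)

Section EnvelopeExtra.
Variables (k : fieldType) (P : poissonType k).
Local Notation m := (@env_m k P).
Local Notation h := (@env_h k P).

Lemma env_mD x y : m (x + y) = m x + m y.
Proof. by have [[mL _] _ _ _ _] := envelope_pair P; have := mL 1 x y; rewrite !scale1r. Qed.

Lemma env_hD x y : h (x + y) = h x + h y.
Proof. by have [[_ hL] _ _ _ _] := envelope_pair P; have := hL 1 x y; rewrite !scale1r. Qed.

Lemma env_m1 : m 1 = 1.
Proof. by have [] := envelope_pair P. Qed.

Lemma env_m0 : m 0 = 0.
Proof. by apply: (addrI (m 0)); rewrite -env_mD !addr0. Qed.

Lemma env_h0 : h 0 = 0.
Proof. by apply: (addrI (h 0)); rewrite -env_hD !addr0. Qed.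

Lemma env_mN x : m (- x) = - m x.
Proof. by apply/eqP; rewrite -addr_eq0 -env_mD addNr env_m0. Qed.

Lemma env_mM x y : m (x * y) = m x * m y.
Proof. by have [_ []] := envelope_pair P. Qed.

Lemma env_hB x y : h (bracket x y) = h x * h y - h y * h x.
Proof. by have [_ []] := envelope_pair P. Qed.

Lemma env_hM x y : h (x * y) = m y * h x + m x * h y.
Proof. by have [_ _] := envelope_pair P. Qed.

Lemma env_hm x y : h x * m y = m (bracket x y) + m y * h x.
Proof. by have [_ _ _ mB _] := envelope_pair P; rewrite mB subrK. Qed.

Lemma env_hZ c x : h (c *: x) = c *: h x.
Proof.
by have [[_ hL] _ _ _ _] := envelope_pair P; have := hL c x 0; rewrite env_h0 !addr0.
Qed.

Lemma env_mZ c x : m (c *: x) = c *: m x.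
Proof.
by have [[mL _] _ _ _ _] := envelope_pair P; have := mL c x 0; rewrite env_m0 !addr0.
Qed.

Lemma env_hA c : h c%:A = 0.
Proof.
rewrite env_hZ; have := env_hM 1 1; rewrite mulr1 env_m1 !mul1r => E.
by rewrite (addrI (h 1) (etrans (esym E) (esym (addr0 _)))) scaler0.
Qed.

Lemma env_msum (I : Type) (r : seq I) (F : I -> P) :
  m (\sum_(i <- r) F i) = \sum_(i <- r) m (F i).
Proof. by elim: r => [|i r IH]; rewrite ?big_nil ?env_m0 // !big_cons env_mD IH. Qed.

End EnvelopeExtra.

Lemma rmorph_conv n (A B : comNzRingType) (f : {rmorphism A -> B})
    (F G : seq 'I_n -> A) w :
  f (conv F G w) = conv (f \o F) (f \o G) w.
Proof.
elim: w F => [|i w IH] F; first exact: rmorphM.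
by rewrite !conv_cons rmorphD rmorphM IH.
Qed.

(** The index set is that of [wbr], so that derivatives of a bracket can be compared with
    convolutions term by term. *)
Lemma conv_wd n d (A : comNzRingType) (F G : seq 'I_n -> A) w :
  (size w <= d)%N ->
  conv F G w = \sum_(a < #|{: d.-bseq 'I_n}|) \sum_(b < #|{: d.-bseq 'I_n}|)
    F (wd a) * G (wd b) * wdelta A (wd a ++ wd b) w.
Proof.
move=> wd_; have expand (H : seq 'I_n -> A) u : (size u <= size w)%N ->
    H u = \sum_(a < #|{: d.-bseq 'I_n}|) H (wd a) * wdelta A (wd a) u.
  (* Only the index given by [wordP] matters, so its coefficient ring is arbitrary. *)
  move=> su; case: (wordP rat d u) => [[i -> _]|[]]; last by rewrite ltnNge (leq_trans su wd_).
  rewrite (bigD1 i) //= /wdelta eqxx mulr1 big1 ?addr0 // => j ne.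
  by rewrite (inj_eq (@wd_inj n d)) (negPf ne) mulr0.
rewrite (eq_conv (expand F) (expand G)) conv_suml; apply: eq_bigr => a _.
rewrite conv_sumr; apply: eq_bigr => b _.
by rewrite convZl convZr conv_wdelta mulrA.
Qed.

Section Differential.
Variables (k : fieldType) (n : nat).
Local Notation P := (freePoisson k n).
Local Notation x := (@fpX k n).

(** The universal property of P makes the differential well defined: the first component is the
    identity and the second one is d. *)
Definition jet_lift : P -> jet P n := fp_lift (fun i => (x i, wdelta P [:: i]) : jet P n).

HB.instance Definition _ := GRing.LRMorphism.on jet_lift.

(* H(f) = sum_w diff f w * H(x_{w_1}) ... H(x_{w_m}) in the universal enveloping
   algebra. *)
Definition diff (f : P) : seq 'I_n -> P := (jet_lift f).2.

Lemma jet_liftB f g : jet_lift (bracket f g) = jet_br (jet_lift f) (jet_lift g).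
Proof. exact: fp_lift_bracket. Qed.

Lemma jet_liftX i : jet_lift (x i) = (x i, wdelta P [:: i]).
Proof. exact: fp_lift_class. Qed.

Lemma jet_liftA (c : k) : jet_lift c%:A = c *: (1 : jet P n).
Proof. by rewrite linearZ rmorph1. Qed.

Lemma jet_lift1 f : (jet_lift f).1 = f.
Proof.
elim/freePoisson_ind: f => [i|c|f g IHf IHg|f g IHf IHg|f g IHf IHg].
- by rewrite jet_liftX.
- by rewrite jet_liftA.
- by rewrite rmorphD /= IHf IHg.
- by rewrite rmorphM /= IHf IHg.
- by rewrite jet_liftB /= IHf IHg.
Qed.

Lemma diffX i w : diff (x i) w = wdelta P [:: i] w.
Proof. by rewrite /diff jet_liftX. Qed.

Lemma diffA (c : k) w : diff c%:A w = 0.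
Proof. by rewrite /diff jet_liftA /= scaler0. Qed.

Lemma diffD f g w : diff (f + g) w = diff f w + diff g w.
Proof. by rewrite /diff rmorphD. Qed.

Lemma diffM f g w : diff (f * g) w = f * diff g w + g * diff f w.
Proof. by rewrite /diff rmorphM /= !jet_lift1. Qed.

Lemma diffB f g w : diff (bracket f g) w =
  bracket f (diff g w) - bracket g (diff f w)
  + (conv (diff f) (diff g) w - conv (diff g) (diff f) w).
Proof. by rewrite /diff jet_liftB /= !jet_lift1. Qed.

(** Lie monomials expand with integer coefficients, and brackets kill constants; so a bracket with a
    Lie form only touches its coefficients. *)
Lemma bracket_lie_coef (f : P) (t : lie_tree n) w : bracket f (lie_coef P t w) = 0.
Proof.
rewrite /lie_coef raddf_tsum; last by move=> a b; rewrite bracketBr.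
rewrite -[RHS](tsum0 P t); apply: eq_tsum => u _ /=; rewrite /wdelta.
by case: eqP; rewrite ?bracket1r ?bracket0r.
Qed.

Lemma bracket_lie_form (f : P) (s : seq (P * lie_tree n)) w :
  bracket f (lie_form s w) = lie_form [seq (bracket f p.1, p.2) | p <- s] w.
Proof.
rewrite /lie_form bracket_sumr big_map; apply: eq_bigr => p _.
by rewrite bracketM bracket_lie_coef mulr0 addr0.
Qed.

Section Evaluation.
Variables (Q : poissonType k) (y : 'I_n -> Q).
Local Notation phi := (fp_lift y).

Definition hword (w : seq 'I_n) : envelope Q :=
  foldr (fun i a => env_h (y i) * a) 1 w.

Lemma hword_cat u v : hword (u ++ v) = hword u * hword v.
Proof. by elim: u => [|i u IH] /=; rewrite ?mul1r // IH mulrA. Qed.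

Definition lie_form_env (s : seq (P * lie_tree n)) : envelope Q :=
  \sum_(p <- s) env_m (phi p.1) * tsum p.2 hword.

Lemma lie_form_envZ a s :
  lie_form_env [seq (a * p.1, p.2) | p <- s] = env_m (phi a) * lie_form_env s.
Proof.
rewrite /lie_form_env big_map mulr_sumr; apply: eq_bigr => p _ /=.
by rewrite rmorphM env_mM mulrA.
Qed.

Lemma lie_form_env_h f s : env_h (phi f) * lie_form_env s
  = lie_form_env [seq (bracket f p.1, p.2) | p <- s]
    + \sum_(p <- s) env_m (phi p.1) * (env_h (phi f) * tsum p.2 hword).
Proof.
rewrite /lie_form_env big_map mulr_sumr -big_split; apply: eq_bigr => p _ /=.
by rewrite mulrA env_hm mulrDl fp_lift_bracket mulrA.
Qed.

Lemma tsum_hword s t :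
  tsum (Node s t) hword = tsum s hword * tsum t hword - tsum t hword * tsum s hword.
Proof.
have E (t1 t2 : lie_tree n) : tsum t1 hword * tsum t2 hword
    = tsum t1 (fun u => tsum t2 (fun v => hword (u ++ v))).
  rewrite (raddf_tsum (f := *%R^~ _)); last by move=> a b; rewrite mulrBl.
  apply: eq_tsum => u _ /=.
  rewrite (raddf_tsum (f := *%R _)); last by move=> a b; rewrite mulrBr.
  by apply: eq_tsum => v _ /=; rewrite hword_cat.
rewrite !E [X in _ - X]exchange_tsum -tsumB /=; apply: eq_tsum => u _.
by rewrite -tsumB.
Qed.

Lemma lie_form_env_cat s t :
  lie_form_env (s ++ t) = lie_form_env s + lie_form_env t.
Proof. exact: big_cat. Qed.

Lemma lie_form_envN s :
  lie_form_env [seq (- p.1, p.2) | p <- s] = - lie_form_env s.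
Proof.
rewrite /lie_form_env big_map -sumrN; apply: eq_bigr => p _ /=.
by rewrite rmorphN env_mN mulNr.
Qed.

Lemma lie_form_env_brE s t : lie_form_env (lie_form_br s t)
  = \sum_(q <- t) env_m (phi q.1) * (lie_form_env s * tsum q.2 hword)
    - \sum_(p <- s) env_m (phi p.1) * (lie_form_env t * tsum p.2 hword).
Proof.
rewrite /lie_form_env big_allpairs_dep.
under [X in _ = X - _]eq_bigr => q _ do rewrite mulr_suml mulr_sumr.
under [X in _ = _ - X]eq_bigr => q _ do rewrite mulr_suml mulr_sumr.
rewrite [X in _ = X - _]exchange_big -sumrB; apply: eq_bigr => p _ /=.
rewrite -sumrB; apply: eq_bigr => q _.
rewrite (tsum_hword p.2 q.2 : tsum p.2 _ = _) rmorphM env_mM mulrBr !mulrA; congr (_ * _ * _ - _).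
by rewrite -!env_mM mulrC.
Qed.

(** A single list describes both sides: d f is a Lie form, and H obeys the chain rule along the
    substitution phi. The case of generators gives H(f) itself; arbitrary y is needed for
    substituting f and g into a Poisson polynomial. *)
Lemma diff_lie_form f : exists s : seq (P * lie_tree n),
  diff f =1 lie_form s /\ env_h (phi f) = lie_form_env s.
Proof.
elim/freePoisson_ind: f => [i|c|f g [s [sf hf]] [t [tg hg]]
    |f g [s [sf hf]] [t [tg hg]]|f g [s [sf hf]] [t [tg hg]]].
- exists [:: (1, Leaf i)]; split=> [w|].
    by rewrite /lie_form big_seq1 mul1r diffX.
  by rewrite /lie_form_env big_seq1 rmorph1 env_m1 mul1r /= fp_lift_class mulr1.
- exists [::]; split=> [w|]; first by rewrite /lie_form big_nil diffA.
  by rewrite /lie_form_env big_nil linearZ rmorph1 env_hA.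
- exists (s ++ t); split=> [w|]; first by rewrite diffD lie_form_cat sf tg.
  by rewrite rmorphD env_hD hf hg /lie_form_env big_cat.
- exists ([seq (f * p.1, p.2) | p <- t] ++ [seq (g * p.1, p.2) | p <- s]).
  split=> [w|]; first by rewrite diffM lie_form_cat !lie_formZ sf tg.
  rewrite rmorphM env_hM hf hg [RHS]big_cat -!/(lie_form_env _) !lie_form_envZ.
  exact: addrC.
pose st := [seq (bracket f p.1, p.2) | p <- t].
pose ts := [seq (bracket g p.1, p.2) | p <- s].
exists (st ++ [seq (- p.1, p.2) | p <- ts] ++ lie_form_br s t); split=> [w|].
  rewrite diffB !lie_form_cat lie_formN lie_form_brE.
  rewrite (funext sf) (funext tg) !bracket_lie_form -/st -/ts.
  exact: esym (addrA _ _ _).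
rewrite fp_lift_bracket env_hB !lie_form_env_cat lie_form_envN lie_form_env_brE.
by rewrite {1}hg {2}hf !lie_form_env_h hf hg opprD addrACA [RHS]addrA.
Qed.

End Evaluation.

(** In the bracket case the derivative of the sum of zbr times two partial derivatives has two
    parts: differentiating the partial derivatives gives the bracket terms of [diffB],
    differentiating [zbr] gives the two convolutions. *)
Lemma wderiv_wemb d f w : (size w <= d)%N ->
  wderiv w (wemb d f) = wemb d (diff f w).
Proof.
case: (wordP k d w) => [[i -> _]|[]]; last by rewrite ltnNge => /negPf ->.
rewrite wderiv_wd => _; move: i.
elim/freePoisson_ind: f => [j|c|f g IHf IHg|f g IHf IHg|f g IHf IHg].
- move=> i; rewrite diffX wembX -wderiv_wd wderiv_zvar size_wd andbT eq_sym.
  by rewrite /wdelta; case: eqP; rewrite ?rmorph1 ?rmorph0.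
- by move=> i; rewrite diffA linearZ rmorph1 rmorph0 /= mderivZ -[1]/(1%:MP) mderivC scaler0.
- by move=> i; rewrite diffD !rmorphD /= mderivD IHf IHg.
- move=> i; rewrite diffM !rmorphD !rmorphM /= mderivM IHf IHg addrC; congr (_ + _).
  exact: mulrC.
move=> i; rewrite diffB wembB rmorphD !rmorphB /= !wembB.
have conv_wemb (A B : seq 'I_n -> P) :
    wemb d (conv A B (wd i))
    = \sum_(a < #|{: d.-bseq 'I_n}|) \sum_(b < #|{: d.-bseq 'I_n}|)
      (wemb d (A (wd a)) * wemb d (B (wd b))) * wdelta _ (wd a ++ wd b) (wd i).
  rewrite -[LHS]/(wemb d _) (rmorph_conv (wemb d)).
  exact: conv_wd (size_wd i).
have zbr_deriv (a b : 'I_#|{: d.-bseq 'I_n}|) : (zbr k d (wd a) (wd b))^`M(i)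
    = wdelta _ (wd a ++ wd b) (wd i) - wdelta _ (wd b ++ wd a) (wd i).
  rewrite /zbr mderivB -!wderiv_wd !wderiv_zvar size_wd !andbT.
  by rewrite /wdelta ![wd i == _]eq_sym.
have expand (S : comNzRingType) (z e1 e2 p q p' q' : S) :
    (e1 - e2) * (p * q) + z * (p' * q + p * q')
    = z * (p * q') + z * (p' * q) + (p * q * e1 - q * p * e2).
  by ring.
rewrite !conv_wemb (wbrC (wemb d g)) opprK -(IHf i) -(IHg i).
rewrite [X in _ - X]exchange_big /wbr raddf_sum /= -sumrB -!big_split.
apply: eq_bigr => a _ /=.
rewrite raddf_sum /= -sumrB -!big_split; apply: eq_bigr => b _ /=.
rewrite -!IHf -!IHg.
rewrite !mderivM zbr_deriv (mderiv_comm a i) (mderiv_comm b i).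
exact: expand.
Qed.

End Differential.

(** * A faithful module over the enveloping algebra *)

Section SeriesModule.
Variables (k : fieldType) (n : nat).
Local Notation P := (freePoisson k n).
Local Notation x := (@fpX k n).
Local Notation M := (seq 'I_n -> P).
Local Notation m := (@env_m k P).
Local Notation h := (@env_h k P).

(** Left multiplication of P^e on sums of G_w H(w), written down without knowing that such sums are
    unique: h_f passes G_w at the cost of a bracket and is then expanded by d f. *)
Fixpoint eexpr_series (a : eexpr P) (G : M) : M :=
  match a with
  | Defs.EM f => fun w => f * G w
  | EH f => fun w => bracket f (G w) + conv (diff f) G w
  | EScal c => fun w => c *: G w
  | EAdd a b => fun w => eexpr_series a G w + eexpr_series b G w
  | EMul a b => eexpr_series a (eexpr_series b G)
  end.

Lemma convZAl (c : k) (F G : M) w : conv (fun u => c *: F u) G w = c *: conv F G w.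
Proof.
rewrite -[RHS]mulr_algl -convZl; congr (conv _ _ _).
by apply/funext => u; rewrite mulr_algl.
Qed.

Lemma convZAr (c : k) (F G : M) w : conv F (fun u => c *: G u) w = c *: conv F G w.
Proof.
rewrite -[RHS]mulr_algl -convZr; congr (conv _ _ _).
by apply/funext => u; rewrite mulr_algl.
Qed.

Lemma eexpr_seriesD a (G H : M) w :
  eexpr_series a (fun w => G w + H w) w = eexpr_series a G w + eexpr_series a H w.
Proof.
elim: a G H w => [f|f|c|a IHa b IHb|a IHa b IHb] G H w /=.
- exact: mulrDr.
- by rewrite bracketDr convDr addrACA.
- exact: scalerDr.
- by rewrite IHa IHb addrACA.
- by rewrite -IHa; congr (eexpr_series a _ w); apply/funext => v.
Qed.

Lemma eexpr_seriesZ a (c : k) (G : M) w :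
  eexpr_series a (fun w => c *: G w) w = c *: eexpr_series a G w.
Proof.
elim: a G w => [f|f|e|a IHa b IHb|a IHa b IHb] G w /=.
- by rewrite scalerAr.
- by rewrite bracketZr convZAr scalerDr.
- by rewrite !scalerA mulrC.
- by rewrite IHa IHb scalerDr.
- by rewrite -IHa; congr (eexpr_series a _ w); apply/funext => v.
Qed.

Lemma diffZ (c : k) (f : P) w : diff (c *: f) w = c *: diff f w.
Proof.
have := diffM c%:A f w.
by rewrite !mulr_algl diffA mulr0 addr0.
Qed.

Lemma eexpr_series_eq a b : eexpr_eq a b -> forall G : M,
  eexpr_series a G = eexpr_series b G.
Proof.
have conv_br f (F G : M) w : bracket f (conv F G w)
    = conv (bracket f \o F) G w + conv F (bracket f \o G) w.
  by apply: conv_deriv => *; [exact: bracketDr | exact: bracketM].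
have eqc (F F' G : M) w : F =1 F' -> conv F G w = conv F' G w by move=> /funext ->.
elim=> //=.
- by move=> ? ? ? _ ab _ bc G; rewrite ab bc.
- by move=> ? ? ? ? _ ab _ cd G; rewrite ab cd.
- by move=> ? ? ? ? _ ab _ cd G; rewrite cd ab.
- by move=> c d G; apply/funext => w; rewrite scalerDl.
- by move=> c d G; apply/funext => w; rewrite scalerA.
- by move=> c a' G; apply/funext => w; rewrite eexpr_seriesZ.
- by move=> ? ? ? G; apply/funext => w; rewrite addrA.
- by move=> ? ? G; apply/funext => w; rewrite addrC.
- by move=> ? G; apply/funext => w; rewrite scale0r add0r.
- by move=> ? G; apply/funext => w; rewrite scaleN1r addNr scale0r.
- by move=> ? G; apply/funext => w; rewrite scale1r.
- by move=> ? ? ? G; apply/funext => w; rewrite eexpr_seriesD.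
- by move=> c f g G; apply/funext => w; rewrite mulrDl scalerAl.
- move=> c f g G; apply/funext => w; rewrite bracketPl scalerDr addrACA.
  rewrite -convZAl -convDl; congr (_ + _); apply: eqc => u.
  by rewrite diffD diffZ.
- by move=> f g G; apply/funext => w; rewrite mulrA.
- move=> f g G; apply/funext => w; rewrite scaleN1r (eqc _ _ _ _ (diffB f g)).
  rewrite !convDl !convDr !convNl -!convA !bracketDr !conv_br bracket_brl /comp.
  by ring.
- move=> f g G; apply/funext => w.
  by rewrite bracketMl (eqc _ _ _ _ (diffM f g)) convDl !convZl; ring.
- move=> f g G; apply/funext => w.
  by rewrite scaleN1r bracketM convZr; ring.
Qed.

Definition series_act (u : envelope P) (G : M) : M := eexpr_series (repr u) G.

Lemma series_act_class a G : series_act (env_class a) G = eexpr_series a G.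
Proof. exact/eexpr_series_eq/env_repr_class. Qed.

Lemma series_actDl u v G w : series_act (u + v) G w = series_act u G w + series_act v G w.
Proof.
by elim/env_ind: u => a; elim/env_ind: v => b; rewrite env_classD !series_act_class.
Qed.

Lemma series_actM u v G : series_act (u * v) G = series_act u (series_act v G).
Proof.
by elim/env_ind: u => a; elim/env_ind: v => b; rewrite env_classM !series_act_class.
Qed.

Lemma series_act1 G : series_act 1 G = G.
Proof.
by apply/funext => w; rewrite -[1]/(env_class (EScal P 1)) series_act_class /= scale1r.
Qed.

Lemma series_act0l G w : series_act 0 G w = 0.
Proof. by rewrite -[0 in LHS]/(env_class (EScal P 0)) series_act_class /= scale0r. Qed.

Lemma series_actNl u G w : series_act (- u) G w = - series_act u G w.
Proof. by apply/eqP; rewrite -addr_eq0 -series_actDl addNr series_act0l. Qed.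

Lemma series_act_m f G w : series_act (m f) G w = f * G w.
Proof. by rewrite series_act_class. Qed.

Lemma series_act_h f G w : series_act (h f) G w = bracket f (G w) + conv (diff f) G w.
Proof. by rewrite series_act_class. Qed.

Lemma series_actDr u (G H : M) w :
  series_act u (fun w => G w + H w) w = series_act u G w + series_act u H w.
Proof. exact: eexpr_seriesD. Qed.

Lemma series_act_suml (I : Type) (r : seq I) (F : I -> envelope P) G w :
  series_act (\sum_(i <- r) F i) G w = \sum_(i <- r) series_act (F i) G w.
Proof.
by elim: r => [|i r IH]; rewrite ?big_nil ?series_act0l // !big_cons series_actDl IH.
Qed.

Local Notation one := (wdelta P [::]).
Local Notation hw := (hword x).

Lemma series_act_hX i G j w : series_act (h (x i)) G (j :: w)
  = bracket (x i) (G (j :: w)) + (i == j)%:R * G w.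
Proof.
rewrite series_act_h (funext (diffX k i)) conv_cons {1}/wdelta mul0r add0r.
congr (_ + _).
have -> : (fun u => wdelta P [:: i] (j :: u)) = (fun u => (i == j)%:R * one u).
  apply/funext => u; rewrite /wdelta eqseq_cons; case: (i == j) => /=.
    by rewrite mul1r.
  by rewrite mul0r.
rewrite convZl; congr (_ * _); elim: w {G} (G) => [|l w _] G; first exact: mul1r.
rewrite conv_cons {1}/wdelta mul1r -[RHS]addr0; congr (_ + _).
exact: conv0l.
Qed.

Lemma series_act_hX0 i G : series_act (h (x i)) G [::] = bracket (x i) (G [::]).
Proof. by rewrite series_act_h (funext (diffX k i)) /conv /= /wdelta mul0r addr0. Qed.

Definition supp_le l (G : M) := forall w, (l < size w)%N -> G w = 0.

Lemma hword_supp l G w : supp_le l G -> supp_le (size w + l) (series_act (hw w) G).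
Proof.
move=> Gl; elim: w => [|i w IH] /=; first by rewrite series_act1.
move=> [|j v] // sv; rewrite series_actM series_act_hX !IH ?bracket0r ?mulr0 ?addr0 //.
by move: sv => /=; lia.
Qed.

(** The action of h(x_i) prepends a letter, up to a bracket with the coefficient at the same word;
    that word is too long for the shorter product, so the bracket vanishes. *)
Lemma hword_lead l G w w1 w2 : supp_le l G -> size w2 = l -> (size w <= size w1)%N ->
  series_act (hw w) G (w1 ++ w2) = (w == w1)%:R * G w2.
Proof.
move=> Gl s2; elim: w w1 => [|i w IH] [|j w1] //=.
- by rewrite series_act1 mul1r.
- by move=> _; rewrite series_act1 mul0r Gl //= size_cat; lia.
move=> sw; rewrite series_actM series_act_hX -cat_cons !IH //; last exact: leqW.
have /negPf -> : w != j :: w1 by apply/eqP => E; move: sw; rewrite E /=; lia.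
rewrite mul0r bracket0r add0r eqseq_cons; case: (i == j); first by rewrite mul1r.
by rewrite !mul0r.
Qed.

(** On the unit series there are no lower terms either, because all coefficients are 0 or 1 and
    brackets kill them. *)
Lemma hword_one w v : series_act (hw w) one v = (w == v)%:R.
Proof.
have one0 : supp_le 0 one by case.
have [sw|sw] := leqP (size w) (size v).
  by rewrite -[v in LHS]cats0 (hword_lead one0) // /wdelta mulr1.
have -> : (w == v) = false by apply/eqP => E; rewrite E ltnn in sw.
elim: w v sw => [|i w IH] [|j v] //= sw.
  rewrite series_actM series_act_hX0.
  case: w IH {sw} => [_|l w IH]; first by rewrite series_act1 bracket1r.
  by rewrite IH ?bracket0r.
rewrite series_actM series_act_hX (IH v) // mulr0 addr0.
have [sw'|sw'] := leqP (size w) (size (j :: v)); last by rewrite IH ?bracket0r.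
rewrite -[j :: v]cats0 (hword_lead one0) // /wdelta mulr1.
by case: eqP => _; rewrite ?bracket1r ?bracket0r.
Qed.

Definition env_nf (s : seq (P * seq 'I_n)) : envelope P :=
  \sum_(p <- s) m p.1 * hw p.2.

(** Normal forms are closed under left multiplication by each m_f and h_f; for composite f the
    defining relations reduce h_f to the generators. *)
Lemma env_nf_ex u : exists s, u = env_nf s.
Proof.
pose nf u := exists s, u = env_nf s.
have nf0 : nf 0 by exists [::]; rewrite /env_nf big_nil.
have nfD u1 u2 : nf u1 -> nf u2 -> nf (u1 + u2).
  by move=> [s1 ->] [s2 ->]; exists (s1 ++ s2); rewrite /env_nf big_cat.
have nfm f u1 : nf u1 -> nf (m f * u1).
  move=> [s ->]; exists [seq (f * p.1, p.2) | p <- s].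
  rewrite /env_nf big_map mulr_sumr; apply: eq_bigr => p _.
  by rewrite /= env_mM mulrA.
have nfN u1 : nf u1 -> nf (- u1).
  by move=> /(nfm (-1)); rewrite env_mN env_m1 mulN1r.
have nfh f u1 : nf u1 -> nf (h f * u1).
  elim/freePoisson_ind: f u1 => [i|c|f g IHf IHg|f g IHf IHg|f g IHf IHg] u1 nu.
  - case: nu => s ->; rewrite /env_nf mulr_sumr.
    elim: s => [|p s IH]; first by rewrite big_nil.
    rewrite big_cons; apply: (nfD) => //; rewrite mulrA env_hm mulrDl -mulrA.
    apply: (nfD).
      by exists [:: (bracket (x i) p.1, p.2)]; rewrite /env_nf big_seq1.
    by exists [:: (p.1, i :: p.2)]; rewrite /env_nf big_seq1.
  - by rewrite env_hA mul0r.
  - by rewrite env_hD mulrDl; apply: (nfD); [apply: (IHf) | apply: (IHg)].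
  - rewrite env_hM mulrDl -!mulrA.
    by apply: (nfD); apply: (nfm); [apply: (IHf) | apply: (IHg)].
  - rewrite env_hB mulrBl -!mulrA; apply: (nfD).
      by apply: (IHf); apply: (IHg).
    by apply: (nfN); apply: (IHg); apply: (IHf).
have scalE c : env_class (EScal P c) = m c%:A.
  rewrite env_mZ env_m1.
  by rewrite -[1]/(env_class (EScal P 1)) env_classZ; apply/env_eqP;
    apply: eeq_sym; apply: eeq_trans (eeq_scalC _ _) (eeq_mul1l _).
have nfM a u1 : nf u1 -> nf (env_class a * u1).
  elim: a u1 => [f|f|c|a IHa b IHb|a IHa b IHb] u1 nu.
  - exact: nfm.
  - exact: nfh.
  - by rewrite scalE; apply: (nfm).
  - by rewrite -env_classD mulrDl; apply: (nfD); [apply: (IHa) | apply: (IHb)].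
  - by rewrite -env_classM -mulrA; apply: (IHa); apply: (IHb).
elim/env_ind: u => a; rewrite -[env_class a]mulr1; apply: nfM.
by exists [:: (1, [::])]; rewrite /env_nf big_seq1 env_m1 mulr1.
Qed.

(** By [hword_one] the value on the unit series lists the coefficients of any normal form, which are
    therefore unique. *)
Definition env_coef (u : envelope P) : M := series_act u one.

Lemma env_nf_coef s w : env_coef (env_nf s) w = \sum_(p <- s) p.1 * (p.2 == w)%:R.
Proof.
rewrite /env_coef /env_nf series_act_suml; apply: eq_bigr => p _.
by rewrite series_actM series_act_m hword_one.
Qed.

Lemma env_coefK u : exists2 s : seq (seq 'I_n),
  uniq s & u = \sum_(w <- s) m (env_coef u w) * hw w.
Proof.
have [s us] := env_nf_ex u; exists (undup (map snd s)); first exact: undup_uniq.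
rewrite [LHS]us.
have E w : m (env_coef u w) * hw w
    = \sum_(p <- s) m (p.1 * (p.2 == w)%:R) * hw w.
  by rewrite us env_nf_coef env_msum mulr_suml.
rewrite (eq_bigr _ (fun w _ => E w)).
rewrite exchange_big /env_nf /= big_seq [RHS]big_seq; apply: eq_bigr => p ps.
rewrite (bigD1_seq p.2) ?undup_uniq ?mem_undup ?map_f //= eqxx mulr1 big1 ?addr0 //.
by move=> w ne; rewrite eq_sym (negPf ne) mulr0 env_m0 mul0r.
Qed.

Lemma env_coef_eq0 u : env_coef u = (fun=> 0) -> u = 0.
Proof.
move=> u0; have [s _ ->] := env_coefK u.
by rewrite u0 big1 // => w _; rewrite env_m0 mul0r.
Qed.

Lemma series_act_supp a l u G :
  supp_le a (env_coef u) -> supp_le l G -> supp_le (a + l) (series_act u G).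
Proof.
move=> ua Gl v sv; have [s _ ->] := env_coefK u.
rewrite series_act_suml big1 // => w _; rewrite series_actM series_act_m.
have [sw|sw] := ltnP a (size w); first by rewrite ua ?mul0r.
by rewrite (hword_supp Gl) ?mulr0 //; lia.
Qed.

(** To top order the action is the concatenation product with commuting coefficients, since brackets
    only contribute to shorter words. As P is a domain, top parts multiply without cancellation. *)
Lemma series_act_lead a l u G w1 w2 :
  supp_le a (env_coef u) -> supp_le l G -> size w1 = a -> size w2 = l ->
  series_act u G (w1 ++ w2) = env_coef u w1 * G w2.
Proof.
move=> ua Gl s1 s2; have [s us uE] := env_coefK u.
rewrite {1}uE series_act_suml.
have E w : series_act (m (env_coef u w) * hw w) G (w1 ++ w2)
    = env_coef u w * ((w == w1)%:R * G w2).
  rewrite series_actM series_act_m.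
  have [sw|sw] := leqP (size w) a; first by rewrite (hword_lead Gl) // s1.
  by rewrite ua // !mul0r.
under eq_bigr => w _ do rewrite E.
have [w1s|w1s] := boolP (w1 \in s).
  rewrite (bigD1_seq w1) //= eqxx mul1r big1 ?addr0 // => w ne.
  by rewrite (negPf ne) mul0r mulr0.
have -> : env_coef u w1 = 0.
  rewrite {1}uE /env_coef series_act_suml big_seq big1 // => w ws.
  rewrite series_actM series_act_m hword_one; case: eqP => [E'|_].
    by rewrite -E' ws in w1s.
  by rewrite mulr0.
rewrite mul0r big_seq big1 // => w ws; case: eqP => [E'|_].
  by rewrite -E' ws in w1s.
by rewrite mul0r mulr0.
Qed.

End SeriesModule.

(** * Lie elements have no Lie left multiples *)

Section Operators.
Variable O : idomainType.
Implicit Types (X Y D : O -> O) (f g y : O).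

Definition opcomm X f : O -> O := fun y => X (f * y) - f * X y.

(** Grothendieck's differential operators of order less than m, described by commutators with
    multiplications; for m = 0 the operator is zero. *)
Fixpoint order_lt (m : nat) X : Prop :=
  match m with
  | 0 => forall y, X y = 0
  | m'.+1 => forall f, order_lt m' (opcomm X f)
  end.

Definition is_additive X := forall y z, X (y + z) = X y + X z.

Definition is_derivation D :=
  is_additive D /\ forall y z, D (y * z) = D y * z + y * D z.

Lemma is_additive0 X : is_additive X -> X 0 = 0.
Proof. by move=> aX; apply: (addrI (X 0)); rewrite -aX !addr0. Qed.

Lemma is_additive_opcomm X f : is_additive X -> is_additive (opcomm X f).
Proof. by move=> aX y z; rewrite /opcomm mulrDr !aX; ring. Qed.

Lemma order_ltD m X Y : order_lt m X -> order_lt m Y ->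
  order_lt m (fun y => X y + Y y).
Proof.
elim: m X Y => [|m IH] X Y oX oY /= y; first by rewrite oX oY addr0.
have -> : opcomm (fun y => X y + Y y) y = (fun z => opcomm X y z + opcomm Y y z).
  by apply/funext => z; rewrite /opcomm; ring.
exact: IH.
Qed.

Lemma order_ltMl m g X : order_lt m X -> order_lt m (fun y => g * X y).
Proof.
elim: m X => [|m IH] X oX /= y; first by rewrite oX mulr0.
have -> : opcomm (fun y => g * X y) y = (fun z => g * opcomm X y z).
  by apply/funext => z; rewrite /opcomm; ring.
exact: IH.
Qed.

Lemma order_ltMlI m g X : g != 0 -> order_lt m (fun y => g * X y) -> order_lt m X.
Proof.
move=> g0; elim: m X => [|m IH] X oX /= y.
  by have /eqP := oX y; rewrite mulf_eq0 (negPf g0) => /eqP.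
apply: IH; have := oX y.
suff -> : opcomm (fun y => g * X y) y = (fun z => g * opcomm X y z) by [].
by apply/funext => z; rewrite /opcomm; ring.
Qed.

Lemma order_ltS m X : order_lt m X -> order_lt m.+1 X.
Proof.
elim: m X => [|m IH] X oX f; last exact/IH/oX.
by move=> y; rewrite /opcomm !oX mulr0 subrr.
Qed.

Lemma order_lt_le m p X : (m <= p)%N -> order_lt m X -> order_lt p X.
Proof. by move=> /subnK <- oX; elim: (p - m)%N => // j; apply: order_ltS. Qed.

Lemma order_ltB m X Y : order_lt m X -> order_lt m Y ->
  order_lt m (fun y => X y - Y y).
Proof.
move=> oX /(order_ltMl (-1)) oY.
have -> : (fun y => X y - Y y) = (fun y => X y + -1 * Y y).
  by apply/funext => y; rewrite mulN1r.
exact: order_ltD.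
Qed.

Lemma order_lt_derivl m D X :
  is_derivation D -> order_lt m X -> order_lt m.+1 (D \o X).
Proof.
move=> [aD DM]; elim: m X => [|m IH] X oX f.
  by move=> y; rewrite /opcomm /= !oX is_additive0 // mulr0 subrr.
have -> : opcomm (D \o X) f = (fun y => (D \o opcomm X f) y + D f * X y).
  apply/funext => y; rewrite [LHS]/opcomm /=.
  have -> : X (f * y) = opcomm X f y + f * X y by rewrite /opcomm subrK.
  by rewrite aD DM; ring.
apply: (@order_ltD m.+1 (D \o opcomm X f) (fun y => D f * X y)).
  by apply: IH; apply: oX.
exact: order_ltMl.
Qed.

Lemma order_lt_derivr m D X : is_derivation D -> is_additive X ->
  order_lt m X -> order_lt m.+1 (X \o D).
Proof.
move=> [aD DM]; elim: m X => [|m IH] X aX oX f.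
  by move=> y; rewrite /opcomm /= !oX mulr0 subrr.
have -> : opcomm (X \o D) f
    = (fun y => (opcomm X f \o D) y + (opcomm X (D f) y + D f * X y)).
  by apply/funext => y; rewrite /opcomm /= DM aX; ring.
apply: (@order_ltD m.+1 (opcomm X f \o D)
  (fun y => opcomm X (D f) y + D f * X y)).
  by apply: IH; [exact: is_additive_opcomm | exact: oX].
apply: (@order_ltD m.+1 (opcomm X (D f)) (fun y => D f * X y)).
  exact/order_ltS/oX.
exact: order_ltMl.
Qed.

Lemma is_derivation_comm D E : is_derivation D -> is_derivation E ->
  is_derivation (fun y => D (E y) - E (D y)).
Proof.
move=> [aD mD] [aE mE]; split=> y z.
  by rewrite !aE !aD aE; ring.
by rewrite !mE !mD !aD !aE !mE !mD; ring.
Qed.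

Lemma is_derivation_sum (I : Type) (r : seq I) (g : I -> O) (D : I -> O -> O) :
  (forall i, is_derivation (D i)) ->
  is_derivation (fun y => \sum_(i <- r) g i * D i y).
Proof.
move=> dD; elim: r => [|i r [aIH mIH]]; split=> y z; rewrite ?big_nil.
- by rewrite addr0.
- by rewrite mul0r mulr0 addr0.
- by rewrite !big_cons aIH (dD i).1; ring.
- by rewrite !big_cons mIH (dD i).2; ring.
Qed.

Lemma order_lt_deriv D : is_derivation D -> order_lt 2 D.
Proof.
move=> [aD DM] f g y; rewrite /opcomm !DM; ring.
Qed.

Hypothesis char0 : forall j, j.+1%:R != 0 :> O.

(** The parameter j lets the induction close: commuting the assumed operator with x gives the same
    expression for [X, x] with j + 1, up to [[X, x], D x], whose order is low enough. So [X, x] has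
    lower order, then so does (j + 1) D x X, and its nonzero factor can be cancelled. *)
Lemma order_lt_descent m j D X x : is_derivation D -> D x != 0 ->
  is_additive X -> order_lt m.+1 X ->
  order_lt m (fun y => opcomm X x (D y) + j.+1%:R * D x * X y) -> order_lt m X.
Proof.
move=> dD Dx0; have [aD DM] := dD.
elim: m j X => [|m IH] j X aX oX oH.
  move=> y; have := oH y; rewrite [opcomm _ _ _]oX add0r => /eqP.
  by rewrite !mulf_eq0 (negPf (char0 j)) (negPf Dx0) => /eqP.
have aXx := is_additive_opcomm x aX.
have oXx : order_lt m (opcomm X x).
  apply: (IH j.+1) => //.
  have -> : (fun y => opcomm (opcomm X x) x (D y) + j.+2%:R * D x * opcomm X x y)
    = (fun y => opcomm (fun y => opcomm X x (D y) + j.+1%:R * D x * X y) x y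
              - opcomm (opcomm X x) (D x) y).
    apply/funext => y; rewrite /opcomm /= !DM !mulrDr !aX -[j.+2]addn1 natrD; ring.
  apply: (@order_ltB m (opcomm (fun y => opcomm X x (D y) + j.+1%:R * D x * X y) x)
    (opcomm (opcomm X x) (D x))); [exact: oH | exact: oX].
apply: (order_ltMlI (g := j.+1%:R * D x)); first by rewrite mulf_neq0.
have -> : (fun y => j.+1%:R * D x * X y)
   = (fun y => (opcomm X x (D y) + j.+1%:R * D x * X y) - (opcomm X x \o D) y).
  by apply/funext => y /=; ring.
apply: (@order_ltB m.+1 (fun y => opcomm X x (D y) + j.+1%:R * D x * X y)
  (opcomm X x \o D)) => //.
exact: order_lt_derivr.
Qed.

(** Orders should add under composition, which leaves order 0 for X. The bound on X drops by one at
    a time: [X, x] D + D x X equals [X D, x] - [X, D x], whose bound is one less than that of X. *)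
Lemma order_lt_compr m D X x : is_derivation D -> D x != 0 -> is_additive X ->
  order_lt m X -> order_lt 2 (X \o D) -> order_lt 1 X.
Proof.
move=> dD Dx0 aX; have [aD DM] := dD.
elim: m => [|m IH]; first by move=> oX _; apply: order_lt_le oX.
case: m IH => [|m] IH oX oXD //.
apply: IH => //; apply: (@order_lt_descent m.+1 0 D X x) => //.
have -> : (fun y => opcomm X x (D y) + 1%:R * D x * X y)
    = (fun y => opcomm (X \o D) x y - opcomm X (D x) y).
  by apply/funext => y; rewrite /opcomm /= !DM aX; ring.
apply: (@order_ltB m.+1 (opcomm (X \o D) x) (opcomm X (D x))); last exact: oX.
by apply: (@order_lt_le 1) => //; apply: oXD.
Qed.

End Operators.

Section WordSums.
Variable n : nat.

Fixpoint word_sum (V : zmodType) (r : nat) (phi : seq 'I_n -> V) : V :=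
  match r with
  | 0 => phi [::]
  | r'.+1 => \sum_i word_sum r' (fun w => phi (i :: w))
  end.

Lemma eq_word_sum (V : zmodType) r (phi psi : seq 'I_n -> V) :
  (forall w, size w = r -> phi w = psi w) -> word_sum r phi = word_sum r psi.
Proof.
elim: r phi psi => [|r IH] phi psi E /=; first exact: E.
by apply: eq_bigr => i _; apply: IH => w sw; apply: E; rewrite /= sw.
Qed.

Lemma word_sumD (V : zmodType) r (phi psi : seq 'I_n -> V) :
  word_sum r (fun w => phi w + psi w) = word_sum r phi + word_sum r psi.
Proof.
elim: r phi psi => [|r IH] phi psi //=; rewrite -big_split.
by apply: eq_bigr => i _; rewrite IH.
Qed.

Lemma raddf_word_sum (V W : zmodType) (f : V -> W) r (phi : seq 'I_n -> V) :
  f 0 = 0 -> {morph f : y z / y + z} ->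
  f (word_sum r phi) = word_sum r (f \o phi).
Proof.
move=> f0 fD; elim: r phi => [|r IH] phi //=.
by rewrite (big_morph f fD f0); apply: eq_bigr => i _; rewrite IH.
Qed.

Lemma word_sum0 (V : zmodType) r : word_sum r (fun=> 0) = 0 :> V.
Proof. by elim: r => //= r IH; rewrite big1. Qed.

Lemma word_sum_cat (V : zmodType) r l (phi : seq 'I_n -> V) :
  word_sum (r + l) phi = word_sum r (fun u => word_sum l (fun v => phi (u ++ v))).
Proof.
elim: r phi => [|r IH] phi //=.
by apply: eq_bigr => i _; rewrite IH.
Qed.

Lemma word_sum_wdelta (A : comNzRingType) (V : lmodType A) u (phi : seq 'I_n -> V) :
  word_sum (size u) (fun w => wdelta A u w *: phi w) = phi u.
Proof.
elim: u phi => [|i u IH] phi /=; first by rewrite scale1r.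
rewrite (bigD1 i) //= big1 ?addr0 => [|j ne].
  rewrite -[RHS](IH (fun w => phi (i :: w))); apply: eq_word_sum => w _.
  by rewrite /wdelta eqseq_cons eqxx.
rewrite -[RHS](word_sum0 V (size u)); apply: eq_word_sum => w _.
by rewrite /wdelta eqseq_cons eq_sym (negPf ne) scale0r.
Qed.

Lemma exchange_tsum_word_sum (A : comNzRingType) (V : lmodType A) t r
    (c : seq 'I_n -> seq 'I_n -> A) (phi : seq 'I_n -> V) :
  tsum t (fun u => word_sum r (fun w => c u w *: phi w))
  = word_sum r (fun w => tsum t (c^~ w) *: phi w).
Proof.
elim: r c phi => [|r IH] c phi /=.
  by rewrite (raddf_tsum (f := fun a => a *: phi [::])) // => a b; apply: scalerBl.
rewrite tsum_sum; apply: eq_bigr => i _.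
by rewrite (IH (fun u w => c u (i :: w)) (fun w => phi (i :: w))).
Qed.

Lemma tsum_word_sum (A : comNzRingType) (V : lmodType A) t (phi : seq 'I_n -> V) :
  tsum t phi = word_sum (tdeg t) (fun w => lie_coef A t w *: phi w).
Proof.
rewrite /lie_coef -exchange_tsum_word_sum; apply: eq_tsum => u <-.
by rewrite word_sum_wdelta.
Qed.

Lemma lie_form_word_sum (A : comNzRingType) (V : lmodType A) r
    (s : seq (A * lie_tree n)) (phi : seq 'I_n -> V) :
  all (fun p => tdeg p.2 == r) s ->
  word_sum r (fun w => lie_form s w *: phi w)
  = \sum_(p <- s) p.1 *: tsum p.2 phi.
Proof.
elim: s => [_|p s IH /= /andP[/eqP pr sr]].
  rewrite big_nil -[RHS](word_sum0 V r); apply: eq_word_sum => w _.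
  by rewrite /lie_form big_nil scale0r.
rewrite big_cons -IH // tsum_word_sum pr.
rewrite (raddf_word_sum (f := GRing.scale p.1)) ?scaler0 //; last exact: scalerDr.
rewrite -word_sumD; apply: eq_word_sum => w _ /=.
by rewrite /lie_form big_cons scalerDl scalerA.
Qed.

End WordSums.

Section LieLeftFactor.
Variables (n d : nat) (K : idomainType).
Local Notation O := {mpoly K[#|{: d.-bseq 'I_n}|]}.
Local Notation z := (@zvar K n d).

(** The derivation sending z_w to z_{iw}. It makes the free associative algebra act by differential
    operators; Lie elements act as derivations, and z of the empty word remembers every word that
    acts on it. *)
Definition word_deriv (i : 'I_n) (F : O) : O :=
  \sum_a z (i :: wd a) * F^`M(a).

Definition word_act (w : seq 'I_n) (F : O) : O := foldr word_deriv F w.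

Lemma word_deriv_deriv i : is_derivation (word_deriv i).
Proof.
split=> F G; rewrite /word_deriv.
  by rewrite -big_split; apply: eq_bigr => a _; rewrite mderivD mulrDr.
rewrite mulr_suml mulr_sumr -big_split; apply: eq_bigr => a _ /=.
by rewrite mderivM mulrDr mulrA [F * (_ * _)]mulrCA.
Qed.

Lemma word_derivZ i c F : word_deriv i (c *: F) = c *: word_deriv i F.
Proof.
rewrite scaler_sumr; apply: eq_bigr => a _.
by rewrite mderivZ scalerAr.
Qed.

Lemma word_deriv_zvar i w : word_deriv i (z w) = z (i :: w).
Proof.
case: (wordP K d w) => [[a -> _]|[sw zw]]; last first.
  rewrite zw (is_additive0 (word_deriv_deriv i).1) zvar_long //=; exact: ltnW.
rewrite /word_deriv (bigD1 a) //= zvar_wd mderivU eqxx mulr1 big1 ?addr0 // => b ne.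
by rewrite mderivU (negPf ne) mulr0.
Qed.

Lemma word_act_add w : is_additive (word_act w).
Proof. by elim: w => [|i w IH] F G //=; rewrite IH (word_deriv_deriv i).1. Qed.

Lemma word_actZ w c F : word_act w (c *: F) = c *: word_act w F.
Proof. by elim: w => //= i w ->; rewrite word_derivZ. Qed.

Lemma word_act_zvar w : word_act w (z [::]) = z w.
Proof. by elim: w => //= i w ->; rewrite word_deriv_zvar. Qed.

Lemma word_act_cat u v F : word_act (u ++ v) F = word_act u (word_act v F).
Proof. exact: foldr_cat. Qed.

Lemma order_lt_word_act w : order_lt (size w).+1 (word_act w).
Proof.
elim: w => [|i w IH] /=; first by move=> f y; rewrite /opcomm subrr.
exact: (order_lt_derivl (word_deriv_deriv i) IH).
Qed.

Lemma word_act1 w : (0 < size w)%N -> word_act w 1 = 0.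
Proof.
elim: w => // i w IH _; rewrite -[LHS]/(word_deriv i (word_act w 1)).
case: w IH => [_|j w ->] //; last exact: is_additive0 (word_deriv_deriv i).1.
by rewrite /word_deriv big1 // => a _; rewrite -[1]/(1%:MP) mderivC mulr0.
Qed.

Lemma word_actB w : {morph word_act w : F G / F - G}.
Proof. by move=> F G; rewrite word_act_add -scaleN1r word_actZ scaleN1r. Qed.

Lemma tsum_word_act_deriv t : is_derivation (fun F => tsum t (word_act^~ F)).
Proof.
elim: t => [i|s IHs t IHt]; first exact: word_deriv_deriv.
pose Ts F := tsum s (word_act^~ F); pose Tt F := tsum t (word_act^~ F).
have E F : tsum (Node s t) (word_act^~ F) = Ts (Tt F) - Tt (Ts F).
  have act_tsum (t1 t2 : lie_tree n) :
      tsum t1 (word_act^~ (tsum t2 (word_act^~ F)))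
      = tsum t1 (fun u => tsum t2 (fun v => word_act (u ++ v) F)).
    apply: eq_tsum => u _; rewrite (raddf_tsum _ _ (@word_actB u)).
    by apply: eq_tsum => v _ /=; rewrite word_act_cat.
  rewrite /Ts /Tt !act_tsum [X in _ - X]exchange_tsum -tsumB /=.
  by apply: eq_tsum => u _; rewrite -tsumB.
by rewrite (funext E); apply: is_derivation_comm.
Qed.

Lemma word_act_sum_add r (c : seq 'I_n -> K) :
  is_additive (fun F => word_sum r (fun w => c w *: word_act w F)).
Proof.
move=> F G; rewrite -word_sumD; apply: eq_word_sum => w _.
by rewrite word_act_add scalerDr.
Qed.

Lemma order_lt_sum r (c : seq 'I_n -> K) :
  order_lt r.+1 (fun F => word_sum r (fun w => c w *: word_act w F)).
Proof.
(* The prefix u holds the letters already summed, which keeps the bound on the order fixed during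
   the induction. *)
suff: forall s u (c : seq 'I_n -> K), (size u + s)%N = r ->
    order_lt r.+1 (fun F => word_sum s (fun w => c w *: word_act (u ++ w) F)).
  by move/(_ r [::] c erefl).
elim=> [|s IH] u e su /=.
  rewrite cats0 -su addn0.
  have -> : (fun F => e [::] *: word_act u F) = (fun F => (e [::])%:MP * word_act u F).
    by apply/funext => F; rewrite mul_mpolyC.
  exact: (order_ltMl _ (order_lt_word_act u)).
pose X i F := word_sum s (fun w => e (i :: w) *: word_act ((u ++ [:: i]) ++ w) F).
have -> : (fun F => \sum_i word_sum s (fun w => e (i :: w) *: word_act (u ++ i :: w) F))
    = (fun F => \sum_i X i F).
  apply/funext => F; apply: eq_bigr => i _; apply: eq_word_sum => w _.
  by rewrite -catA.
have oX i : order_lt r.+1 (X i) by apply: (IH); rewrite size_cat /= -su; lia.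
elim: (index_enum _) => [|i l IHl].
  have X0 : order_lt 0 (fun F => \sum_(j <- [::]) X j F) by move=> F; rewrite big_nil.
  exact: (order_lt_le (leq0n r.+1) X0).
have -> : (fun F => \sum_(j <- i :: l) X j F)
    = (fun F => X i F + \sum_(j <- l) X j F).
  by apply/funext => F; rewrite big_cons.
exact: (order_ltD (oX i)).
Qed.

Lemma wderivZ w c F : wderiv w (c *: F) = c *: wderiv w F :> O.
Proof. by rewrite /wderiv; case: insub => [b|]; rewrite ?scaler0 ?mderivZ. Qed.

Lemma wderivD w F G : wderiv w (F + G) = wderiv w F + wderiv w G :> O.
Proof. by rewrite /wderiv; case: insub => [b|]; rewrite ?addr0 ?mderivD. Qed.

Lemma wderiv0 w : wderiv w 0 = 0 :> O.
Proof. by rewrite /wderiv; case: insub => [b|]; rewrite ?mderiv0. Qed.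

Lemma wderiv_word_sum r (c : seq 'I_n -> K) u : (r <= d)%N -> size u = r ->
  wderiv u (word_sum r (fun w => c w *: z w)) = (c u)%:MP.
Proof.
move=> rd su; rewrite (raddf_word_sum (f := @wderiv K n d u)).
- rewrite -[RHS](word_sum_wdelta _ (fun w => (c w)%:MP)) su.
  apply: eq_word_sum => w sw; rewrite /= wderivZ wderiv_zvar su rd andbT.
  rewrite /wdelta; case: eqP => _; last by rewrite scaler0 scale0r.
  by rewrite !mulr1n scale1r -mul_mpolyC mulr1.
- exact: wderiv0.
- by move=> F G; apply: wderivD.
Qed.

Hypothesis char0 : forall j, j.+1%:R != 0 :> K.

Lemma mpoly_char0 j : j.+1%:R != 0 :> O.
Proof. by rewrite -mpolyC_nat mpolyC_eq0. Qed.

(** Let c act as X and the forms as derivations T. Then X composed with T t is T s, of order at most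
    1, so X is a multiplication unless T t = 0. Since r > 0, words of length r kill 1, whence X =
    0. *)
Lemma lie_left_factor_le (s t : seq (K * lie_tree n)) (r l : nat) (c : seq 'I_n -> K) :
  (0 < r)%N -> (r + l <= d)%N ->
  all (fun p => tdeg p.2 == (r + l)%N) s -> all (fun p => tdeg p.2 == l) t ->
  (forall u v, size u = r -> size v = l ->
     lie_form s (u ++ v) = c u * lie_form t v) ->
  forall u v, size u = r -> size v = l -> c u = 0 \/ lie_form t v = 0.
Proof.
move=> r0 rd ss tt st u v su sv.
have [->|tv] := eqVneq (lie_form t v) 0; first by right.
left; pose X F : O := word_sum r (fun w => c w *: word_act w F).
pose T (a : seq (K * lie_tree n)) (F : O) := \sum_(p <- a) p.1%:MP * tsum p.2 (word_act^~ F).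
have T_deriv a : is_derivation (T a).
  apply: (is_derivation_sum a (fun p => p.1%:MP) (fun p => _)) => p.
  exact: tsum_word_act_deriv.
have T_sum a m F : all (fun p => tdeg p.2 == m) a ->
    T a F = word_sum m (fun w => lie_form a w *: word_act w F).
  move=> /(lie_form_word_sum (V := O)) ->; apply: eq_bigr => p _.
  by rewrite mul_mpolyC.
have XT : X \o T t = T s.
  apply/funext => F; rewrite /= (T_sum _ _ _ ss) (T_sum _ _ _ tt) word_sum_cat.
  apply: eq_word_sum => w sw.
  rewrite (raddf_word_sum (f := word_act w)); last exact: word_act_add.
    rewrite (raddf_word_sum (f := GRing.scale (c w))) ?scaler0 //; last exact: scalerDr.
    apply: eq_word_sum => w' sw' /=.
    by rewrite word_actZ st // scalerA word_act_cat.
  exact/is_additive0/word_act_add.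
(* The coefficient of t at v is recovered from this value by differentiating along z_v. *)
have Tz : T t (z [::]) != 0.
  apply: contraNneq tv => /(congr1 (wderiv v)); rewrite (T_sum _ _ _ tt).
  under eq_word_sum => w _ do rewrite word_act_zvar.
  rewrite (wderiv_word_sum _ _ sv); last by lia.
  rewrite wderiv0 => /eqP.
  by rewrite mpolyC_eq0.
have oX : order_lt 1 X.
  apply: (order_lt_compr mpoly_char0 (T_deriv t) Tz).
  - exact: word_act_sum_add.
  - exact: order_lt_sum.
  - by rewrite XT; apply: order_lt_deriv.
have X1 : X 1 = 0.
  rewrite -[RHS](word_sum0 n _ r); apply: eq_word_sum => w sw.
  by rewrite word_act1 ?sw // scaler0.
(* Order 0 means that X commutes with multiplication by z of the empty word; evaluated at 1 this
   gives X(z) = z X(1) = 0. *)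
have /eqP := oX (z [::]) 1; rewrite /opcomm X1 mulr0 subr0 mulr1 => /eqP.
rewrite /X; under eq_word_sum => w _ do rewrite word_act_zvar.
move=> /(congr1 (wderiv u)); rewrite (wderiv_word_sum _ _ su); last by lia.
rewrite wderiv0 => /eqP.
by rewrite mpolyC_eq0 => /eqP.
Qed.

End LieLeftFactor.

(** * Left dependence is linear dependence of differentials *)

Section LeftDependence.
Variables (k : fieldType) (char0 : [pchar k] =i pred0) (n : nat).
Local Notation P := (freePoisson k n).
Local Notation x := (@fpX k n).
Local Notation m := (@env_m k P).
Local Notation h := (@env_h k P).

Lemma fp_mulf_neq0 (f g : P) : f != 0 -> g != 0 -> f * g != 0.
Proof.
move=> f0 g0; apply/eqP => /(freePoisson_domain char0) [] /eqP.
  by rewrite (negPf f0).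
by rewrite (negPf g0).
Qed.

Lemma fp_expf_neq0 (f : P) N : f != 0 -> f ^+ N != 0.
Proof.
by move=> f0; elim: N => [|N IH]; rewrite ?expr0 ?oner_neq0 // exprS fp_mulf_neq0.
Qed.

Lemma lie_form_rmorph (A B : comNzRingType) (f : {rmorphism A -> B})
    (s : seq (A * lie_tree n)) w :
  lie_form [seq (f p.1, p.2) | p <- s] w = f (lie_form s w).
Proof.
rewrite /lie_form big_map rmorph_sum; apply: eq_bigr => p _ /=.
rewrite rmorphM /lie_coef (raddf_tsum (f := f)); last exact: rmorphB.
congr (_ * _); apply: eq_tsum => u _ /=; rewrite /wdelta.
by case: eqP; rewrite ?rmorph1 ?rmorph0.
Qed.

(** Coefficients are carried to the domain [wpoly] by [wemb d]. Only the two elements of the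
    conclusion have to be detected there, which determines d; the word variables of the operators
    are truncated at r + l. *)
Lemma lie_left_factor (s t : seq (P * lie_tree n)) (r l : nat) (c : seq 'I_n -> P) :
  (0 < r)%N ->
  all (fun p => tdeg p.2 == (r + l)%N) s -> all (fun p => tdeg p.2 == l) t ->
  (forall u v, size u = r -> size v = l ->
     lie_form s (u ++ v) = c u * lie_form t v) ->
  forall u v, size u = r -> size v = l -> c u = 0 \/ lie_form t v = 0.
Proof.
move=> r0 ss tt st u v su sv.
have [d [gc gt]] := lie_gen_ex2 (c u) (lie_form t v).
pose K : idomainType := wpoly k n d.
have charK j : j.+1%:R != 0 :> K.
  by rewrite -mpolyC_nat mpolyC_eq0; apply: natr_neq0.
pose f (q : P * lie_tree n) : K * lie_tree n := (wemb d q.1, q.2).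
have fs : all (fun p => tdeg p.2 == (r + l)%N) (map f s) by rewrite all_map.
have ft : all (fun p => tdeg p.2 == l) (map f t) by rewrite all_map.
have fst' u' v' : size u' = r -> size v' = l ->
    lie_form (map f s) (u' ++ v') = (wemb d \o c) u' * lie_form (map f t) v'.
  by move=> su' sv'; rewrite !(lie_form_rmorph (wemb d)) st // rmorphM.
have [] := lie_left_factor_le charK r0 (leqnn _) fs ft fst' su sv.
- by move=> /(wemb_eq0 char0 gc); left.
by rewrite (lie_form_rmorph (wemb d)) => /(wemb_eq0 char0 gt); right.
Qed.

Lemma bracket_exp (f p : P) N : exists g, bracket f (p ^+ N.+1) = g * p ^+ N.
Proof.
elim: N => [|N [g IH]]; first by exists (bracket f p); rewrite mulr1.
exists (bracket f p + g); rewrite exprS bracketM IH mulrDl; congr (_ + _).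
by rewrite mulrCA -exprS.
Qed.

(** The denominators needed are powers of p. Multiplying by h_f costs one more power, because the
    bracket of f with p^(N+1) is still divisible by p^N. *)
Lemma env_ore (p : P) u : exists N v, m (p ^+ N) * u = v * m p.
Proof.
pose ok u := exists N v, m (p ^+ N) * u = v * m p.
have mexp N1 N2 : m (p ^+ (N1 + N2)) = m (p ^+ N1) * m (p ^+ N2).
  by rewrite exprD env_mM.
have okD u1 u2 : ok u1 -> ok u2 -> ok (u1 + u2).
  move=> [N1 [v1 E1]] [N2 [v2 E2]].
  exists (N1 + N2)%N, (m (p ^+ N2) * v1 + m (p ^+ N1) * v2).
  rewrite mulrDr mulrDl -!mulrA -E1 -E2 !mulrA -!mexp addnC //.
have okm f u1 : ok u1 -> ok (m f * u1).
  move=> [N [v E]]; exists N, (m f * v).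
  by rewrite mulrA -env_mM [p ^+ N * f]mulrC env_mM -!mulrA E.
have okN u1 : ok u1 -> ok (- u1).
  by move=> [N [v E]]; exists N, (- v); rewrite mulrN E mulNr.
have okh f u1 : ok u1 -> ok (h f * u1).
  move=> [N [v E]]; have [g Eg] := bracket_exp f p N.
  exists N.+1, (h f * m p * v - m g * v).
  have -> : m (p ^+ N.+1) * (h f * u1)
      = h f * m (p ^+ N.+1) * u1 - m (bracket f (p ^+ N.+1)) * u1.
    by rewrite env_hm mulrDl addrC addrA addNr add0r mulrA.
  by rewrite Eg exprS !env_mM mulrBl -!mulrA E.
have okM a u1 : ok u1 -> ok (env_class a * u1).
  elim: a u1 => [f|f|c|a IHa b IHb|a IHa b IHb] u1 o1.
  - exact: okm.
  - exact: okh.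
  - have -> : env_class (EScal P c) = c *: 1.
      by rewrite -[1]/(env_class (EScal P 1)) env_classZ; apply/env_eqP;
        apply: eeq_sym; apply: eeq_trans (eeq_scalC _ _) (eeq_mul1l _).
    rewrite -[1](env_m1 P) -env_mZ; exact: okm.
  - by rewrite -env_classD mulrDl; apply: okD; [apply: (IHa) | apply: (IHb)].
  - by rewrite -env_classM -mulrA; apply: (IHa); apply: (IHb).
elim/env_ind: u => a; rewrite -[env_class a]mulr1; apply: okM.
by exists 1%N, 1; rewrite expr1 mulr1 mul1r.
Qed.

Lemma env_m_mul_neq0 (p : P) u : p != 0 -> u != 0 -> m p * u != 0.
Proof.
move=> p0; apply: contraNneq => pu; apply/eqP/env_coef_eq0/funext => w.
have := congr1 (fun v => env_coef v w) pu.
rewrite /env_coef series_actM series_act_m series_act0l.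
by move=> /(freePoisson_domain char0) [/eqP|] //; rewrite (negPf p0).
Qed.

Lemma top_word (G : seq 'I_n -> P) L : supp_le L G -> (exists w, G w != 0) ->
  exists a w, [/\ supp_le a G, size w = a, G w != 0 & (a <= L)%N].
Proof.
elim: L => [|L IH] GL [w Gw].
  exists 0%N, w; split=> //; apply/eqP; rewrite -leqn0 leqNgt.
  by apply: contra Gw => /GL ->.
have [[w' [sw' Gw']]|no] := pselect (exists w', size w' = L.+1 /\ G w' != 0).
  by exists L.+1, w'.
have [|//|a [w1 [? ? ? ?]]] := IH; last by exists a, w1; split=> //; apply: leqW.
  move=> v; rewrite leq_eqVlt => /orP[/eqP sv|/GL //].
  by apply/eqP; apply: contrapT => /negP Gv; apply: no; exists v.
by exists w.
Qed.

Lemma env_coef_bound u : exists L, supp_le L (env_coef u : seq 'I_n -> P).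
Proof.
have [s ->] := env_nf_ex u; exists (\max_(p <- s) size p.2)%N => w sw.
rewrite env_nf_coef big_seq big1 // => p ps; case: eqP => [E|_]; last by rewrite mulr0.
by move: sw; rewrite -E ltnNge => /negP[]; apply: leq_bigmax_seq ps isT.
Qed.

Lemma env_top u : u != 0 ->
  exists a w, [/\ supp_le a (env_coef u), size w = a & env_coef u w != 0 :> P].
Proof.
move=> u0; have [L uL] := env_coef_bound u.
have [|a [w [? ? ? _]]] := top_word uL; last by exists a, w.
apply: contrapT => no; case/eqP: u0; apply: env_coef_eq0; apply/funext => w.
by apply/eqP; apply: contrapT => /negP uw; apply: no; exists w.
Qed.

Lemma lie_form_supp (s : seq (P * lie_tree n)) :
  exists L, supp_le L (lie_form s).
Proof.
exists (\sum_(p <- s) tdeg p.2)%N; elim: s => [|p s IH] w; rewrite /lie_form.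
  by rewrite !big_nil.
rewrite !big_cons => sw; rewrite [X in _ + X]IH; last by lia.
by rewrite lie_coef_size ?mulr0 ?addr0 // gtn_eqF // (leq_ltn_trans (leq_addr _ _) sw).
Qed.

Lemma lie_form_nil (s : seq (P * lie_tree n)) : lie_form s [::] = 0.
Proof.
rewrite /lie_form big1 // => p _; rewrite lie_coef_size ?mulr0 //=.
by rewrite eq_sym -lt0n tdeg_gt0.
Qed.

Lemma lie_form_homog (s : seq (P * lie_tree n)) r w : size w = r ->
  lie_form [seq p <- s | tdeg p.2 == r] w = lie_form s w.
Proof.
move=> sw; rewrite /lie_form big_filter big_mkcond /=; apply: eq_bigr => p _.
by case: ifP => // E; rewrite lie_coef_size ?mulr0 // sw eq_sym E.
Qed.

Definition proportional (F G : seq 'I_n -> P) :=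
  exists p q : P, (p != 0) || (q != 0) /\ forall w, p * F w = q * G w.

Section EuclidStep.
Variable N : nat.
Hypothesis IH : forall (a b : seq (P * lie_tree n)) i j u v,
  (i + j < N)%N -> supp_le i (lie_form a) -> supp_le j (lie_form b) ->
  (u != 0) || (v != 0) ->
  (forall w, series_act u (lie_form a) w + series_act v (lie_form b) w = 0) ->
  proportional (lie_form a) (lie_form b).

(** The relation at words beginning with u1 makes the top part of p a a left multiple of that of b,
    with p in P. By [lie_left_factor] this forces i = j; then the multiplier is an element c0 of P,
    and p a - c0 b has smaller degree. *)
Lemma euclid_step (a b : seq (P * lie_tree n)) i j u v w1 w2 :
  (i + j <= N)%N -> (j <= i)%N ->
  supp_le i (lie_form a) -> supp_le j (lie_form b) ->
  size w1 = i -> size w2 = j -> lie_form a w1 != 0 -> lie_form b w2 != 0 ->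
  (u != 0) -> (v != 0) ->
  (forall w, series_act u (lie_form a) w + series_act v (lie_form b) w = 0) ->
  proportional (lie_form a) (lie_form b).
Proof.
move=> ijN ji ai bj s1 s2 a1 b2 u0 v0 uv.
have i0 : (0 < i)%N.
  by rewrite -s1; case: (w1) a1 => //; rewrite lie_form_nil eqxx.
have [mu [u1 [umu su1 uu1]]] := env_top u0.
have [mv [v1 [vmv sv1 vv1]]] := env_top v0.
(* Otherwise the top part of the product of larger degree would have nothing to cancel against. *)
have E : (mu + i = mv + j)%N.
  apply/eqP; rewrite eqn_leq; apply/andP; split; rewrite leqNgt; apply/negP => lt.
    have := uv (u1 ++ w1); rewrite (series_act_lead umu ai) //.
    rewrite (series_act_supp vmv bj) ?size_cat ?su1 ?s1 // addr0 => /eqP.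
    by rewrite (negPf (fp_mulf_neq0 uu1 a1)).
  have := uv (v1 ++ w2); rewrite (series_act_lead vmv bj) //.
  rewrite (series_act_supp umu ai) ?size_cat ?sv1 ?s2 // add0r => /eqP.
  by rewrite (negPf (fp_mulf_neq0 vv1 b2)).
pose p := env_coef u u1; pose c y := - env_coef v (u1 ++ y).
have pc y1 y2 : size y1 = (i - j)%N -> size y2 = j ->
    p * lie_form a (y1 ++ y2) = c y1 * lie_form b y2.
  move=> sy1 sy2; have := uv (u1 ++ y1 ++ y2).
  rewrite (series_act_lead umu ai) //; last by rewrite size_cat; lia.
  rewrite catA (series_act_lead vmv bj) //; last by rewrite size_cat; lia.
  by move=> /eqP; rewrite addr_eq0 /c mulNr => /eqP.
case: (ltngtP j i) ji => // [ji _|Eij _].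
  pose s := [seq (p * q.1, q.2) | q <- [seq q <- a | tdeg q.2 == (i - j + j)%N]].
  have ij0 : (0 < i - j)%N by rewrite subn_gt0.
  have ss : all (fun q => tdeg q.2 == (i - j + j)%N) s.
    by rewrite all_map; apply: filter_all.
  have sb y1 y2 : size y1 = (i - j)%N -> size y2 = j ->
      lie_form s (y1 ++ y2) = c y1 * lie_form [seq q <- b | tdeg q.2 == j] y2.
    move=> sy1 sy2; rewrite lie_formZ !lie_form_homog ?pc //.
    by rewrite size_cat sy1 sy2.
  have st1 : size (take (i - j) w1) = (i - j)%N by rewrite size_take s1; case: ltnP; lia.
  have sd1 : size (drop (i - j) w1) = j by rewrite size_drop s1; lia.
  have cb : c (take (i - j) w1) * lie_form b (drop (i - j) w1) = 0.
    have [-> | bd] := lie_left_factor ij0 ss (filter_all _ _) sb st1 sd1.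
      by rewrite mul0r.
    by rewrite -(lie_form_homog b sd1) bd mulr0.
  have /eqP := pc _ _ st1 sd1; rewrite cat_take_drop cb.
  by rewrite (negPf (fp_mulf_neq0 uu1 a1)).
pose c0 := c [::]; pose a' := [seq (p * q.1, q.2) | q <- a] ++ [seq (- c0 * q.1, q.2) | q <- b].
have a'E w : lie_form a' w = p * lie_form a w - c0 * lie_form b w.
  by rewrite lie_form_cat !lie_formZ (mulNr c0).
(* The relation for a must become one for a': as p^M u = u' p, multiplying the old relation by p^M
   on the left lets p be absorbed into a', and u' c0 compensates for the part of b in a'. *)
have [M [u' uE]] := env_ore p u.
have u'0 : u' != 0.
  have : m (p ^+ M) * u != 0 by rewrite env_m_mul_neq0 ?fp_expf_neq0.
  by apply: contraNneq => u'0; rewrite uE u'0 mul0r.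
have [||||p1 [q1 [pq1 pqE]]] := IH (a := a') (b := b) (i := i.-1) (j := j)
    (u := u') (v := u' * m c0 + m (p ^+ M) * v) _ _ bj.
- by rewrite Eij in ijN *; lia.
- move=> w sw; rewrite a'E; have [sw'|sw'] := leqP (size w) i; last first.
    by rewrite ai // bj ?Eij // !mulr0 subrr.
  have wi : size w = i.
    by apply/eqP; rewrite eqn_leq sw' -[X in (X <= _)%N](prednK i0).
  by rewrite -[w]cat0s pc ?subrr ?Eij ?subnn //=.
- by rewrite u'0.
- move=> w; have -> : lie_form a' = (fun w => series_act (m p) (lie_form a) w
      + series_act (m (- c0)) (lie_form b) w).
    apply/funext => y; rewrite a'E !series_act_m. by rewrite (mulNr c0).
  rewrite series_actDr series_actDl -!series_actM -uE env_mN mulrN series_actNl.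
  rewrite addrA addrNK !series_actM !series_act_m -mulrDr uv mulr0 //.
(* Obtained by expanding p1 (p a - c0 b) = q1 b; if p1 = 0 the second coefficient is q1, which is
   then nonzero. *)
exists (p1 * p), (q1 + p1 * c0); split=> [|w].
  have [p10|p10] := eqVneq p1 0; last by rewrite fp_mulf_neq0.
  by move: pq1; rewrite p10 eqxx !mul0r addr0 /= => ->; rewrite orbT.
apply/eqP; rewrite -subr_eq0 -[X in _ == X](subrr (q1 * lie_form b w)) -{1}pqE a'E.
by apply/eqP; ring.
Qed.

End EuclidStep.

Lemma lie_forms_proportional N (a b : seq (P * lie_tree n)) i j u v :
  (i + j < N)%N -> supp_le i (lie_form a) -> supp_le j (lie_form b) ->
  (u != 0) || (v != 0) ->
  (forall w, series_act u (lie_form a) w + series_act v (lie_form b) w = 0) ->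
  proportional (lie_form a) (lie_form b).
Proof.
elim: N a b i j u v => // N IH a b i j u v ijN ai bj uv0 uv.
have propC F G : proportional F G -> proportional G F.
  by move=> [p [q [pq pqE]]]; exists q, p; split=> [|w]; [rewrite orbC | rewrite pqE].
have [[w1 a1]|a0] := pselect (exists w, lie_form a w != 0); last first.
  exists 1, 0; split=> [|w]; first by rewrite oner_neq0.
  rewrite mul1r mul0r; apply/eqP; apply: contrapT => /negP aw.
  by apply: a0; exists w.
have [[w2 b2]|b0] := pselect (exists w, lie_form b w != 0); last first.
  exists 0, 1; split=> [|w]; first by rewrite oner_neq0 orbT.
  rewrite mul1r mul0r; apply/esym/eqP; apply: contrapT => /negP bw.
  by apply: b0; exists w.
have [i' [y1 [ai' s1 ay1 ii']]] := top_word ai (ex_intro _ w1 a1).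
have [j' [y2 [bj' s2 by2 jj']]] := top_word bj (ex_intro _ w2 b2).
have act_neq0 t (G : seq 'I_n -> P) l y : t != 0 -> supp_le l G -> size y = l -> G y != 0 ->
    exists w, series_act t G w != 0.
  move=> t0 Gl sy Gy; have [c [z [tc sz tz]]] := env_top t0.
  by exists (z ++ y); rewrite (series_act_lead tc Gl sz sy) fp_mulf_neq0.
have u0 : u != 0.
  apply: contraTneq uv0 => u0; rewrite u0 eqxx /=; apply/negP => v0.
  have [w] := act_neq0 v _ _ _ v0 bj' s2 by2.
  by have := uv w; rewrite u0 series_act0l add0r => ->; rewrite eqxx.
have v0 : v != 0.
  apply/negP => /eqP v0; have [w] := act_neq0 u _ _ _ u0 ai' s1 ay1.
  by have := uv w; rewrite v0 series_act0l addr0 => ->; rewrite eqxx.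
have [ji|ij] := leqP j' i'.
  by apply: (euclid_step IH _ ji ai' bj' s1 s2 ay1 by2 u0 v0 uv); lia.
apply: propC; apply: (euclid_step IH _ (ltnW ij) bj' ai' s2 s1 by2 ay1 v0 u0) => [|w].
  by lia.
by rewrite addrC uv.
Qed.

(** Applied to the unit series, H(f) gives d f, so a left relation becomes a relation between Lie
    forms. *)
Lemma left_dependent_diff (f g : P) :
  left_dependent (tnth [tuple h f; h g]) -> proportional (diff f) (diff g).
Proof.
move=> [c [[i ci] /(congr1 (@series_act k n))]].
rewrite big_ord_recl big_ord1 !(tnth_nth 0) /= => E.
have [s [fs _]] := diff_lie_form x f; have [t [gt _]] := diff_lie_form x g.
have [L1 sL1] := lie_form_supp s; have [L2 tL2] := lie_form_supp t.
rewrite (funext fs) (funext gt).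
apply: (@lie_forms_proportional (L1 + L2).+1 s t L1 L2 (c ord0) (c (lift ord0 ord0))) => //.
  move: ci; case: (unliftP ord0 i) => [i' ->|-> ->] //.
  by rewrite [i']ord1 => ->; rewrite orbT.
move=> w; have := congr1 (fun F => F (wdelta P [::]) w) E.
rewrite series_act0l series_actDl !series_actM.
have act1 f' : series_act (h f') (wdelta P [::]) = diff f'.
  apply/funext => y; rewrite series_act_h.
  have -> : bracket f' (wdelta P [::] y) = 0.
    by rewrite /wdelta; case: eqP; rewrite ?bracket1r ?bracket0r.
  rewrite add0r; elim: y (diff f') => [|i' y IH] F; first exact: mulr1.
  by rewrite conv_cons IH /wdelta mulr0 add0r.
by rewrite !act1 (funext fs) (funext gt).
Qed.

End LeftDependence.

(** * A theorem of Luroth type *)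

Section Gauss.
Variable K : fieldType.
Implicit Types (p b : {poly K}) (M Q H : {poly {poly K}}).

Lemma min_divisor b : (1 < size b)%N ->
  exists p, [/\ p %| b, (1 < size p)%N
    & forall q, q %| b -> (1 < size q)%N -> (size p <= size q)%N].
Proof.
move=> b1; pose A s := `[< exists p, [/\ p %| b, (1 < size p)%N & size p = s] >].
have exA : exists s, A s by exists (size b); apply/asboolP; exists b; rewrite dvdpp.
case: (ex_minnP exA) => s /asboolP[p [pb p1 <-]] minA; exists p; split=> // q qb q1.
by apply: minA; apply/asboolP; exists q.
Qed.

Lemma min_divisor_prime b p : b != 0 -> p %| b -> (1 < size p)%N ->
  (forall q, q %| b -> (1 < size q)%N -> (size p <= size q)%N) ->
  forall c d, p %| c * d -> p %| c \/ p %| d.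
Proof.
move=> b0 pb p1 minp c d pcd; have p0 : p != 0 by rewrite -size_poly_gt0 ltnW.
have g0 : gcdp p c != 0 by rewrite gcdp_eq0 (negPf p0).
have [g1|g1] := leqP (size (gcdp p c)) 1.
  have cop : coprimep p c by rewrite /coprimep eqn_leq g1 lt0n size_poly_eq0.
  by right; rewrite -(Gauss_dvdpr _ cop).
left; have gb : gcdp p c %| b by apply: dvdp_trans pb; apply: dvdp_gcdl.
have : gcdp p c %= p.
  rewrite -(dvdp_size_eqp (dvdp_gcdl p c)) eqn_leq minp // andbT.
  exact: dvdp_leq p0 (dvdp_gcdl _ _).
by move=> /eqp_dvdl <-; apply: dvdp_gcdr.
Qed.

Lemma polyC_dvd p M : (forall i, p %| M`_i) -> exists M', M = p%:P * M'.
Proof.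
move=> pM; exists (map_poly (fun c => c %/ p) M); apply/polyP => i.
by rewrite coefCM coef_map_id0 ?div0p // mulrC divpK.
Qed.

Lemma gauss_prime p M Q : (forall c d, p %| c * d -> p %| c \/ p %| d) ->
  (forall i, p %| (M * Q)`_i) -> (forall i, p %| M`_i) \/ (forall i, p %| Q`_i).
Proof.
move=> prp pMQ.
have first H : ~ (forall i, p %| H`_i) ->
    exists i, ~~ (p %| H`_i) /\ forall j, (j < i)%N -> p %| H`_j.
  move=> nH; have exn : exists i, ~~ (p %| H`_i).
    by apply: contrapT => no; apply: nH => i; apply: contrapT => /negP pi; apply: no; exists i.
  case: (ex_minnP exn) => i pi mini; exists i; split=> // j ji.
  by apply: contraLR ji => /mini; rewrite -leqNgt.
apply: contrapT => /not_orP[/first[i [Mi iM]] /first[j [Qj jQ]]].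
have := pMQ (i + j)%N; rewrite coefM.
have li : (i < (i + j).+1)%N by rewrite ltnS leq_addr.
rewrite (bigD1 (Ordinal li)) //= addKn dvdp_addl.
  by move=> /prp[]; apply/negP.
apply: (big_ind (fun c => p %| c)) => [|c d pc pd|a na]; first exact: dvdp0.
  exact: dvdp_add.
have [ai|ia] := ltnP a i; first by apply/dvdp_mulr/iM.
apply/dvdp_mull/jQ.
have ai : a != i :> nat by apply: contra na => /eqP ai; apply/eqP/val_inj.
by have := ltn_ord a; lia.
Qed.

(** Irreducible factors of b are removed one by one, each dividing M or Q by primality; b1 collects
    those taken from M. *)
Lemma gauss b M Q H : b != 0 -> M * Q = b%:P * H ->
  exists b1 M' Q', M = b1%:P * M' /\ H = M' * Q'.
Proof.
have [s] := ubnP (size b); elim: s => // s IH in b M Q H * => sb b0 MQ.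
have [b1|b1] := leqP (size b) 1.
  have bE := size1_polyC b1; exists 1, M, ((b`_0)^-1%:P%:P * Q).
  have c0 : b`_0 != 0 by move: b0; rewrite {1}bE polyC_eq0.
  by rewrite polyC1 mul1r mulrCA MQ {2}bE mulrA -!polyCM mulVf // !polyC1 mul1r.
have [p [pb p1 minp]] := min_divisor b1.
have p0 : p != 0 by rewrite -size_poly_gt0 ltnW.
have pP0 : p%:P != 0 :> {poly {poly K}} by rewrite polyC_eq0.
have bE : b = p * (b %/ p) by rewrite mulrC divpK.
have b'0 : b %/ p != 0 by apply: contraNneq b0 => b'0; rewrite bE b'0 mulr0.
have sb' : (size (b %/ p)%R < s)%N.
  by rewrite -ltnS; apply: leq_trans sb; rewrite ltnS {2}bE size_mul // -(prednK (ltnW p1)) addSn /= -subn_gt0 addnK; case: (size p) p1 => [|[]].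
have pMQ i : p %| (M * Q)`_i by rewrite MQ coefCM dvdp_mulr.
have [/polyC_dvd[M' ME]|/polyC_dvd[Q' QE]] :=
    gauss_prime (min_divisor_prime b0 pb p1 minp) pMQ.
  have MQ' : M' * Q = (b %/ p)%:P * H.
    by apply: (mulfI pP0); rewrite mulrA -ME MQ {1}bE polyCM mulrA.
  have [b1' [M1 [Q1 [E1 E2]]]] := IH _ _ _ _ sb' b'0 MQ'.
  by exists (p * b1'), M1, Q1; rewrite ME E1 polyCM mulrA.
have MQ' : M * Q' = (b %/ p)%:P * H.
  by apply: (mulfI pP0); rewrite mulrCA -QE MQ {1}bE polyCM mulrA.
exact: IH _ _ _ _ sb' b'0 MQ'.
Qed.

End Gauss.

Section Luroth.
Variables (k : fieldType) (R : idomainType).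
Variables (kap : {rmorphism k -> R}) (eps : {rmorphism R -> k}).
Hypothesis kapK : cancel kap eps.
(** The algebra to be generated by one element. Closure under exact division is [Cdiv]; by [Clead]
    its nonzero elements are monic in X up to a scalar of k, so one can divide by them over R and
    [eps] preserves their degree. *)
Variable C : {poly R} -> Prop.
Hypothesis Ck : forall c, C (kap c)%:P.
Hypothesis CD : forall f g, C f -> C g -> C (f + g).
Hypothesis CM : forall f g, C f -> C g -> C (f * g).
Hypothesis Cdiv : forall f g, C f -> f != 0 -> C (f * g) -> C g.
Hypothesis Clead : forall f, C f -> exists c, lead_coef f = kap c.

Local Notation A := {poly R}.
Let rho (f : A) : {poly k} := map_poly eps f.
(* The variable of A is X; ev evaluates polynomials in T over A at X = T. *)
Let ev (H : {poly A}) : {poly k} := (map_poly (map_poly eps) H).['X].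
Let lift (w : {poly k}) : {poly A} := map_poly (polyC \o kap) w.
Let dif (f : A) : {poly A} := lift (rho f) - f%:P.
(** Polynomials over C vanishing under T = X. A nonzero one of least degree plays the role of the
    minimal polynomial of X over the fraction field of C. *)
Let inI (H : {poly A}) := (forall i, C H`_i) /\ ev H = 0.

Let C0 : C 0. Proof. by have := Ck 0; rewrite rmorph0 polyC0. Qed.

Let CN f : C f -> C (- f).
Proof. by have := Ck (-1); rewrite rmorphN1 => C1 Cf; rewrite -mulN1r -polyC1 -polyCN; apply: CM. Qed.

Let CB f g : C f -> C g -> C (f - g).
Proof. by move=> Cf Cg; apply: CD => //; apply: CN. Qed.

Let evD H1 H2 : ev (H1 + H2) = ev H1 + ev H2.
Proof. by rewrite /ev rmorphD hornerD. Qed.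

Let evB H1 H2 : ev (H1 - H2) = ev H1 - ev H2.
Proof. by rewrite /ev rmorphB hornerD hornerN. Qed.

Let evM H1 H2 : ev (H1 * H2) = ev H1 * ev H2.
Proof. by rewrite /ev rmorphM hornerM. Qed.

Let evC f : ev f%:P = rho f.
Proof. by rewrite /ev map_polyC hornerC. Qed.

Let ev_lift w : ev (lift w) = w.
Proof.
rewrite /ev /lift -map_poly_comp.
rewrite (eq_map_poly (g := polyC)); last first.
  by move=> c /=; rewrite map_polyC /= kapK.
by rewrite -[RHS]comp_polyXr.
Qed.

Let kap_eq0 c : (kap c == 0) = (c == 0).
Proof. by rewrite fmorph_eq0. Qed.

Let rho_eq0 f : C f -> rho f = 0 -> f = 0.
Proof.
move=> /Clead[c cE] /polyP/(_ (size f).-1); rewrite coef_map coef0 /= -lead_coefE cE kapK => c0.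
apply/eqP; by rewrite -lead_coef_eq0 cE c0 rmorph0.
Qed.

Let size_rho f : C f -> size (rho f) = size f.
Proof.
move=> /Clead[c cE]; have [->|f0] := eqVneq f 0; first by rewrite /rho rmorph0 !size_poly0.
rewrite /rho size_map_poly_id0 // cE kapK.
by apply: contraNneq f0 => c0; rewrite -lead_coef_eq0 cE c0 rmorph0.
Qed.

Let C_lift w i : C (lift w)`_i.
Proof. by rewrite coef_map_id0 ?Ck //= rmorph0. Qed.

Let inI_dif f : C f -> inI (dif f).
Proof.
move=> Cf; split=> [i|]; last by rewrite evB ev_lift evC subrr.
rewrite coefB coefC; apply: CB; first exact: C_lift.
by case: ifP.
Qed.

Let size_lift w : size (lift w) = size w.
Proof.
have [->|w0] := eqVneq w 0; first by rewrite /lift rmorph0 !size_poly0.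
by rewrite size_map_poly_id0 //= polyC_eq0 kap_eq0 lead_coef_eq0.
Qed.

Let size_dif f : C f -> (1 < size f)%N -> size (dif f) = size f.
Proof.
move=> Cf f1; rewrite /dif size_polyDl size_lift size_rho // size_polyN.
by apply: leq_ltn_trans f1; apply: size_polyC_leq1.
Qed.

(* A nonzero element of least degree divides the others up to a power of its
   leading coefficient. *)
Let minimal_div m H : inI m -> m != 0 ->
  (forall H, inI H -> H != 0 -> (size m <= size H)%N) -> inI H ->
  exists N Q, (lead_coef m ^+ N)%:P * H = m * Q.
Proof.
move=> [Cm evm] m0 minm; have [s] := ubnP (size H).
elim: s => // s IH in H * => sH IHH; have [CH evH] := IHH.
have [->|H0] := eqVneq H 0; first by exists 0%N, 0; rewrite !mulr0.
pose b := lead_coef m; pose X := (lead_coef H)%:P * 'X^(size H - size m).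
have mH : (size m <= size H)%N by apply: minm.
have CXn j i : C ('X^j`_i : A).
  by rewrite coefXn; case: (i == j); [have := Ck 1; rewrite rmorph1 | exact: C0].
have Csum (F : {poly A}) (G : {poly A}) i : (forall i, C F`_i) -> (forall i, C G`_i) -> C (F * G)`_i.
  by move=> CF CG; rewrite coefM; apply: big_ind => // a _; apply: CM.
have inI1 : inI (b%:P * H - X * m).
  split=> [i|]; last by rewrite evB !evM evm evH !mulr0 subrr.
  rewrite coefB; apply: CB; apply: (Csum) => // j.
    by rewrite coefC; case: ifP => // _; apply: Cm.
  by apply: (Csum) => // l; rewrite coefC; case: ifP => // _; apply: CH.
have b0 : b != 0 by rewrite lead_coef_eq0.
have sm0 : (0 < size m)%N by rewrite size_poly_gt0.
have s1 : (size (b%:P * H - X * m)%R < size H)%N.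
  rewrite -[X in (_ < X)%N](prednK (leq_trans sm0 mH)) ltnS.
  apply/leq_sizeP => j Hj; rewrite coefB coefCM -mulrA coefCM coefXnM.
  have aux (h' m' : nat) : (m' <= h' -> 0 < m' -> h'.-1 <= j ->
      [/\ (j < h' - m') = false, h' <= j -> m' <= j - (h' - m'),
          j < h' -> j = h'.-1 & h'.-1 - (h' - m') = m'.-1])%N by split; lia.
  have [aux1 aux2 aux3 aux4] := aux _ _ mH sm0 Hj.
  rewrite aux1; have [jH|jH] := leqP (size H) j.
    by rewrite !nth_default ?mulr0 ?subrr //; apply: aux2.
  rewrite (aux3 jH) aux4.
  by rewrite -!lead_coefE mulrC subrr.
have [|N [Q E]] := IH _ _ inI1; first exact: leq_trans s1 sH.
exists N.+1, (Q + (b ^+ N)%:P * X).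
rewrite mulrDr -E mulrBr [m * (_ * X)]mulrCA [m * X]mulrC subrK.
by rewrite mulrA -polyCM -exprSr.
Qed.

Let lead_dif f : C f -> (1 < size f)%N ->
  lead_coef (dif f) = (kap (lead_coef (rho f)))%:P.
Proof.
move=> Cf f1; rewrite lead_coefE size_dif // coefB coefC.
have -> : ((size f).-1 == 0)%N = false by case: (size f) f1 => [|[]].
by rewrite subr0 coef_map_id0 /= ?rmorph0 // lead_coefE size_rho.
Qed.

Let tofrac_inj : injective (@FracField.tofrac R).
Proof. by move=> c d /eqP; rewrite tofrac_eq => /eqP. Qed.

(** Over the fraction field of R, Gauss's lemma splits M as b1 M' with M' dividing [dif F]. The
    leading coefficient of the latter is a scalar, so M' has a constant leading coefficient and b1
    is the leading coefficient of M up to a unit. *)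
Let minimal_lead_dvd M F : inI M -> M != 0 ->
  (forall H, inI H -> H != 0 -> (size M <= size H)%N) -> C F -> (1 < size F)%N ->
  forall i, exists c, M`_i = lead_coef M * c.
Proof.
move=> IM M0 minM CF F1 i; pose b := lead_coef M; have Cb : C b by apply: IM.1.
have b0 : b != 0 by rewrite lead_coef_eq0.
have [cb cbE] := Clead Cb.
have cb0 : cb != 0 by rewrite -kap_eq0 -cbE lead_coef_eq0.
pose tau : {rmorphism A -> {poly {fraction R}}} := map_poly (@FracField.tofrac R).
have tau_inj : injective tau by apply: map_inj_poly; [exact: tofrac_inj | exact: rmorph0].
have size_tau f : size (tau f) = size f by apply: size_map_inj_poly; [exact: tofrac_inj | exact: rmorph0].
have tau0 : forall f, (tau f == 0) = (f == 0).
  by move=> f; rewrite -!size_poly_eq0 size_tau.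
pose tt : {rmorphism {poly A} -> {poly {poly {fraction R}}}} := map_poly tau.
have lead_tt H : lead_coef (tt H) = tau (lead_coef H).
  by apply: lead_coef_map_inj; [exact: tau_inj | exact: rmorph0].
have [N [Q E]] := minimal_div IM M0 minM (inI_dif CF).
have E' : tt M * tt Q = (tau (b ^+ N))%:P * tt (dif F).
  by rewrite -rmorphM -E rmorphM /= map_polyC.
have bN0 : tau (b ^+ N) != 0 by rewrite tau0 expf_neq0.
have [b1 [M' [Q' [ME FE]]]] := gauss bN0 E'.
have /eqP : size (lead_coef M' * lead_coef Q') = 1%N.
  rewrite -lead_coefM -FE lead_tt lead_dif // size_tau size_polyC kap_eq0 lead_coef_eq0.
  by rewrite -size_poly_eq0 size_rho //; case: (size F) F1.
rewrite size_mul_eq1 => /andP[/eqP M'1 _].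
have eE := size1_polyC (eq_leq M'1); set e := (lead_coef M')`_0 in eE.
have e0 : e != 0 by rewrite -polyC_eq0 -eE -size_poly_eq0 M'1.
have b1E : b1 = tau b * (e^-1)%:P.
  rewrite -[tau b]lead_tt ME lead_coefM lead_coefC eE -mulrA -polyCM mulfV //.
  by rewrite polyC1 mulr1.
(* The divisibility has to descend from the fraction field to R: division by the monic d is possible
   over R, and its remainder is a multiple of b of smaller degree, hence 0. *)
pose d := kap cb^-1 *: b.
have dmon : d \is monic.
  by rewrite monicE lead_coefZ cbE -rmorphM mulVf // rmorph1.
have Md := Pdiv.RingMonic.rdivp_eq dmon M`_i.
set q := Pdiv.Ring.rdivp _ _ in Md; set r := Pdiv.Ring.rmodp _ _ in Md.
have dE : d = b * (kap cb^-1)%:P by rewrite mulrC mul_polyC.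
suff r0 : r = 0.
  by exists (q * (kap cb^-1)%:P); rewrite Md r0 addr0 dE mulrCA.
have tM : tau M`_i = tau b * ((e^-1)%:P * M'`_i).
  by rewrite -[LHS](coef_map tau) -/(tt M) ME coefCM b1E mulrA.
have tr : tau r = tau b * ((e^-1)%:P * M'`_i - tau (q * (kap cb^-1)%:P)).
  rewrite mulrBr -tM Md dE !rmorphD !rmorphM /= mulrCA addrAC subrr add0r //.
apply/eqP; rewrite -tau0 tr mulf_eq0 tau0 (negPf b0) /=; apply: contraTT isT => X0.
have : (size r < size d)%N by rewrite Pdiv.Ring.ltn_rmodp monic_neq0.
have -> : size d = size b by rewrite size_scale // kap_eq0 invr_eq0.
rewrite -(size_tau r) -(size_tau b) tr size_mul ?tau0 // -subn1 -addnBA ?size_poly_gt0 //.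
by rewrite ltnNge leq_addr.
Qed.

(** Dividing M by its leading coefficient gives a monic m in [inI] dividing all its members. For a
    coefficient a of m of largest X-degree, [dif a] is a scalar multiple of m. Modulo [dif a], the
    polynomial rho f in T, expanded in powers of rho a, gets coefficients in k[a] and T-degree below
    deg a; f is its constant term. *)
Lemma luroth : exists a, C a /\ forall f, C f -> exists p : {poly k},
  f = (map_poly (polyC \o kap) p).[a].
Proof.
have [[F [CF F1]]|allconst] := pselect (exists F, C F /\ (1 < size F)%N); last first.
  (* Here C has only constants in X; each is its own leading coefficient, hence a scalar. *)
  exists 0; split=> // f Cf; have f1 : (size f <= 1)%N.
    by rewrite leqNgt; apply/negP => f1; apply: allconst; exists f.
  have [c cE] := Clead Cf; exists c%:P; rewrite map_polyC hornerC /=.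
  rewrite -cE [LHS](size1_polyC f1) lead_coefE; congr (_`_ _)%:P.
  by case: (size f) f1 => [|[]].
have [M [IM M0 minM]] : exists M, [/\ inI M, M != 0
    & forall H, inI H -> H != 0 -> (size M <= size H)%N].
  pose B s := `[< exists M, [/\ inI M, M != 0 & size M = s] >].
  have exB : exists s, B s.
    exists (size (dif F)); apply/asboolP; exists (dif F); split=> //.
      exact: inI_dif.
    by rewrite -size_poly_gt0 size_dif // ltnW.
  case: (ex_minnP exB) => s /asboolP[M [IM M0 <-]] minB; exists M; split=> // H IH H0.
  by apply: minB; apply/asboolP; exists H.
have Cb : C (lead_coef M) by apply: IM.1.
have b0 : lead_coef M != 0 by rewrite lead_coef_eq0.
have [c cE] := choice (minimal_lead_dvd IM M0 minM CF F1).
pose m : {poly A} := \poly_(i < size M) c i.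
have mE : M = (lead_coef M)%:P * m.
  apply/polyP => i; rewrite coefCM coef_poly; case: ltnP => [_|Mi]; first exact: cE.
  by rewrite mulr0 nth_default.
clearbody m; have m0 : m != 0 by apply: contraNneq M0 => m0; rewrite mE m0 mulr0.
have size_m : size m = size M by rewrite [in RHS]mE mul_polyC size_scale.
have m_monic : lead_coef m = 1.
  by apply: (mulfI b0); rewrite mulr1 [in RHS]mE lead_coefM lead_coefC.
have Im : inI m.
  split=> [i|]; first by apply: (Cdiv Cb b0); rewrite -coefCM -mE; apply: IM.1.
  have /eqP := IM.2; rewrite mE evM evC mulf_eq0 => /orP[/eqP/(rho_eq0 Cb)/eqP|/eqP //].
  by rewrite (negPf b0).
have m_dvd H : inI H -> exists Q, H = m * Q.
  move=> IH; have [|N [Q]] := minimal_div Im m0 _ IH.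
    by move=> H'; rewrite size_m; apply: minM.
  by rewrite m_monic expr1n polyC1 mul1r => ->; exists Q.
(* a coefficient of m of largest degree generates C *)
have [i0 ai0] : {i0 : 'I_(size m) | sizeY m = size m`_i0}.
  by apply: eq_bigmax; rewrite card_ord size_poly_gt0.
set a := m`_i0 in ai0; have Ca : C a by apply: Im.1.
have a1 : (1 < size a)%N.
  rewrite ltnNge -ai0; apply/negP => m1.
  (* If no coefficient involved X, m would be lifted from k[T], and its value at T = X would be m
     itself up to naming, hence nonzero. *)
  have mlift : m = lift (\poly_(i < size m) eps (m`_i)`_0).
    apply/polyP => i; rewrite coef_map_id0 /= ?rmorph0 // coef_poly.
    case: ltnP => [_|mi] /=; last by rewrite nth_default // rmorph0.
    have m1i := leq_trans (max_size_coefXY m i) m1.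
    have [d dE] := Clead (Im.1 i).
    rewrite {1}(size1_polyC m1i); congr _%:P.
    have E : (m`_i)`_0 = kap d.
      by rewrite -dE lead_coefE; case: (size m`_i) m1i => [|[]].
    by rewrite E kapK.
  move: Im.2; rewrite mlift ev_lift => E; case/eqP: m0.
  by rewrite mlift E /lift rmorph0.
have [q qE] := m_dvd _ (inI_dif Ca).
have la : lead_coef a != 0 by rewrite lead_coef_eq0 -size_poly_gt0 ltnW.
(* [swapXY] makes X the main variable. Both [dif a] and m have the X-degree of a, so q is free of X;
   the leading coefficient of [dif a] in X is free of T, so q is a constant. *)
have size_swap : size (swapXY (dif a)) = size a.
  apply/eqP; rewrite eqn_leq -sizeYE; apply/andP; split.
    apply/bigmax_leqP => i _; rewrite coefB coefC coef_map_id0 /= ?rmorph0 //.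
    apply: leq_trans (size_polyD _ _) _; rewrite geq_max size_polyN.
    rewrite (leq_trans (size_polyC_leq1 _) (ltnW a1)) /=.
    by case: ifP; rewrite ?size_poly0.
  apply: leq_trans (max_size_coefXY _ 0); rewrite coefB coefC eqxx coef_map_id0 /= ?rmorph0 //.
  by rewrite addrC size_polyDl size_polyN // (leq_ltn_trans (size_polyC_leq1 _) a1).
have lead_swap : lead_coef (swapXY (dif a)) = (- lead_coef a)%:P.
  apply/polyP => i; rewrite lead_coefE size_swap coef_swapXY coefB !coefC.
  rewrite coef_map_id0 /= ?rmorph0 // coefB coefC.
  have -> : ((size a).-1 == 0)%N = false by case: (size a) a1 => [|[]].
  by rewrite sub0r; case: (i == 0)%N; rewrite ?coef0 ?oppr0.
have dif0 : dif a != 0 by rewrite -size_poly_gt0 size_dif // ltnW.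
have q0 : q != 0 by apply: contraNneq dif0 => q0; rewrite qE q0 mulr0.
have swap_mq : swapXY (dif a) = swapXY m * swapXY q by rewrite qE rmorphM.
have sq1 : size (swapXY q) = 1%N.
  have : size (swapXY (dif a)) = ((size (swapXY m)) + (size (swapXY q))).-1.
    by rewrite swap_mq size_mul ?swapXY_eq0.
  rewrite size_swap -sizeYE ai0; have : (0 < size (swapXY q))%N.
    by rewrite size_poly_gt0 swapXY_eq0.
  by move: (size (swapXY q)) (size a) a1 => x y; lia.
have qC := size1_polyC (eq_leq sq1); set q1 := (swapXY q)`_0 in qC.
have sq1' : size q1 = 1%N.
  have : size (lead_coef (swapXY m) * lead_coef (swapXY q)) == 1%N.
    by rewrite -lead_coefM -swap_mq lead_swap size_polyC oppr_eq0 la.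
  by rewrite size_mul_eq1 qC lead_coefC => /andP[_ /eqP].
have qE' : q = (q1`_0)%:P%:P.
  by rewrite -[q]swapXYK qC (size1_polyC (eq_leq sq1')) swapXY_polyC map_polyC coefC.
have dvd_dif H : inI H -> exists Q, H = dif a * Q.
  move=> /m_dvd[Q ->]; exists ((kap (lead_coef (rho a))^-1)%:P%:P * Q).
  have qlead : q1`_0 = kap (lead_coef (rho a)).
    apply/eqP; rewrite -(inj_eq (@polyC_inj _)) -lead_dif // qE lead_coefM m_monic.
    by rewrite mul1r qE' lead_coefC.
  rewrite qE -mulrA; congr (_ * _); rewrite qE' qlead mulrA -!polyCM -rmorphM mulfV.
    by rewrite rmorph1 !polyC1 mul1r.
  by rewrite lead_coef_eq0 -size_poly_gt0 size_rho // ltnW.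
pose al := rho a; have al1 : (1 < size al)%N by rewrite size_rho.
pose ph (p : {poly k}) : A := (map_poly (polyC \o kap) p).[a].
have phC c0 : ph c0%:P = (kap c0)%:P by rewrite /ph map_polyC hornerC.
have ph0 : ph 0 = 0 by rewrite -polyC0 phC rmorph0.
(* Digits of w in base rho a: Euclidean division by [al] is repeated, and modulo [dif a] the lift of
   [al] is a. *)
have expand w : exists W : nat -> {poly k}, exists Q,
    lift w - \poly_(i < (size a).-1) ph (W i) = dif a * Q.
  have [s] := ubnP (size w); elim: s => // s IH in w *; rewrite ltnS => sw.
  have [wa|wa] := ltnP (size w) (size a).
    exists (fun i => (w`_i)%:P), 0; rewrite mulr0; apply/eqP; rewrite subr_eq0.
    apply/eqP/polyP => i; rewrite [LHS]coef_map_id0 /= ?rmorph0 // coef_poly phC.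
    case: ltnP => // ia; rewrite nth_default ?rmorph0 //.
    by apply: leq_trans ia; rewrite -ltnS prednK // ltnW.
  have al0 : al != 0 by rewrite -size_poly_gt0 ltnW.
  have su : (size (w %/ al)%R < s)%N.
    apply: leq_trans sw; rewrite size_divp // size_rho //.
    have sa0 : (0 < (size a).-1)%N by case: (size a) a1 => [|[]].
    by rewrite ltn_subrL sa0 /=; apply: leq_trans wa; apply: ltnW.
  have [W [Q WQ]] := IH _ su.
  have sv : (size (w %% al)%R < size a)%N by rewrite -(size_rho Ca) ltn_modp.
  exists (fun i => 'X * W i + ((w %% al)`_i)%:P), (lift (w %/ al) + a%:P * Q).
  have phE p c0 : ph ('X * p + c0%:P) = a * ph p + (kap c0)%:P.
    rewrite /ph rmorphD rmorphM /= map_polyX map_polyC /= hornerD hornerM hornerX.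
    by rewrite hornerC.
  have -> : \poly_(i < (size a).-1) ph ('X * W i + ((w %% al)`_i)%:P)
      = a%:P * \poly_(i < (size a).-1) ph (W i) + lift (w %% al).
    apply/polyP => i; rewrite coefD coefCM [(lift _)`_i]coef_map_id0 /= ?rmorph0 //.
    rewrite !coef_poly; case: ltnP => ia; first by rewrite phE.
    rewrite mulr0 add0r [(w %% al)`_i]nth_default ?rmorph0 //.
    by apply: leq_trans ia; rewrite -ltnS prednK // ltnW.
  rewrite {1}(divp_eq w al) [X in X - _](_ : _ = lift (w %/ al) * lift al + lift (w %% al)).
    rewrite opprD addrACA subrr addr0 mulrDr [_ * (a%:P * Q)]mulrCA -WQ /dif -/al.
    ring.
  by rewrite /lift rmorphD rmorphM.
exists a; split=> // f Cf.
have [W [Q WQ]] := expand (rho f); have [Q' fQ] := dvd_dif _ (inI_dif Cf).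
have fW : \poly_(i < (size a).-1) ph (W i) - f%:P = dif a * (Q' - Q).
  by rewrite mulrBr -fQ -WQ /dif; ring.
(* A nonzero multiple of [dif a] has T-degree at least deg a, whereas the left side of [fW] has
   smaller degree. *)
have QQ : Q' - Q = 0.
  apply/eqP; apply: contraTT isT => QQ.
  have : (size (dif a) <= size (dif a * (Q' - Q))%R)%N.
    by rewrite size_mul // -subn1 -addnBA ?size_poly_gt0 // leq_addr.
  rewrite -fW size_dif // leqNgt => /negP[].
  apply: leq_ltn_trans (size_polyD _ _) _; rewrite gtn_max size_polyN.
  rewrite (leq_ltn_trans (size_polyC_leq1 _) a1) andbT.
  by apply: leq_ltn_trans (size_poly _ _) _; rewrite prednK // ltnW.
exists (W 0%N); move: fW; rewrite QQ mulr0 => /eqP; rewrite subr_eq0 => /eqP.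
move=> /polyP/(_ 0%N); rewrite coef_poly coefC eqxx.
by case: (size a) a1 => [|[]].
Qed.

End Luroth.

(** Uniqueness of digits in base B; it separates the monomials of a polynomial by weights. *)
Lemma digits_inj N B (f g : 'I_N -> nat) :
  (forall i, f i < B)%N -> (forall i, g i < B)%N ->
  (\sum_i f i * B ^ i = \sum_i g i * B ^ i)%N -> f =1 g.
Proof.
elim: N f g => [|N IH] f g fB gB E; first by case.
have B0 : (0 < B)%N by apply: leq_ltn_trans (fB ord0).
have shift (h : 'I_N.+1 -> nat) : (\sum_i h i * B ^ i
    = h ord0 + (\sum_i h (lift ord0 i) * B ^ i) * B)%N.
  rewrite big_ord_recl muln1 big_distrl; congr (_ + _)%N.
  by apply: eq_bigr => i _; rewrite /= /bump /= add1n expnS -mulnA [(B * _)%N]mulnC.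
move: E; rewrite !shift => E.
have E0 : f ord0 = g ord0.
  have := congr1 (modn^~ B) E.
  by rewrite /= ![(_ ord0 + _)%N]addnC !modnMDl !modn_small.
have /eqP := E; rewrite E0 eqn_add2l eqn_pmul2r // => /eqP E1 i.
case: (unliftP ord0 i) => [j|] -> //.
exact: (IH (fun j => f (lift ord0 j)) (fun j => g (lift ord0 j))).
Qed.

Lemma coefM_top (R : nzRingType) (p q : {poly R}) a b :
  (size p <= a.+1)%N -> (size q <= b.+1)%N -> (p * q)`_(a + b) = p`_a * q`_b.
Proof.
move=> pa qb; rewrite coefM.
have la : (a < (a + b).+1)%N by rewrite ltnS leq_addr.
rewrite (bigD1 (Ordinal la)) //= addKn big1 ?addr0 // => i ni.
have ni' : i != a :> nat by apply: contra ni => /eqP ia; apply/eqP/val_inj.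
have [ia|ia] := ltnP a i; first by rewrite nth_default ?mul0r // (leq_trans pa).
have {}ia : (i < a)%N by rewrite ltn_neqAle ni'.
rewrite [q`__]nth_default ?mulr0 //; apply: leq_trans qb _.
by rewrite ltn_subRL ltn_add2r.
Qed.

Lemma seq_argmax (T : eqType) (s : seq T) (w : T -> nat) : (exists x, x \in s) ->
  exists2 x, x \in s & forall y, y \in s -> (w y <= w x)%N.
Proof.
elim: s => [[x]|x s IH _]; first by rewrite in_nil.
case: s IH => [_|z s IH].
  by exists x; rewrite ?inE // => y; rewrite inE => /eqP ->.
have [|m ms mmax] := IH; first by exists z; rewrite inE eqxx.
have [wm|wm] := leqP (w x) (w m).
  by exists m => [|y]; rewrite inE ?ms ?orbT // => /orP[/eqP ->|/mmax].
exists x => [|y]; rewrite inE ?eqxx // => /orP[/eqP ->|/mmax ym] //.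
exact: leq_trans ym (ltnW wm).
Qed.

Section MpolyLuroth.
Variables (k : fieldType) (char0 : [pchar k] =i pred0) (N : nat).
Local Notation R := {mpoly k[N]}.

Section Shift.
Variable e : 'I_N -> nat.

(** A Nagata substitution: the extra variable X records weights, so a suitable e makes a given
    polynomial monic in X up to a scalar, and X = 0 undoes it. *)
Definition mshift_def : R -> {poly R} :=
  mmap (polyC \o @mpolyC N k) (fun i => ('X_i)%:P + 'X^(e i)).

HB.instance Definition _ := GRing.RMorphism.on mshift_def.

Fact mshift_key : unit. Proof. by []. Qed.
Definition mshift := locked_with mshift_key mshift_def.

Lemma mshiftE : mshift = mshift_def. Proof. by rewrite /mshift unlock. Qed.

Lemma mshiftC c : mshift c%:MP = (c%:MP)%:P.
Proof. by rewrite mshiftE /mshift_def mmapC. Qed.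

Lemma mshiftX i : mshift 'X_i = ('X_i)%:P + 'X^(e i).
Proof. by rewrite mshiftE /mshift_def mmapX mmap1U. Qed.

Lemma mshiftD f g : mshift (f + g) = mshift f + mshift g.
Proof. by rewrite mshiftE; apply: (rmorphD mshift_def). Qed.

Lemma mshiftM f g : mshift (f * g) = mshift f * mshift g.
Proof. by rewrite mshiftE; apply: (rmorphM mshift_def). Qed.

Lemma mshift_nat d : mshift d%:R = d%:R.
Proof. by rewrite mshiftE; apply: (rmorph_nat mshift_def). Qed.

Lemma mshift0r : mshift 0 = 0.
Proof. by rewrite mshiftE; apply: (rmorph0 mshift_def). Qed.

Lemma mshiftZ c h : mshift (c *: h) = (c%:MP)%:P * mshift h.
Proof. by rewrite -mul_mpolyC mshiftM mshiftC. Qed.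

Lemma mshift_sum (I : Type) (r : seq I) (Q : pred I) (h : I -> R) :
  mshift (\sum_(i <- r | Q i) h i) = \sum_(i <- r | Q i) mshift (h i).
Proof. exact: (big_morph _ mshiftD mshift0r). Qed.

Lemma mshift_monomE m : mshift 'X_[m] = \prod_i (('X_i)%:P + 'X^(e i)) ^+ m i.
Proof. by rewrite mshiftE /mshift_def mmapX. Qed.

Hypothesis e0 : forall i, (0 < e i)%N.

Lemma mshift0 h : (mshift h).[0] = h.
Proof.
elim/mpoly_alg_ind: h => [c|i|f g fE gE|f g fE gE].
- by rewrite mshiftC hornerC.
- by rewrite mshiftX hornerD hornerC hornerXn expr0n (gtn_eqF (e0 i)) addr0.
- by rewrite mshiftD hornerD; congr (_ + _).
- by rewrite mshiftM hornerM; congr (_ * _).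
Qed.

Lemma mshift_eq0 h : (mshift h == 0) = (h == 0).
Proof.
by apply/eqP/eqP => [E|->]; [rewrite -(mshift0 h) E horner0 | rewrite mshift0r].
Qed.

Lemma coef_mshift_deriv j h l : (mshift h^`M(j))`_l = ((mshift h)`_l)^`M(j).
Proof.
elim/mpoly_alg_ind: h l => [c|i|f g fE gE|f g fE gE] l.
- rewrite mderivC mshift0r coef0 mshiftC coefC.
  by case: ifP; rewrite ?mderivC ?mderiv0.
- rewrite mderivU mshiftX coefD mderivD coefC coefXn.
  have -> : ((l == e i)%:R : R)^`M(j) = 0.
    by case: eqP; rewrite ?mderiv0 // -[1%:R]/(1%:MP) mderivC.
  rewrite addr0 mshift_nat -polyC_natr.
  by rewrite coefC; case: ifP; rewrite ?mderivU ?mderiv0.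
- by rewrite mderivD !mshiftD !coefD mderivD fE gE.
- rewrite mderivM !mshiftD !mshiftM !coefD !coefM raddf_sum -big_split.
  by apply: eq_bigr => a _; rewrite /= mderivM fE gE.
Qed.

Lemma deriv_mshift h :
  (mshift h)^`() = \sum_i ((e i)%:R *: 'X^((e i).-1)) * mshift h^`M(i).
Proof.
elim/mpoly_alg_ind: h => [c|j|f g fE gE|f g fE gE].
- by rewrite mshiftC derivC big1 // => i _; rewrite mderivC mshift0r mulr0.
- rewrite mshiftX derivD derivC add0r derivXn (bigD1 j) //= mderivU eqxx mshift_nat.
  rewrite mulr1 big1 ?addr0 => [|i ne]; first by rewrite scaler_nat.
  by rewrite mderivU (negPf ne) mshift_nat mulr0.
- rewrite mshiftD derivD fE gE -big_split; apply: eq_bigr => i _.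
  by rewrite mderivD mshiftD mulrDr.
- rewrite mshiftM derivM fE gE mulr_suml mulr_sumr -big_split.
  apply: eq_bigr => i _; rewrite mderivM mshiftD !mshiftM /=; ring.
Qed.

(** Parallel gradients and the chain rule give F' times the j-th derivative of h equal to the j-th
    derivative of F times h', where the primes are derivatives in X. The leading coefficient of F is
    constant, so differentiating by j lowers the X-degree of F; the right side is then too small in
    degree, and the top coefficient of the left side kills the derivative of the leading coefficient
    of h. *)
Lemma mshift_lead_const (F h : R) :
  (1 < size (mshift F))%N -> (exists c, lead_coef (mshift F) = c%:MP) ->
  (forall i j, F^`M(i) * h^`M(j) = F^`M(j) * h^`M(i)) ->
  exists c, lead_coef (mshift h) = c%:MP.
Proof.
move=> sF [al alE] Fh.
have [->|h0] := eqVneq h 0; first by exists 0; rewrite mshift0r lead_coef0.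
have al0 : al != 0.
  apply: contraTneq sF => al0; move: alE; rewrite al0 => /eqP.
  by rewrite lead_coef_eq0 => /eqP ->; rewrite size_poly0.
have sh : (0 < size (mshift h))%N by rewrite size_poly_gt0 mshift_eq0.
set l := (size (mshift h)).-1; set m := (size (mshift F)).-2.
have lE : size (mshift h) = l.+1 by rewrite prednK.
have mE : size (mshift F) = m.+2 by rewrite /m; case: (size _) sF => [|[]].
have alm : (mshift F)`_m.+1 = al%:MP by rewrite -alE lead_coefE mE.
suff dlead j : (lead_coef (mshift h))^`M(j) = 0.
  by exists (lead_coef (mshift h))@_0%MM; apply: mpoly_deriv0.
have E : (mshift F)^`() * mshift h^`M(j) = mshift F^`M(j) * (mshift h)^`().
  rewrite !deriv_mshift mulr_suml mulr_sumr; apply: eq_bigr => i _.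
  by rewrite -mulrA -mshiftM Fh mshiftM mulrCA.
have := congr1 (fun p : {poly R} => p`_(m + l)) E; rewrite coefM_top; last first.
- by apply/leq_sizeP => j' lj; rewrite coef_mshift_deriv nth_default ?mderiv0 // lE.
- by apply/leq_sizeP => j' mj; rewrite coef_deriv nth_default ?mul0rn // mE.
rewrite [RHS]nth_default; last first.
  apply: leq_trans (size_polyMleq _ _) _.
  have s1 : (size (mshift F^`M(j)) <= m.+1)%N.
    apply/leq_sizeP => j' mj; rewrite coef_mshift_deriv.
    have [->|ne] := eqVneq j' m.+1; first by rewrite alm mderivC.
    by rewrite nth_default ?mderiv0 // mE ltn_neqAle eq_sym ne.
  have s2 : (size (mshift h)^`() <= l)%N.
    by rewrite -ltnS -lE lt_size_deriv // -size_poly_gt0.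
  by move: s1 s2; move: (size _) (size _) => x y; lia.
rewrite coef_deriv alm coef_mshift_deriv -[(mshift h)`_l]/(lead_coef (mshift h)).
move=> /eqP; rewrite -mulr_natr mulf_eq0 => /orP[|/eqP //].
by rewrite mulf_eq0 mpolyC_eq0 (negPf al0) -mpolyC_nat mpolyC_eq0 (negPf (natr_neq0 _ _)).
Qed.

Let monic_deg (p : {poly R}) d := p \is monic /\ size p = d.+1.

Let monic_degM p q d d' :
  monic_deg p d -> monic_deg q d' -> monic_deg (p * q) (d + d').
Proof.
move=> [mp sp] [mq sq]; split; first by rewrite rpredM.
by rewrite size_monicM ?monic_neq0 // sp sq addSn addnS.
Qed.

Let monic_deg1 : monic_deg 1 0.
Proof. by split; [exact: monic1 | exact: size_poly1]. Qed.

Definition mweight (m : 'X_{1.. N}) : nat := \sum_i m i * e i.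

Lemma mshift_monom m :
  mshift 'X_[m] \is monic /\ size (mshift 'X_[m]) = (mweight m).+1.
Proof.
rewrite mshift_monomE /mweight -/(monic_deg _ _).
apply: (big_ind2 monic_deg) => [|p d q d' | i _] //; first exact: monic_degM.
have Xi : monic_deg (('X_i)%:P + 'X^(e i)) (e i).
  have lt : (size (('X_i)%:P : {poly R})%R < size ('X^(e i) : {poly R})%R)%N.
    by rewrite size_polyXn ltnS (leq_trans (size_polyC_leq1 _)) .
  rewrite addrC; split; last by rewrite (size_polyDl lt) size_polyXn.
  by rewrite monicE lead_coefDl // lead_coefXn eqxx.
elim: (m i) => [|d IH]; first by rewrite mul0n.
by rewrite exprS mulSn; apply: monic_degM.
Qed.

(** A monomial becomes monic in X of degree its weight; with distinct weights the heaviest monomial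
    alone determines the leading term. *)
Lemma mshift_lead F : F != 0 -> {in msupp F &, injective mweight} ->
  exists m, [/\ m \in msupp F, size (mshift F) = (mweight m).+1,
    lead_coef (mshift F) = (F@_m)%:MP
    & forall m', m' \in msupp F -> (mweight m' <= mweight m)%N].
Proof.
move=> F0 winj.
have [m mF maxm] : exists2 m, m \in msupp F
    & forall m', m' \in msupp F -> (mweight m' <= mweight m)%N.
  apply: seq_argmax; first by exists (mlead F); apply: mlead_supp.
exists m; have [mm sm] := mshift_monom m.
have Fm : F@_m != 0 by rewrite -mcoeff_msupp.
have sizem : size (((F@_m)%:MP)%:P * mshift 'X_[m]) = (mweight m).+1.
  by rewrite mul_polyC size_scale ?mpolyC_eq0.
set rest := \sum_(m' <- msupp F | m' != m) F@_m' *: 'X_[m'].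
have FE : mshift F = ((F@_m)%:MP)%:P * mshift 'X_[m] + mshift rest.
  rewrite {1}[F]mpolyE (bigD1_seq m) ?msupp_uniq //=.
  by rewrite mshiftD mshiftZ.
have srest : (size (mshift rest) < (mweight m).+1)%N.
  rewrite ltnS mshift_sum big_seq_cond; apply: (big_ind (fun p : {poly R} => (size p <= mweight m)%N)).
  - by rewrite size_poly0.
  - by move=> p q sp sq; apply: leq_trans (size_polyD _ _) _; rewrite geq_max sp.
  move=> m' /andP[m'F ne]; rewrite mshiftZ mul_polyC.
  apply: leq_trans (size_scale_leq _ _) _; rewrite (mshift_monom m').2.
  rewrite ltn_neqAle maxm // andbT; apply: contra ne => /eqP wE.
  by apply/eqP; apply: winj.
split=> //; first by rewrite FE size_polyDl sizem.
rewrite FE lead_coefDl ?sizem // mul_polyC lead_coefZ.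
by have /monicP -> := mm; rewrite mulr1.
Qed.

End Shift.

Lemma mpoly_deriv0P (F : R) : (forall i, F^`M(i) = 0) \/ exists2 m, m \in msupp F & m != 0%MM.
Proof.
have [[m mF m0]|no] := pselect (exists2 m, m \in msupp F & m != 0%MM); first by right; exists m.
left=> i; have -> : F = (F@_0%MM)%:MP; last by rewrite mderivC.
apply/mpolyP => m; rewrite mcoeffC; have [->|m0] := eqVneq m 0%MM; first by rewrite mulr1.
rewrite mulr0; apply: contrapT => /eqP Fm; apply: no; exists m => //.
by rewrite mcoeff_msupp.
Qed.

(** The polynomials with gradient parallel to that of F form an algebra closed under exact division
    and containing G. Its shift satisfies the assumptions of [luroth], and X = 0 brings the result
    back. *)
Lemma mpoly_luroth_nonconst (F G p q : R) : ~ (forall i, F^`M(i) = 0) ->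
  (p != 0) || (q != 0) -> (forall i, p * F^`M(i) = q * G^`M(i)) ->
  exists a, (exists P : {poly k}, F = horner_alg a P)
    /\ (exists Q : {poly k}, G = horner_alg a Q).
Proof.
move=> Fnc pq FG.
have [//|[m1 m1F m10]] := mpoly_deriv0P F.
have F0 : F != 0 by apply: contraTneq m1F => ->; rewrite msupp0.
have q0 : q != 0.
  apply: contra_notN Fnc => /eqP q0 i; apply/eqP; have /eqP := FG i.
  rewrite q0 mul0r mulf_eq0 => /orP[/eqP p0|//].
  by rewrite p0 q0 eqxx in pq.
(* Every exponent in F is smaller than B, so exponent vectors are digit sequences and the weights
   B^i are injective on its monomials. *)
pose B := (msize F).+1; pose e (i : 'I_N) := (B ^ i)%N.
have e0 i : (0 < e i)%N by rewrite expn_gt0.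
have digitB m i : m \in msupp F -> (m i < B)%N.
  move=> /msize_mdeg_lt mF; rewrite ltnS ltnW //; apply: leq_ltn_trans mF.
  by rewrite mdegE (bigD1 i) //= leq_addr.
have winj : {in msupp F &, injective (mweight e)}.
  move=> m m' mF m'F wE; apply/mnmP; apply: (digits_inj _ _ wE) => i; exact: digitB.
have [m [mF sF lF maxm]] := mshift_lead e0 F0 winj.
have s1 : (1 < size (mshift e F))%N.
  rewrite sF ltnS; apply: leq_trans (maxm _ m1F).
  rewrite lt0n; apply: contra m10; rewrite sum_nat_eq0 => /forallP w0.
  apply/eqP/mnmP => i; rewrite mnm0E; apply/eqP.
  by have /implyP/(_ isT) := w0 i; rewrite muln_eq0 -[(e i == 0)%N]negbK -lt0n e0 orbF.
pose D h := forall i j, F^`M(i) * h^`M(j) = F^`M(j) * h^`M(i).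
pose C (H : {poly R}) := exists2 h, H = mshift e h & D h.
have DF : D F by move=> i j; apply: mulrC.
have DG : D G.
  by move=> i j; apply: (mulfI q0); rewrite mulrCA -FG [RHS]mulrCA -FG; ring.
have [||||||a [[a' aE _] gen]] := @luroth k R (@mpolyC N k) (mcoeff 0%MM) _ C.
- by move=> c /=; rewrite mcoeffC eqxx mulr1.
- move=> c; exists c%:MP; first by rewrite mshiftC.
  by move=> i j; rewrite !mderivC !mulr0.
- move=> f g [f' -> Df] [g' -> Dg]; exists (f' + g'); first by rewrite mshiftD.
  by move=> i j; rewrite !mderivD !mulrDr Df Dg.
- move=> f g [f' -> Df] [g' -> Dg]; exists (f' * g'); first by rewrite mshiftM.
  move=> i j; rewrite !mderivM !mulrDr !mulrA Df.
  by rewrite -!mulrA ![F^`M(_) * (f' * _)]mulrCA Dg.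
- move=> f g [f' -> Df]; rewrite mshift_eq0 // => f'0 [h hE Dh].
  have hfg : h = f' * g.[0] by rewrite -(mshift0 e0 h) -hE hornerM mshift0.
  exists g.[0].
    apply: (mulfI (_ : mshift e f' != 0)); first by rewrite mshift_eq0.
    by rewrite hE hfg mshiftM.
  move=> i j; apply: (mulfI f'0); have := Dh i j; rewrite hfg !mderivM !mulrDr.
  rewrite !mulrA Df => /addrI; rewrite -!mulrA ![F^`M(_) * (f' * _)]mulrCA //.
- move=> f [f' -> Df].
  by apply: (mshift_lead_const e0 s1 _ Df); exists F@_m.
have shift_alg P : mshift e (horner_alg a' P) = (map_poly (polyC \o @mpolyC N k) P).[a].
  rewrite aE mshiftE /horner_alg /horner_morph -(horner_map (mshift_def e)).
  rewrite -map_poly_comp; congr _.[_]; apply: eq_map_poly => c /=.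
  by rewrite -mul_mpolyC mulr1 -mshiftE mshiftC.
have pullback H : D H -> exists P : {poly k}, H = horner_alg a' P.
  move=> DH; have [|P PE] := gen (mshift e H); first by exists H.
  by exists P; rewrite -(mshift0 e0 H) PE -shift_alg mshift0.
by exists a'; split; apply: pullback.
Qed.

Lemma mpoly_luroth (F G p q : R) :
  (p != 0) || (q != 0) -> (forall i, p * F^`M(i) = q * G^`M(i)) ->
  exists a, (exists P : {poly k}, F = horner_alg a P)
    /\ (exists Q : {poly k}, G = horner_alg a Q).
Proof.
move=> pq FG.
have [Fc|Fnc] := pselect (forall i, F^`M(i) = 0); last first.
  exact: mpoly_luroth_nonconst Fnc pq FG.
have [Gc|Gnc] := pselect (forall i, G^`M(i) = 0).
  have const (H : R) : (forall i, H^`M(i) = 0) -> exists P : {poly k}, H = horner_alg (0 : R) P.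
    move=> /(mpoly_deriv0 char0) ->; exists (H@_0%MM)%:P.
    by rewrite horner_algC -mul_mpolyC mulr1.
  by exists 0; split; apply: const.
have [||a [? ?]] := @mpoly_luroth_nonconst G F q p Gnc; [by rewrite orbC | by [] |].
by exists a.
Qed.

End MpolyLuroth.

(** * Dependence *)

Lemma morph_mmap_alg (k : fieldType) (A B : comAlgType k) (phi : A -> B) m
    (f : 'I_m -> A) F :
  {morph phi : x y / x + y} -> {morph phi : x y / x * y} ->
  (forall c : k, phi c%:A = c%:A) ->
  phi (mmap (in_alg A) f F) = mmap (in_alg B) (phi \o f) F.
Proof.
move=> phiD phiM phiA; elim/mpoly_alg_ind: F => [c|i|F G EF EG|F G EF EG].
- by rewrite !mmapC /= phiA.
- by rewrite !mmapX !mmap1U.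
- by rewrite !mmapD phiD EF EG.
- by rewrite !rmorphM /= phiM EF EG.
Qed.

Lemma eq_mmap_alg (k : fieldType) (A : comAlgType k) m (f g : 'I_m -> A) F :
  f =1 g -> mmap (in_alg A) f F = mmap (in_alg A) g F.
Proof. by move=> /funext ->. Qed.

Section TrivialPoisson.
Variables (k : fieldType) (m : nat).

Definition trivial_poisson := {mpoly k[m]}.
HB.instance Definition _ := GRing.ComAlgebra.on trivial_poisson.
Let br (F G : trivial_poisson) : trivial_poisson := 0.

Let brPl (c : k) F G H : br (c *: F + G) H = c *: br F H + br G H.
Proof. by rewrite /br scaler0 addr0. Qed.
Let brPr (c : k) F G H : br F (c *: G + H) = c *: br F G + br F H.
Proof. by rewrite /br scaler0 addr0. Qed.
Let brxx F : br F F = 0. Proof. by []. Qed.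
Let brJ F G H : br F (br G H) + br G (br H F) + br H (br F G) = 0.
Proof. by rewrite /br !addr0. Qed.
Let brM F G H : br F (G * H) = br F G * H + G * br F H.
Proof. by rewrite /br mul0r mulr0 addr0. Qed.

HB.instance Definition _ := isPoisson.Build k trivial_poisson brPl brPr brxx brJ brM.

End TrivialPoisson.

(** Freeness would map the generated subalgebra to the polynomial algebra with zero bracket, sending
    f_i to X_i; a polynomial relation F would then be sent to F itself, which is nonzero. *)
Lemma poly_dependent_poisson_dependent (k : fieldType) (P : poissonType k) m
    (f : 'I_m -> P) :
  poly_dependent f -> poisson_dependent f.
Proof.
move=> [F [F0 fF]] free.
have [phi [_ phiX _]] := free (trivial_poisson k m) (fun i => 'X_i).
pose A := poisson_subalg f.
have E0 : mmap (in_alg A) (@psub_gen _ _ _ f) F = 0.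
  apply: val_inj; rewrite -[RHS]fF.
  exact: (@morph_mmap_alg k A P (fun x => val x) m (psub_gen f) F).
move: F0; have <- : mmap (in_alg (trivial_poisson k m)) (fun i => 'X_i) F = F.
  elim/mpoly_alg_ind: F {fF E0} => [c|i|F G EF EG|F G EF EG].
  - by rewrite mmapC /= -mul_mpolyC mulr1.
  - by rewrite mmapX mmap1U.
  - by rewrite mmapD; congr (_ + _).
  - by rewrite rmorphM; congr (_ * _).
have <- : phi (mmap (in_alg A) (@psub_gen _ _ _ f) F)
    = mmap (in_alg (trivial_poisson k m)) (fun i => 'X_i) F.
  rewrite (morph_mmap_alg (B := trivial_poisson k m)).
  - by apply: eq_mmap_alg => i; apply: phiX.
  - exact: rmorphD.
  - exact: rmorphM.
  - by move=> c; rewrite linearZ rmorph1.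
by rewrite E0 rmorph0 eqxx.
Qed.

Lemma msize_mderiv (R : nzRingType) m (F : {mpoly R[m]}) i s :
  (msize F <= s.+1)%N -> (msize F^`M(i) <= s)%N.
Proof.
move=> Fs; rewrite [msize _]msizeE; apply/bigmax_leqP_seq => e eF _.
move: eF; rewrite mcoeff_msupp mcoeff_deriv => eF.
have /msize_mdeg_lt : (e + U_(i))%MM \in msupp F.
  by rewrite mcoeff_msupp; apply: contra eF => /eqP ->; rewrite mul0rn.
by rewrite mdegD mdeg1 addn1 => eF'; rewrite -ltnS; apply: leq_trans Fs.
Qed.

(** Bracketing F(f, g) = 0 with f and with g gives each partial derivative at (f, g) times the
    bracket of f and g. If that bracket is nonzero, the derivatives are again relations, of smaller
    degree, hence 0; so F is a constant, hence 0. *)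
Lemma poly_dependent_bracket (k : fieldType) (char0 : [pchar k] =i pred0)
    (P : poissonType k) (dom : forall u v : P, u * v = 0 -> u = 0 \/ v = 0) (f g : P) :
  poly_dependent (tnth [tuple f; g]) -> bracket f g = 0.
Proof.
set fg := tnth _; move=> [F [F0 fF]]; apply: contrapT => fg0.
pose ev := mmap (in_alg P) fg.
have fg1 : fg ord0 = f by rewrite /fg (tnth_nth 0).
have fg2 : fg (lift ord0 ord0) = g by rewrite /fg (tnth_nth 0).
have evX i : ev 'X_i = fg i by rewrite /ev mmapX mmap1U.
have evC c : ev c%:MP = c%:A by rewrite /ev mmapC.
have evD G H : ev (G + H) = ev G + ev H by apply: mmapD.
have evM G H : ev (G * H) = ev G * ev H by apply: (rmorphM (mmap (in_alg P) fg)).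
have ev0 : ev 0 = 0 by apply: mmap0.
have brl G : bracket f (ev G) = ev G^`M(lift ord0 ord0) * bracket f g.
  elim/mpoly_alg_ind: G => [c|i|G H EG EH|G H EG EH].
  - by rewrite evC bracketAr mderivC ev0 mul0r.
  - rewrite evX mderivU; case: (unliftP ord0 i) => [j ->|->].
      by rewrite [j]ord1 eqxx fg2 -[1%:R]/(1%:MP) evC scale1r mul1r.
    by rewrite fg1 bracketxx ev0 mul0r.
  - by rewrite evD bracketDr mderivD evD mulrDl EG EH.
  - rewrite evM bracketM mderivM evD !evM EG EH; ring.
have brr G : bracket (ev G) g = ev G^`M(ord0) * bracket f g.
  elim/mpoly_alg_ind: G => [c|i|G H EG EH|G H EG EH].
  - by rewrite evC bracketC bracketAr oppr0 mderivC ev0 mul0r.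
  - rewrite evX mderivU; case: (unliftP ord0 i) => [j ->|->].
      by rewrite [j]ord1 fg2 bracketxx ev0 mul0r.
    by rewrite eqxx fg1 -[1%:R]/(1%:MP) evC scale1r mul1r.
  - by rewrite evD bracketDl mderivD evD mulrDl EG EH.
  - rewrite evM bracketMl mderivM evD !evM EG EH; ring.
suff inj s G : (msize G <= s)%N -> ev G = 0 -> G = 0.
  by move/eqP: F0; apply; apply: (inj (msize F)).
elim: s G => [|s IH] G sG G0.
  by apply/eqP; rewrite -msize_poly_eq0 -leqn0.
have dG i : G^`M(i) = 0.
  apply: IH; first exact: msize_mderiv.
  suff : ev G^`M(i) * bracket f g = 0 by move=> /dom[].
  case: (unliftP ord0 i) => [j ->|->]; last by rewrite -brr G0 bracket0l.
  by rewrite [j]ord1 -brl G0 bracket0r.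
rewrite (mpoly_deriv0 char0 dG) in G0 *.
move: G0; rewrite evC => /eqP; rewrite scaler_eq0 oner_eq0 orbF => /eqP ->.
by [].
Qed.

(** H(f) and H(g) commute, so they serve as each other's coefficients; when H(f) = 0 these may both
    vanish, and the coefficients 1 and 0 are taken. *)
Lemma bracket0_left_dependent (k : fieldType) (P : poissonType k) (f g : P) :
  bracket f g = 0 -> left_dependent (tnth [tuple env_h f; env_h g]).
Proof.
move=> fg; pose c (i : 'I_2) := if i == ord0 then env_h g else - env_h f.
have [f0|f0] := eqVneq (env_h f) 0.
  exists (fun i => (i == ord0)%:R); split; first by exists ord0; rewrite oner_neq0.
  by rewrite big_ord_recl big_ord1 !(tnth_nth 0) /= mul1r mul0r addr0.
exists c; split; first by exists (lift ord0 ord0); rewrite /c /= oppr_eq0.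
rewrite big_ord_recl big_ord1 !(tnth_nth 0) /c /= mulNr.
by rewrite -env_hB bracketC fg oppr0 env_h0.
Qed.

Lemma horner_alg_poly_dependent (k : fieldType) (A : comAlgType k) (a : A) (p q : {poly k}) :
  poly_dependent (tnth [tuple horner_alg a p; horner_alg a q]).
Proof.
(* The (D + 1)^2 products p^i q^j with i, j at most D all have size at most D^2 + 1, so they are
   linearly dependent; the relation is then evaluated at a. *)
pose D := (size p + size q).+1.
pose N := (D.+1 * D.+1)%N; pose M := (D * D).+1.
pose ei (r : 'I_N) := (r %/ D.+1)%N; pose ej (r : 'I_N) := (r %% D.+1)%N.
pose v r := p ^+ ei r * q ^+ ej r.
have eiD r : (ei r <= D)%N by rewrite -ltnS ltn_divLR.
have ejD r : (ej r <= D)%N by rewrite -ltnS ltn_mod.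
have sv r : (size (v r) <= M)%N.
  apply: leq_trans (size_polyMleq _ _) _.
  have sp := size_poly_exp_leq p (ei r); have sq := size_poly_exp_leq q (ej r).
  have : ((size p).-1 * ei r + (size q).-1 * ej r <= D * D)%N.
    apply: leq_trans (leq_add (leq_mul (leq_pred _) (eiD r)) (leq_mul (leq_pred _) (ejD r))) _.
    by rewrite -mulnDl leq_mul2r leqnSn orbT.
  move: sp sq; rewrite /M; move: (size (p ^+ _)) (size (q ^+ _)) => x y.
  by move: (_ * _)%N (_ * _)%N (_ * _)%N => z t u; lia.
pose B : 'M[k]_(N, M) := \matrix_(r, c) (v r)`_c.
have ker0 : kermx B != 0.
  rewrite kermx_eq0 /row_free neq_ltn; apply/orP; left.
  apply: leq_ltn_trans (rank_leq_col B) _.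
  by rewrite /M /N mulSn mulnS /D; move: (_ * _)%N; lia.
pose u := nz_row (kermx B).
have uB : u *m B = 0 by apply/sub_kermxP; apply: nz_row_sub.
have u0 : u != 0 by rewrite nz_row_eq0.
have vu : \sum_r u 0 r *: v r = 0.
  apply/polyP => c; rewrite coef_sum coef0.
  have [cM|cM] := ltnP c M.
    have := congr1 (fun X : 'rV_M => X 0 (Ordinal cM)) uB.
    rewrite mxE [RHS]mxE => E; rewrite -[RHS]E.
    by apply: eq_bigr => r _; rewrite mxE coefZ.
  by rewrite big1 // => r _; rewrite coefZ nth_default ?mulr0 // (leq_trans (sv r)).
pose mon r : 'X_{1.. 2} := (U_(ord0) *+ ei r + U_(lift ord0 ord0) *+ ej r)%MM.
have mon_inj : injective mon.
  move=> r s E; apply/val_inj; rewrite /= (divn_eq r D.+1) (divn_eq s D.+1).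
  have := congr1 (fun m : 'X_{1.. 2} => m ord0) E.
  have := congr1 (fun m : 'X_{1.. 2} => m (lift ord0 ord0)) E.
  rewrite /mon !mnmDE !mulmnE !mnm1E /= !mul0n !mul1n !addn0 !add0n.
  by rewrite /ei /ej => -> ->.
exists (\sum_r u 0 r *: 'X_[mon r]); split.
  apply: contraNneq u0 => /mpolyP uF; apply/eqP/rowP => r.
  have := uF (mon r); rewrite mcoeff0 raddf_sum (bigD1 r) //= mcoeffZ mcoeffX eqxx.
  rewrite mulr1 big1 ?addr0 ?mxE // => s sr.
  by rewrite mcoeffZ mcoeffX (inj_eq mon_inj) (negPf sr) mulr0.
set fg := tnth _; have fg1 : fg ord0 = horner_alg a p by rewrite /fg (tnth_nth 0).
have fg2 : fg (lift ord0 ord0) = horner_alg a q by rewrite /fg (tnth_nth 0).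
rewrite raddf_sum -[RHS](rmorph0 (horner_alg a)) -vu rmorph_sum.
apply: eq_bigr => r _; rewrite /= mmapZ -mul_polyC [RHS]rmorphM /= horner_algC.
congr (_ * _).
rewrite mmapX /mmap1 big_ord_recl big_ord1 fg1 fg2.
rewrite /mon !mnmDE !mulmnE !mnm1E /= !mul0n !mul1n !addn0 !add0n.
by rewrite rmorphM !rmorphXn.
Qed.

Section ProportionalDiff.
Variables (k : fieldType) (char0 : [pchar k] =i pred0) (n : nat).
Local Notation P := (freePoisson k n).

(** The generator A found in the polynomial algebra need not come from P, but its retraction does
    the work: [wproj] is an algebra morphism and gives back f and g. *)
Lemma proportional_diff_luroth (f g : P) : proportional (diff f) (diff g) ->
  exists a : P, (exists p : {poly k}, f = horner_alg a p)
    /\ (exists q : {poly k}, g = horner_alg a q).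
Proof.
move=> [p [q [pq fg]]].
have [d1 [gf gg]] := lie_gen_ex2 f g; have [d2 [gp gq]] := lie_gen_ex2 p q.
pose d := (d1 + d2)%N.
have {}gf : lie_gen d f by apply: lie_gen_le gf; apply: leq_addr.
have {}gg : lie_gen d g by apply: lie_gen_le gg; apply: leq_addr.
have {}gp : lie_gen d p by apply: lie_gen_le gp; apply: leq_addl.
have {}gq : lie_gen d q by apply: lie_gen_le gq; apply: leq_addl.
have [||A [[F1 fE] [G1 gE]]] :=
  @mpoly_luroth k char0 _ (wemb d f) (wemb d g) (wemb d p) (wemb d q).
- case/orP: pq => [p0|q0]; apply/orP; [left | right].
    by apply: contra p0 => /eqP /(wemb_eq0 char0 gp) ->.
  by apply: contra q0 => /eqP /(wemb_eq0 char0 gq) ->.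
- move=> i; rewrite -!wderiv_wd !wderiv_wemb ?size_wd //.
  by rewrite -(rmorphM (wemb d)) fg rmorphM.
have projE H : wproj d (horner_alg A H) = horner_alg (wproj d A) H.
  rewrite /horner_alg /horner_morph -(horner_map (wproj d)) -map_poly_comp.
  congr _.[_]; apply: eq_map_poly => c /=.
  by rewrite wprojZ rmorph1.
exists (wproj d A); split.
  by exists F1; rewrite -projE -fE (wembK char0 gf).
by exists G1; rewrite -projE -gE (wembK char0 gg).
Qed.

End ProportionalDiff.

(** * Fox calculus: Poisson freeness from left independence *)

Section Fox.
Variables (k : fieldType) (P : poissonType k).

Definition env_act (u : envelope P) (p : P) : P := eexpr_act (repr u) p.

Lemma env_act_class a p : env_act (env_class a) p = eexpr_act a p.
Proof. exact: (eexpr_act_eq (env_repr_class a)). Qed.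

Lemma env_actD u v p : env_act (u + v) p = env_act u p + env_act v p.
Proof. by elim/env_ind: u => a; elim/env_ind: v => b; rewrite env_classD !env_act_class. Qed.

Lemma env_actM u v p : env_act (u * v) p = env_act u (env_act v p).
Proof. by elim/env_ind: u => a; elim/env_ind: v => b; rewrite env_classM !env_act_class. Qed.

Lemma env_act0l p : env_act 0 p = 0.
Proof. by rewrite -[0 in LHS]/(env_class (EScal P 0)) env_act_class /= scale0r. Qed.

Lemma env_act0r u : env_act u 0 = 0.
Proof. by have := eexpr_actZ (repr u) 0 0; rewrite !scale0r. Qed.

Lemma env_act_h f p : env_act (env_h f) p = bracket f p.
Proof. by rewrite env_act_class. Qed.

Lemma env_act_m f p : env_act (env_m f) p = f * p.
Proof. by rewrite env_act_class. Qed.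

Lemma env_act_sum (I : Type) (r : seq I) (F : I -> envelope P) p :
  env_act (\sum_(i <- r) F i) p = \sum_(i <- r) env_act (F i) p.
Proof.
by elim: r => [|i r IH]; rewrite ?big_nil ?env_act0l // !big_cons env_actD IH.
Qed.

Variables (m : nat) (f : 'I_m -> P).

Lemma word_sum_rcons (V : zmodType) r (phi : seq 'I_m -> V) :
  word_sum r.+1 phi = \sum_i word_sum r (fun w => phi (rcons w i)).
Proof.
elim: r phi => [|r IH] phi //; rewrite -[LHS]/(\sum_i word_sum r.+1 _).
by rewrite [RHS]exchange_big; apply: eq_bigr => i _; rewrite IH.
Qed.

(* The words in the H(f_i) are independent over P as soon as the H(f_i) are left
   independent: evaluation at 1 kills every word except the empty one. *)
Lemma hword_independent D (q : seq 'I_m -> P) :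
  ~ left_dependent (fun i => env_h (f i)) ->
  \sum_(l < D) word_sum l (fun w => env_m (q w) * hword f w) = 0 ->
  forall w, (size w < D)%N -> q w = 0.
Proof.
move=> indep; elim: D q => [|D IH] q E //.
(* The nonempty words are grouped by their last letter, so the relation reads m(q []) plus a left
   combination of the H(f_i). *)
pose X i := \sum_(l < D) word_sum l (fun w => env_m (q (rcons w i)) * hword f w).
have {}E : env_m (q [::]) + \sum_i X i * env_h (f i) = 0.
  rewrite -[RHS]E big_ord_recl; congr (_ + _); first by rewrite /= mulr1.
  under eq_bigr => i _ do rewrite /X mulr_suml.
  rewrite exchange_big; apply: eq_bigr => l _; rewrite lift0 word_sum_rcons; apply: eq_bigr => i _.
  rewrite (raddf_word_sum (f := *%R^~ _)) ?mul0r //; last first.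
    by move=> y z; rewrite mulrDl.
  by apply: eq_word_sum => w _ /=; rewrite -cats1 hword_cat /= mulr1 mulrA.
have q0 : q [::] = 0.
  have := congr1 (env_act^~ 1) E; rewrite env_actD env_act0l env_act_m mulr1.
  rewrite env_act_sum big1 ?addr0 // => i _.
  by rewrite env_actM env_act_h bracket1r env_act0r.
have X0 i : X i = 0.
  apply/eqP; apply: contrapT => Xi; apply: indep; exists X; split.
    by exists i; apply/negP.
  by move: E; rewrite q0 env_m0 add0r.
move=> w; case/lastP: w => [|w i] //; rewrite size_rcons ltnS.
by apply: (IH (fun w => q (rcons w i))); apply: X0.
Qed.

Lemma lie_coef_in_alg (A : comAlgType k) (t : lie_tree m) w :
  lie_coef A t w = (lie_coef k t w)%:A.
Proof.
rewrite /lie_coef -[RHS]/(in_alg A _) raddf_tsum; last exact: (rmorphB (in_alg A)).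
by apply: eq_tsum => u _ /=; rewrite /wdelta; case: eqP; rewrite ?scale1r ?scale0r.
Qed.

End Fox.

Section FoxFree.
Variables (k : fieldType) (char0 : [pchar k] =i pred0) (P : poissonType k) (m : nat).
Local Notation Y := (freePoisson k m).

(** The differential of a Lie monomial has scalar coefficients, so the bound d is not raised and can
    stay fixed in an induction. *)
Lemma lie_gen_diff d (u : Y) w : lie_gen d u -> lie_gen d (diff u w).
Proof.
have gA (c : k) : lie_gen d (c%:A : Y) by apply: lie_gen_scal.
elim=> [c|t _|u1 v1 g1 IH1 g2 IH2|u1 v1 g1 IH1 g2 IH2].
- by rewrite diffA -(scale0r 1).
- suff -> : diff (tree_br (@fpX k m) t) w = lie_coef Y t w.
    by rewrite lie_coef_in_alg.
  elim: t w => [i|s IHs t IHt] w /=; first by rewrite diffX.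
  rewrite diffB IHs IHt !bracket_lie_coef subrr add0r lie_coef_node.
  by rewrite (funext IHs) (funext IHt).
- by rewrite diffD; apply: lie_genD.
- by rewrite diffM; apply: lie_genD; apply: lie_genM.
Qed.

Variable f : 'I_m -> P.
Local Notation phi := (fp_lift f).
Hypothesis indep : ~ left_dependent (fun i => env_h (f i)).

Lemma lie_form_env_words (s : seq (Y * lie_tree m)) D :
  (forall p, List.In p s -> (tdeg p.2 < D)%N) ->
  lie_form_env f s
  = \sum_(l < D) word_sum l (fun w => env_m (phi (lie_form s w)) * hword f w).
Proof.
elim: s => [|p s IH] sD.
  rewrite /lie_form_env big_nil big1 // => l _.
  rewrite -[RHS](word_sum0 m _ l); apply: eq_word_sum => w _.
  by rewrite /lie_form big_nil rmorph0 env_m0 mul0r.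
rewrite /lie_form_env big_cons -/(lie_form_env f s) IH => [|q qs]; last by apply: sD; right.
transitivity (\sum_(l < D)
    (word_sum l (fun w => env_m (phi (p.1 * lie_coef Y p.2 w)) * hword f w)
    + word_sum l (fun w => env_m (phi (lie_form s w)) * hword f w))); last first.
  apply: eq_bigr => l _; rewrite -word_sumD; apply: eq_word_sum => w _.
  by rewrite /lie_form big_cons rmorphD env_mD mulrDl.
rewrite big_split /=; congr (_ + _).
have pD : (tdeg p.2 < D)%N by apply: sD; left.
rewrite (bigD1 (Ordinal pD)) //= [X in _ + X]big1 ?addr0 => [|l lp].
  rewrite (tsum_word_sum (A := k)).
  rewrite (raddf_word_sum (f := *%R (env_m (phi p.1)))) ?mulr0 //; last exact: mulrDr.
  apply: eq_word_sum => w _ /=.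
  rewrite lie_coef_in_alg rmorphM /= linearZ rmorph1 env_mM env_mZ env_m1 /=.
  by rewrite -mulrA mulr_algl.
rewrite -[RHS](word_sum0 m _ l); apply: eq_word_sum => w wl.
rewrite lie_coef_size ?mulr0 ?rmorph0 ?env_m0 ?mul0r // wl.
by apply: contra lp => /eqP lp; apply/eqP/val_inj.
Qed.

(** The induction is on the degree of the polynomial [wemb d u] with d fixed: there the coefficients
    of the differential are partial derivatives, of smaller degree. *)
Lemma fp_lift_injective (u : Y) : phi u = 0 -> u = 0.
Proof.
have [d] := lie_gen_ex u; have [s] := ubnP (msize (wemb d u)).
elim: s => // s IH in u *; rewrite ltnS => us gu fu.
have diff0 w : (size w <= d)%N -> diff u w = 0.
  have [t [ut hu]] := diff_lie_form f u.
  (* D exceeds both the words to be tested, of length at most d, and all Lie monomials occurring in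
     the differential. *)
  have [D tD] : exists D, (d < D)%N /\ forall p, List.In p t -> (tdeg p.2 < D)%N.
    exists (d + \sum_(p <- t) tdeg p.2).+1; split; first by rewrite ltnS leq_addr.
    move=> p pt; rewrite ltnS; apply: leq_trans (leq_addl _ _).
    elim: (t) pt => //= q t' IHt [->|/IHt pt]; rewrite big_cons; first exact: leq_addr.
    by apply: leq_trans pt _; apply: leq_addl.
  have [dD {}tD] := tD; move=> wd_.
  have wD : (size w < D)%N by apply: leq_ltn_trans dD.
  have phi0 : phi (diff u w) = 0.
    rewrite ut; apply: (hword_independent indep (q := fun w => phi (lie_form t w)) _ wD).
    by rewrite -lie_form_env_words // -hu fu env_h0.
  case: s IH us => [|s] IH us.
    have u0 : wemb d u = 0 by apply/eqP; rewrite -msize_poly_eq0 -leqn0.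
    by rewrite (wemb_eq0 char0 gu u0) -(scale0r 1) diffA scale0r.
  apply: IH => //; last exact: lie_gen_diff.
  case: (wordP k d w) => [[i wE _]|[]]; last by rewrite ltnNge wd_.
  by rewrite -wderiv_wemb // wE wderiv_wd ltnS; apply: msize_mderiv.
have du i : (wemb d u)^`M(i) = 0.
  by rewrite -wderiv_wd wderiv_wemb ?size_wd // diff0 ?size_wd // rmorph0.
have uE := mpoly_deriv0 char0 du.
have uc : u = ((wemb d u)@_0%MM)%:A.
  rewrite -{1}(wembK char0 gu) {1}uE /wproj mmapC //.
move: fu; rewrite uc linearZ rmorph1 /= => /eqP.
by rewrite scaler_eq0 oner_eq0 orbF => /eqP ->; rewrite scale0r.
Qed.

(** The canonical map from the free algebra to the generated subalgebra is bijective: its image is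
    closed and contains the generators, and [fp_lift_injective] gives injectivity. Universality is
    transported along a chosen inverse. *)
Lemma left_independent_poisson_free : poisson_free f.
Proof.
pose A := poisson_subalg f.
pose psi : Y -> A := fp_lift (psub_gen f : 'I_m -> A).
have psi_val u : val (psi u) = phi u.
  elim/freePoisson_ind: u => [i|c|u v Eu Ev|u v Eu Ev|u v Eu Ev].
  - by rewrite /psi !fp_lift_class.
  - by rewrite /psi !linearZ !rmorph1.
  - by rewrite /psi !rmorphD /= -Eu -Ev.
  - by rewrite /psi !rmorphM /= -Eu -Ev.
  - by rewrite fp_lift_bracket -Eu -Ev /psi fp_lift_bracket.
have psi_surj (a : A) : exists u, psi u = a.
  suff [u ua] : exists u, phi u = val a.
    by exists u; apply: val_inj; rewrite -ua -psi_val.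
  pose S : {pred P} := fun p => `[< exists u, phi u = p >].
  have /asboolP // : val a \in S.
  have /poisson_spanP := valP a; apply.
    split; first split.
    - by apply/asboolP; exists 1; rewrite rmorph1.
    - move=> c p q /asboolP[u <-] /asboolP[v <-]; apply/asboolP.
      by exists (c *: u + v); rewrite linearP.
    - move=> p q /asboolP[u <-] /asboolP[v <-]; apply/asboolP.
      by exists (u * v); rewrite rmorphM.
    - move=> p q /asboolP[u <-] /asboolP[v <-]; apply/asboolP.
      by exists (bracket u v); rewrite fp_lift_bracket.
  by move=> i; apply/asboolP; exists (fpX k i); rewrite fp_lift_class.
have psi_inj u v : psi u = psi v -> u = v.
  move=> E; apply/eqP; rewrite -subr_eq0; apply/eqP/fp_lift_injective.
  by rewrite rmorphB /= -!psi_val E subrr.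
have psiP c u v : psi (c *: u + v) = c *: psi u + psi v by apply: linearP.
have psi1 : psi 1 = 1 by apply: rmorph1.
have psiD u v : psi (u + v) = psi u + psi v by apply: rmorphD.
have psiM u v : psi (u * v) = psi u * psi v by apply: rmorphM.
have psiA (c : k) : psi c%:A = c%:A by rewrite /psi linearZ rmorph1.
have psiB u v : psi (bracket u v) = bracket (psi u) (psi v) by apply: fp_lift_bracket.
have psiX i : psi (fpX k i) = psub_gen f i by apply: fp_lift_class.
have [inv invK] := choice psi_surj.
move=> Q y; pose ext (a : A) : Q := fp_lift y (inv a).
have ext_lin : linear ext.
  move=> c a b; rewrite /ext -linearP; congr (fp_lift y _); apply: psi_inj.
  by rewrite psiP !invK.
have ext_mul : monoid_morphism ext.
  split=> [|a b].
    rewrite /ext -[RHS](rmorph1 (fp_lift y)); congr (fp_lift y _); apply: psi_inj.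
    by rewrite psi1 invK.
  rewrite /ext -rmorphM; congr (fp_lift y _); apply: psi_inj.
  by rewrite psiM !invK.
pose LM := GRing.isLinear.Build k A Q _ ext ext_lin.
pose MM := GRing.isMonoidMorphism.Build A Q ext ext_mul.
pose extm : {lrmorphism A -> Q} := HB.pack ext LM MM.
exists extm; split=> [a b|i|th thB thX a].
- rewrite /= /ext -fp_lift_bracket; congr (fp_lift y _); apply: psi_inj.
  by rewrite psiB !invK.
- rewrite /= /ext -[RHS](fp_lift_class y (PVar k i)); congr (fp_lift y _); apply: psi_inj.
  by rewrite invK psiX.
rewrite /= /ext -{1}(invK a).
elim/freePoisson_ind: (inv a) => [i|c|u v Eu Ev|u v Eu Ev|u v Eu Ev].
- by rewrite psiX thX fp_lift_class.
- by rewrite psiA !linearZ !rmorph1.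
- by rewrite psiD !rmorphD /= Eu Ev.
- by rewrite psiM !rmorphM /= Eu Ev.
- by rewrite psiB thB Eu Ev fp_lift_bracket.
Qed.

End FoxFree.

Theorem theorem5 (k : fieldType) (char0 : [pchar k] =i pred0) (n : nat)
    (f g : freePoisson k n) :
  [<-> poisson_dependent (tnth [tuple f; g]);
       left_dependent (tnth [tuple env_h f; env_h g]);
       poly_dependent (tnth [tuple f; g]);
       exists a : freePoisson k n,
         (exists p : {poly k}, f = horner_alg a p)
         /\ (exists q : {poly k}, g = horner_alg a q);
       bracket f g = 0].
Proof.
have hE : (fun i => env_h (tnth [tuple f; g] i)) =1 tnth [tuple env_h f; env_h g].
  by move=> i; rewrite !(tnth_nth 0); case: i => [[|[|]]].
(* The circle behind the proof is (ii) => (iv) => (iii) => (v) => (ii); condition (i) is attached by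
   (i) => (ii) and (iii) => (i). *)
have ii_iv : left_dependent (tnth [tuple env_h f; env_h g]) ->
    exists a : freePoisson k n, (exists p : {poly k}, f = horner_alg a p)
      /\ (exists q : {poly k}, g = horner_alg a q).
  by move=> /(left_dependent_diff char0); apply: proportional_diff_luroth.
have iv_iii : (exists a : freePoisson k n,
      (exists p : {poly k}, f = horner_alg a p)
      /\ (exists q : {poly k}, g = horner_alg a q)) ->
    poly_dependent (tnth [tuple f; g]).
  by move=> [a [[p ->] [q ->]]]; apply: horner_alg_poly_dependent.
have iii_v : poly_dependent (tnth [tuple f; g]) -> bracket f g = 0.
  by apply: (poly_dependent_bracket char0) => u v; apply: freePoisson_domain.
have v_ii := @bracket0_left_dependent k (freePoisson k n) f g.
tfae.
- move=> dep; apply: contrapT => indep; apply: dep.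
  by apply: (left_independent_poisson_free char0); rewrite (funext hE).
- by move=> /ii_iv.
- by move=> /iii_v/v_ii/ii_iv.
- by move=> /iv_iii/iii_v.
- by move=> /v_ii/ii_iv/iv_iii/poly_dependent_poisson_dependent.
Qed.
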